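(* Let $\mathscr{D}$ be a nonnegative integer-valued random variable with $\mathbb{P}(\mathscr{D}>t)=\mathcal{L}(t)t^{-\gamma}$, where $\mathcal{L}$ is slowly varying at infinity and $1<\gamma<2$, and let $\mu=\mathbb{E}[\mathscr{D}]$. Let $\mathbf{D}_n=(D_1,\dots,D_n)$ be i.i.d. copies of $\mathscr{D}$ and let $\widehat{G}_n$ be the erased configuration model with degree sequence $\mathbf{D}_n$, with Pearson correlation coefficient $\widehat{r}_n$. Then there exists a slowly-varying function $\mathcal{L}_1$ such that, as $n\to\infty$, \[ \mu\,\mathcal{L}_1(n)\,n^{1-\frac{1}{\gamma}}\,\widehat{r}_n \xrightarrow{d} -\frac{\mathcal{S}_{\gamma/2}^2}{\mathcal{S}_{\gamma/3}}. \]
   Context: Configuration model (CM) with degree sequence $\mathbf{D}_n$: vertex $i\in\{1,\dots,n\}$ receives $D_i$ half-edges (if $L_n=\sum_i D_i$ is odd, one half-edge is added to one vertex; this correction is ignored), and all half-edges are paired uniformly at random, giving a multigraph $G_n$. The erased configuration model (ECM) $\widehat G_n$ is obtained from $G_n$ by removing all self-loops and replacing multiple edges between two vertices by a single edge. For a multigraph with degrees $d_i$, $\ell=\sum_i d_i$ and $x_{ij}$ the number of edges between $i$ and $j$ (self-loops counted twice), Pearson's correlation coefficient is \[ r=\frac{\sum_{i,j} x_{ij}d_id_j-\frac{1}{\ell}\big(\sum_i d_i^2\big)^2}{\sum_i d_i^3-\frac1\ell\big(\sum_i d_i^2\big)^2}; \] $\widehat r_n$ is this quantity computed on $\widehat G_n$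 (with its degrees $\widehat D_i$, edge indicators $\widehat X_{ij}$ and $\widehat L_n=\sum_i\widehat D_i$). Stable limits: let $\xi_1,\xi_2,\dots$ be i.i.d. exponential with mean 1, $\Gamma_i=\sum_{j=1}^i\xi_j$, and for integer $p\ge2$, $\mathcal{S}_{\gamma/p}=\sum_{i=1}^\infty\Gamma_i^{-p/\gamma}$, all defined from the same sequence $(\Gamma_i)$. *)

(* Defs.v *)
From HB Require Import structures.
From mathcomp Require Import all_boot all_order all_algebra all_fingroup.
From mathcomp Require Import all_classical all_reals all_analysis.

Set Implicit Arguments.
Unset Strict Implicit.
Unset Printing Implicit Defensive.

Import Order.TTheory GRing.Theory Num.Theory.
Import numFieldNormedType.Exports.

Local Open Scope classical_set_scope.
Local Open Scope ring_scope.

Definition mutually_independent {d d'} {T : measurableType d}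
  {T' : measurableType d'} {R : realType} (P : probability T R)
  (X : nat -> T -> T') : Prop :=
  forall (J : seq nat) (B : nat -> set T'),
    uniq J -> (forall j, j \in J -> measurable (B j)) ->
    P [set w | forall j, j \in J -> B j (X j w)] =
    (\big[*%E/1%E]_(j <- J) P (X j @^-1` B j))%E.

Definition slowly_varying {R : realType} (L : R -> R) : Prop :=
  measurable_fun [set: R] L /\
  (\forall t \near +oo, 0 < L t) /\
  (forall lam : R, 0 < lam -> (L (lam * t) / L t) @[t --> +oo] --> (1 : R)).

(* x i j = number of edges between i and j (self-loops counted twice), *)
Definition pearson {R : realType} (n : nat) (x : 'I_n -> 'I_n -> R)
  (deg : 'I_n -> R) : R :=
  let l := \sum_i deg i in
  let s2 := \sum_i deg i ^+ 2 in
  let s3 := \sum_i deg i ^+ 3 in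
  ((\sum_i \sum_j x i j * deg i * deg j) - s2 ^+ 2 / l) /
  (s3 - s2 ^+ 2 / l).

(* Degrees after the parity correction: if the total degree is odd,
   one half-edge is added to vertex 0. *)
Definition cm_deg (n : nat) (d : 'I_n -> nat) (i : 'I_n) : nat :=
  (d i + ((odd (\sum_(k < n) d k)) && (val i == 0)%N))%N.

(* Total number of half-edges L_n (even when n > 0). *)
Definition cm_L (n : nat) (d : 'I_n -> nat) : nat :=
  (\sum_(i < n) cm_deg d i)%N.

(* Half-edges are 0, ..., L_n - 1; vertex v owns the half-edges
   numbered from sum_{u<v} d'_u to sum_{u<=v} d'_u - 1.  The owner of
   half-edge h is the number of vertices v with sum_{u<=v} d'_u <= h. *)
Definition cm_owner (n : nat) (d : 'I_n -> nat) (h : nat) : nat :=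
  #|[pred v : 'I_n | (\sum_(u < n | (u <= v)%N) cm_deg d u <= h)%N]|.

Definition cm_is_pairing (n : nat) (d : 'I_n -> nat)
  (s : {perm 'I_(cm_L d)}) : bool :=
  [forall h, (s h != h) && (s (s h) == h)].

(* Number of edges between i and j in the multigraph G_n given by the
   pairing s (self-loops counted twice): number of half-edges h of i
   paired with a half-edge of j. *)
Definition cm_x (n : nat) (d : 'I_n -> nat) (s : {perm 'I_(cm_L d)})
  (i j : 'I_n) : nat :=
  #|[pred h : 'I_(cm_L d) | (cm_owner d h == i) && (cm_owner d (s h) == j)]|.

Definition ecm_x (n : nat) (d : 'I_n -> nat) (s : {perm 'I_(cm_L d)})
  (i j : 'I_n) : nat :=
  ((i != j) && (0 < cm_x s i j)%N)%N.

Definition ecm_deg (n : nat) (d : 'I_n -> nat) (s : {perm 'I_(cm_L d)})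
  (i : 'I_n) : nat := (\sum_(j < n) ecm_x s i j)%N.

Definition ecm_pearson {R : realType} (n : nat) (d : 'I_n -> nat)
  (s : {perm 'I_(cm_L d)}) : R :=
  pearson (fun i j => (ecm_x s i j)%:R) (fun i => (ecm_deg s i)%:R).

(* Average of g over a uniformly random pairing of the half-edges
   (the conditional expectation given the degree sequence). *)
Definition cm_avg {R : realType} (n : nat) (d : 'I_n -> nat)
  (g : {perm 'I_(cm_L d)} -> R) : R :=
  (\sum_(s | cm_is_pairing s) g s) /
  (#|[pred s : {perm 'I_(cm_L d)} | cm_is_pairing s]|)%:R.

(* E[ f(a * \hat r_n) ] for the ECM with degree sequence (D_0,...,D_{n-1}),
   the D_i being random variables on the probability space P. *)
Definition ecm_expect {d} {T : measurableType d} {R : realType}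
  (P : probability T R) (D : nat -> T -> nat) (n : nat) (a : R)
  (f : R -> R) : \bar R :=
  'E_P[(fun w => @cm_avg R n (fun i => D (val i) w)
                   (fun s => f (a * ecm_pearson s)))%R]%E.

(* Gamma_{i+1} = xi_0 + ... + xi_i  (so Gamma_k, k >= 1, is gam (k-1)). *)
Definition gam {T : Type} {R : realType} (xi : nat -> T -> R) (i : nat)
  (w : T) : R := \sum_(j < i.+1) xi j w.

(* S_{gamma/p} = sum_{k>=1} Gamma_k^{-p/gamma}, a series of nonnegative
   terms, taken in the extended reals (it is a.s. finite). *)
Definition stable_S {T : Type} {R : realType} (xi : nat -> T -> R)
  (gamma : R) (p : nat) (w : T) : \bar R :=
  (\sum_(i <oo) ((gam xi i w) `^ (- (p%:R / gamma)))%:E)%E.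

Definition stable_limit {T : Type} {R : realType} (xi : nat -> T -> R)
  (gamma : R) (w : T) : R :=
  - (fine (stable_S xi gamma 2 w)) ^+ 2 / fine (stable_S xi gamma 3 w).

(* Main.v *)
Require Import Defs.
From HB Require Import structures.
From mathcomp Require Import all_boot all_order all_algebra all_fingroup.
From mathcomp Require Import all_classical all_reals all_analysis.
From mathcomp Require Import measurable_realfun ring lra.

(**
  Let [a_n] be the integer quantile of order [1 - 1/n] of the degree law and
  write [A_n = \sum_i (D_i/a_n)^2], [B_n = \sum_i (D_i/a_n)^3].  With
  [L1 n = n^(1/gamma) / a_n] the quantity of the theorem is
  [mu n/a_n * r_n = mu (N - A^2 n/l) / (B - A^2 a_n/l)], where [A], [B], [l] are
  computed from the erased degrees and [N = n a_n^(-4) \sum X_ij D_i D_j].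

  The Laplace transform of [(A_n, B_n)] converges to
  [exp (- \int_0^oo (1 - exp (- s x^(-2/gamma) - t x^(-3/gamma))) dx)],
  which is also that of the pair of stable series: both sides reduce to this
  integral, the first because [n E g(D) = \int_0^n g(a(n/x)) dx], the second
  because [G z = exp (- \int_z^oo (1 - kap))] solves [G z = E (kap G) (z + xi)].
  Bernstein polynomials in [exp (- A)], [exp (- B)] then give
  [E f (- A_n^2/B_n) -> E f (- S_2^2/S_3)].

  It remains to see that erasing edges is negligible.  Symmetry under
  conjugation bounds the factorial moments of [X_ij], so the conditional mean
  of the excess of [X_ij] over its indicator is at most [min z z^2 <= z^p] for
  [z] of order [D_i D_j / n], and [p < gamma] can be taken so close to [gamma]
  that the resulting sums, of order [n^(2-p)] and [n^(4-p)], are [o(a_n)] and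
  [o(a_n^4)].
*)

Set Implicit Arguments.
Unset Strict Implicit.
Unset Printing Implicit Defensive.

Import Order.TTheory GRing.Theory Num.Theory.
Import numFieldNormedType.Exports.

Local Open Scope classical_set_scope.
Local Open Scope ring_scope.

(** * Bounded random variables *)

(** The factor [mu] is cancelled by [l / n], which tends to [mu], and [A^2 a_n / l] vanishes because
    [a_n / n] does; this is why only [- A^2 / B] survives. The map [(a, b) |-> a^2 / b] is singular
    at [b = 0] and unbounded at infinity, so convergence of transforms does not apply to it
    directly. The mass in both regions is bounded by the transforms themselves: smallness of the
    Laplace exponent near 0 controls large values, and its unboundedness in [t] controls a small
    denominator. On the remaining compact set the ratio is a continuous function of [exp (- A)] and
    [exp (- B)], whose mixed moments are transforms at integer arguments. For the erasure neither of
    the two obvious moments is enough. Summing [z] over all pairs gives order [n], more than [a_n],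
    and [z^2] has infinite mean because the degrees have infinite variance. A power strictly between
    them has a finite mean and still gains over [n]. The pairing and the degrees never share a
    probability space: [cm_avg] averages over pairings for fixed degrees, and all estimates for it
    are deterministic in the degrees. *)

Definition Ex {d} {T : measurableType d} {R : realType} (P : probability T R)
  (X : T -> R) : R := fine (\int[P]_w (X w)%:E)%E.

(** Bounded measurable variables have real expectations, so limits and linear combinations can be
    handled in [R] without integrability side conditions. *)
Definition bmf {d} {T : measurableType d} {R : realType} (X : T -> R) : Prop :=
  measurable_fun [set: T] X /\ exists M : R, forall w, `|X w| <= M.

Section expectation.
Context {d} {T : measurableType d} {R : realType} (P : probability T R).
Implicit Types X Y : T -> R.

Lemma bmf_cst (c : R) : bmf (fun _ : T => c).
Proof. by split; [exact: measurable_cst|exists `|c|]. Qed.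

Lemma bmfD {X Y} : bmf X -> bmf Y -> bmf (fun w => X w + Y w).
Proof.
move=> [mX [M bX]] [mY [N bY]]; split; first exact: measurable_funD.
by exists (M + N) => w; rewrite (le_trans (ler_normD _ _))// lerD.
Qed.

Lemma bmfN {X} : bmf X -> bmf (fun w => - X w).
Proof.
move=> [mX [M bX]]; split; first exact: measurable_funN.
by exists M => w; rewrite normrN.
Qed.

Lemma bmfB {X Y} : bmf X -> bmf Y -> bmf (fun w => X w - Y w).
Proof. by move=> bX bY; apply: bmfD => //; exact: bmfN. Qed.

Lemma bmfM {X Y} : bmf X -> bmf Y -> bmf (fun w => X w * Y w).
Proof.
move=> [mX [M bX]] [mY [N bY]]; split; first exact: measurable_funM.
by exists (M * N) => w; rewrite normrM ler_pM.
Qed.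

Lemma bmfX {X} n : bmf X -> bmf (fun w => X w ^+ n).
Proof.
move=> bX; elim: n => [|n IH]; first exact: bmf_cst.
rewrite (_ : (fun w => _) = fun w => X w * X w ^+ n); first exact: bmfM.
by apply/funext => w; rewrite exprS.
Qed.

Lemma bmf_norm {X} : bmf X -> bmf (fun w => `|X w|).
Proof.
move=> [mX [M bX]]; split; first exact: measurableT_comp.
by exists M => w; rewrite normr_id.
Qed.

Lemma bmf_prod {I : Type} (r : seq I) (Q : pred I) (F : I -> T -> R) :
  (forall i, Q i -> bmf (F i)) -> bmf (fun w => \prod_(i <- r | Q i) F i w).
Proof.
move=> bF; elim: r => [|i r IH].
  rewrite (_ : (fun w => _) = fun=> 1); first exact: bmf_cst.
  by apply/funext => w; rewrite big_nil.
case Qi: (Q i).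
  rewrite (_ : (fun w => _) = fun w => F i w * \prod_(i <- r | Q i) F i w).
    by apply: bmfM => //; exact: bF.
  by apply/funext => w; rewrite big_cons Qi.
rewrite (_ : (fun w => _) = fun w => \prod_(i <- r | Q i) F i w)//.
by apply/funext => w; rewrite big_cons Qi.
Qed.

Lemma bmf_integrable {X} : bmf X -> P.-integrable setT (EFin \o X).
Proof.
move=> [mX [M bX]]; apply: measurable_bounded_integrable => //.
  by rewrite -ge0_fin_numE// fin_num_measure.
exists M; split; first exact: num_real.
by move=> x Mx w _ /=; rewrite (le_trans (bX w))// ltW.
Qed.

Lemma ExE {X} : bmf X -> (\int[P]_w (X w)%:E)%E = (Ex P X)%:E.
Proof.
by move=> /bmf_integrable iX; rewrite fineK//; exact: integrable_fin_num iX.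
Qed.

Lemma Ex_cst (c : R) : Ex P (fun _ => c) = c.
Proof.
by rewrite /Ex integral_cst//= probability_setT mule1.
Qed.

Lemma ExD {X Y} : bmf X -> bmf Y -> Ex P (fun w => X w + Y w) = Ex P X + Ex P Y.
Proof.
by move=> /bmf_integrable iX /bmf_integrable iY; exact: RintegralD.
Qed.

Lemma ExZ {X} (c : R) : bmf X -> Ex P (fun w => c * X w) = c * Ex P X.
Proof. by move=> /bmf_integrable iX; exact: RintegralZl. Qed.

Lemma ExB {X Y} : bmf X -> bmf Y -> Ex P (fun w => X w - Y w) = Ex P X - Ex P Y.
Proof.
by move=> /bmf_integrable iX /bmf_integrable iY; exact: RintegralB.
Qed.

Lemma Ex_le {X Y} : bmf X -> bmf Y -> (forall w, X w <= Y w) -> Ex P X <= Ex P Y.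
Proof.
by move=> /bmf_integrable iX /bmf_integrable iY XY; exact: le_Rintegral.
Qed.

Lemma Ex_ge0 {X} : (forall w, 0 <= X w) -> 0 <= Ex P X.
Proof. by move=> X0; rewrite /Ex fine_ge0// integral_ge0// => w _; rewrite lee_fin. Qed.

Lemma Ex_dist {X Y} : bmf X -> bmf Y ->
  `|Ex P X - Ex P Y| <= Ex P (fun w => `|X w - Y w|).
Proof.
move=> bX bY; rewrite -ExB//; apply: le_normr_Rintegral => //.
by apply: bmf_integrable; exact: bmfB.
Qed.

Lemma Ex_le_integral {X Y} (c : R) : bmf X -> measurable_fun setT Y ->
  (forall w, 0 <= X w <= Y w) -> (\int[P]_w (Y w)%:E <= c%:E)%E -> Ex P X <= c.
Proof.
move=> bX mY XY Yc; rewrite -lee_fin -ExE//; apply: le_trans Yc.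
apply: ge0_le_integral => //.
- by move=> w _; rewrite lee_fin; case/andP: (XY w).
- by apply/measurable_EFinP; case: bX.
- by apply/measurable_EFinP.
- by move=> w _; rewrite lee_fin; case/andP: (XY w).
Qed.

Lemma Ex_cvg (F : nat -> T -> R) X (M : R) :
  (forall n, measurable_fun setT (F n)) -> measurable_fun setT X ->
  (forall n w, `|F n w| <= M) ->
  {ae P, forall w, F n w @[n --> \oo] --> X w} ->
  Ex P (F n) @[n --> \oo] --> Ex P X.
Proof.
move=> mF mX bF cF.
have [| | | | |iX _] := @dominated_convergence _ _ _ P setT measurableT
  (fun n => EFin \o F n) (EFin \o X) (cst M%:E) _ _.
- by move=> n; exact/measurable_EFinP.
- exact/measurable_EFinP.
- apply: filterS cF => w cw _ /=.
  by apply/fine_cvgP; split; [exact: nearW|].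
- by apply: (@bmf_integrable (fun=> M)); exact: bmf_cst.
- by apply/aeW => w n _ /=; rewrite lee_fin.
move=> c; have /fine_cvgP[_ ] : (\int[P]_w (F n w)%:E)%E @[n --> \oo] --> (Ex P X)%:E; last by [].
by rewrite /Ex fineK//; exact: integrable_fin_num iX.
Qed.

Lemma Ex_ae_eq {X Y} : measurable_fun setT X -> measurable_fun setT Y ->
  {ae P, forall w, X w = Y w} -> Ex P X = Ex P Y.
Proof.
move=> mX mY XY; rewrite /Ex; congr fine; apply: ae_eq_integral => //.
- exact/measurable_EFinP.
- exact/measurable_EFinP.
- by apply: filterS XY => w /= -> _.
Qed.

End expectation.

(** * Independence *)

Section independence.
Context {d d' : measure_display} {T : measurableType d}
  {T' : measurableType d'} {R : realType} (P : probability T R).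
Variable X : nat -> T -> T'.
Hypothesis mX : forall i, measurable_fun [set: T] (X i).

Definition cyl (J : seq nat) (B : nat -> set T') : set T :=
  [set w | forall j, j \in J -> B j (X j w)].

(** Independence of a state [V], built from the variables before [k], and the variables from [k] on.
    Cylinders suffice as test events, and an arbitrary target for [V] lets an induction append one
    variable at a time to the state. *)
Definition indep_tail (k : nat) {d1} {T1 : measurableType d1} (V : T -> T1) :=
  forall (J : seq nat) (B : nat -> set T') (A : set T1),
    measurable A -> uniq J -> (forall j, j \in J -> (k <= j)%N) ->
    (forall j, j \in J -> measurable (B j)) ->
    P (V @^-1` A `&` cyl J B) =
    (P (V @^-1` A) * \big[*%E/1%E]_(j <- J) P (X j @^-1` B j))%E.

Lemma cyl_cons k J B : cyl (k :: J) B = X k @^-1` B k `&` cyl J B.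
Proof.
apply/seteqP; split=> [w h|w [h1 h2] j].
  by split; [apply: h; rewrite mem_head|move=> j jJ; apply: h; rewrite inE jJ orbT].
by rewrite inE => /predU1P[->//|]; exact: h2.
Qed.

Lemma cyl_nil B : cyl [::] B = setT.
Proof. by apply/seteqP; split=> // w _ j; rewrite in_nil. Qed.

Lemma measurable_cyl J B : (forall j, j \in J -> measurable (B j)) ->
  measurable (cyl J B).
Proof.
elim: J => [|k J IH] mB; first by rewrite cyl_nil.
rewrite cyl_cons; apply: measurableI.
  by rewrite -[X in measurable X]setTI; apply: mX => //; apply: mB; rewrite mem_head.
by apply: IH => j jJ; apply: mB; rewrite inE jJ orbT.
Qed.

Lemma indep_tail_cst {d1} {T1 : measurableType d1} (c : T1) :
  mutually_independent P X -> indep_tail 0 (fun=> c).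
Proof.
move=> iX J B A mA uJ _ mB; rewrite preimage_cst; case: ifPn => _.
  by rewrite setTI iX// probability_setT mul1e.
by rewrite set0I measure0 mul0e.
Qed.

Lemma indep_tail_comp k {d1 d2} {T1 : measurableType d1}
    {T2 : measurableType d2} (V : T -> T1) (g : T1 -> T2) :
  measurable_fun setT g -> indep_tail k V -> indep_tail k (g \o V).
Proof.
move=> mg iV J B A mA uJ kJ mB; rewrite comp_preimage; apply: iV => //.
by rewrite -[X in measurable X]setTI; exact: mg.
Qed.

Let probJ (J : seq nat) (B : nat -> set T') : R :=
  fine (\big[*%E/1%E]_(j <- J) P (X j @^-1` B j))%E.

Let prob_preimage j (B : set T') : measurable B ->
  (0 <= P (X j @^-1` B) <= 1)%E.
Proof.
move=> mB; rewrite measure_ge0 probability_le1//.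
by rewrite -[X in measurable X]setTI; exact: mX.
Qed.

Let probJE J B : (forall j, j \in J -> measurable (B j)) ->
  (\big[*%E/1%E]_(j <- J) P (X j @^-1` B j))%E = (probJ J B)%:E /\
  0 <= probJ J B.
Proof.
rewrite /probJ; elim: J => [|k J IH] mB; first by rewrite big_nil.
have [|-> h0] := IH; first by move=> j jJ; apply: mB; rewrite inE jJ orbT.
rewrite big_cons.
have /andP[p0 p1] : (0 <= P (X k @^-1` B k) <= 1)%E.
  by apply: prob_preimage; apply: mB; rewrite mem_head.
have [|-> _] := IH; first by move=> j jJ; apply: mB; rewrite inE jJ orbT.
have pf : P (X k @^-1` B k) \is a fin_num.
  by rewrite ge0_fin_numE// (le_lt_trans p1)// ltry.
rewrite -(fineK pf) -EFinM/=; split => //.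
by apply: mulr_ge0 => //; exact: fine_ge0.
Qed.

(** As functions of [A], both sides are finite measures on the product: the law of [(V, X k)]
    restricted to the cylinder, and that law scaled by the probability of the cylinder. They agree
    on rectangles, where independence is used for the list [k :: J], and rectangles form a
    generating pi-system. *)
Lemma indep_tail_step k {d1} {T1 : measurableType d1} (V : T -> T1) :
  measurable_fun setT V -> indep_tail k V ->
  indep_tail k.+1 (fun w => (V w, X k w)).
Proof.
move=> mV iV J B A mA uJ kJ mB.
set VX := fun w => (V w, X k w).
have mVX : measurable_fun setT VX by exact: measurable_fun_pair.
have [cE c0] := probJE mB; rewrite cE.
have mE := measurable_cyl mB.

pose m1f : {measure set (T1 * T')%type -> \bar R} :=
  pushforward (mrestr P mE) VX.
pose m1 := m1f mVX.
pose m2f : {measure set (T1 * T')%type -> \bar R} :=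
  mscale (NngNum c0) (pushforward P VX).
pose m2 := m2f mVX.
have k_notin : k \notin J by apply/negP => /kJ; rewrite ltnn.
pose C : set (set (T1 * T')) :=
  [set C | exists A, measurable A /\ exists B, measurable B /\ C = A `*` B].
suff : m1 A = m2 A.
  by move=> m12; rewrite muleC; exact: m12.
apply: (measure_unique C (fun n => setT)) => //.
- rewrite measurable_prod_measurableType //; congr (<<s _ >>).
  rewrite predeqE; split => [[A1 mA1 [B1 mB1 <-]]|[A1 [mA1 [B1 [mB1 ->]]]]].
    by exists A1; split => //; exists B1.
  by exists A1 => //; exists B1.
- move=> /= _ _ [X1 [mX1 [X2 [mX2 ->]]]] [Y1 [mY1 [Y2 [mY2 ->]]]].
  rewrite -setXI; exists (X1 `&` Y1); split; first exact: measurableI.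
  by exists (X2 `&` Y2); split => //; exact: measurableI.
- by move=> _; exists setT; split => //; exists setT; split => //; rewrite setXTT.
- by apply/seteqP; split => // w _; exists 0%N.
- move=> _ [A1 [mA1 [B1 [mB1 ->]]]].
  pose B' j := if j == k then B1 else B j.
  have B'J : {in J, B' =1 B}.
    by move=> j jJ; rewrite /B'; case: eqP => // jk; rewrite -jk jJ in k_notin.
  have kB : B' k = B1 by rewrite /B' eqxx.
  have cylJ : cyl J B = cyl J B'.
    by apply/seteqP; split => w h j jJ; move: (h j jJ); rewrite B'J.
  have mB' j : j \in k :: J -> measurable (B' j).
    rewrite inE => /predU1P[->|jJ]; first by rewrite kB.
    by rewrite B'J//; exact: mB.
  change (P (VX @^-1` (A1 `*` B1) `&` cyl J B) =
    ((probJ J B)%:E * P (VX @^-1` (A1 `*` B1)))%E).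
  have -> : VX @^-1` (A1 `*` B1) = V @^-1` A1 `&` X k @^-1` B1 by [].
  have e1 : P (V @^-1` A1 `&` X k @^-1` B1) = (P (V @^-1` A1) * P (X k @^-1` B1))%E.
    have := iV [:: k] B' A1 mA1 isT.
    rewrite cyl_cons cyl_nil setIT kB big_seq1 kB; apply.
      by move=> j; rewrite inE => /eqP ->.
    by move=> j; rewrite inE => /eqP ->; rewrite kB.
  rewrite -setIA cylJ e1 -{1}kB -cyl_cons iV//; last 2 first.
  + by rewrite /= k_notin.
  + by move=> j; rewrite inE => /predU1P[->//|/kJ/ltnW].
  rewrite big_cons kB muleA [RHS]muleC -cE; congr (_ * _)%E.
  by rewrite !big_seq; apply: eq_bigr => j jJ; rewrite B'J.
- move=> _; change (P (VX @^-1` setT `&` cyl J B) < +oo)%E.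
  rewrite preimage_setT setTI.
  by rewrite -ge0_fin_numE// fin_num_measure.
Qed.

(** Independence identifies the law of [(V, X k)] with the product of the two marginals; Tonelli
    does the rest. *)
Lemma indep_tail_integral k {d1} {T1 : measurableType d1} (V : T -> T1)
    (h : T1 * T' -> \bar R) :
  measurable_fun setT V -> indep_tail k V ->
  measurable_fun setT h -> (forall z, 0 <= h z)%E ->
  (\int[P]_w h (V w, X k w) = \int[P]_w \int[P]_w' h (V w, X k w'))%E.
Proof.
move=> mV iV mh h0.
pose fV := @MeasurableFun.Pack _ _ _ _ V
  (MeasurableFun.Class (isMeasurableFun.Build _ _ _ _ V mV)).
pose fX := @MeasurableFun.Pack _ _ _ _ (X k)
  (MeasurableFun.Class (isMeasurableFun.Build _ _ _ _ (X k) (mX k))).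
set VX := fun w => (V w, X k w).
have mVX : measurable_fun setT VX by exact: measurable_fun_pair.
pose fVX := @MeasurableFun.Pack _ _ _ _ VX
  (MeasurableFun.Class (isMeasurableFun.Build _ _ _ _ VX mVX)).
pose m1 : probability T1 R := distribution P fV.
pose m2 : probability T' R := distribution P fX.
pose m : probability (T1 * T')%type R := distribution P fVX.
transitivity (\int[m]_z h z)%E.
  by rewrite /m /distribution ge0_integral_pushforward//=.
have mE : (\int[m]_z h z = \int[(m1 \x m2)%E]_z h z)%E.
  apply: eq_measure_integral => /= A mA _; apply/esym.
  apply: (@product_measure_unique _ _ _ _ _ m1 m2 m) => // A1 B1 mA1 mB1.
  rewrite /m /m1 /m2 /distribution /pushforward/=.
  have := iV [:: k] (fun=> B1) A1 mA1 isT.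
  rewrite cyl_cons cyl_nil setIT big_seq1; apply.
    by move=> j; rewrite inE => /eqP ->.
  by move=> j _.
rewrite mE fubini_tonelli1//= /fubini_F.
rewrite /m1 /distribution ge0_integral_pushforward//=; last 2 first.
- exact: measurable_fun_fubini_tonelli_F.
- by move=> x _; apply: integral_ge0 => *; exact: h0.
apply: eq_integral => w _ /=.
rewrite /m2 /distribution ge0_integral_pushforward//=.
by apply: (measurableT_comp mh); exact: pair1_measurable.
Qed.

Lemma indep_tail_single i k : mutually_independent P X -> (i < k)%N ->
  indep_tail k (X i).
Proof.
move=> iX ik J B A mA uJ kJ mB.
have iJ : i \notin J by apply/negP => /kJ; rewrite leqNgt ik.
pose B' j := if j == i then A else B j.
have B'J : {in J, B' =1 B}.
  by move=> j jJ; rewrite /B'; case: eqP => // ji; rewrite -ji jJ in iJ.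
have iB : B' i = A by rewrite /B' eqxx.
have -> : cyl J B = cyl J B'.
  by apply/seteqP; split => w h j jJ; move: (h j jJ); rewrite B'J.
rewrite -{1}iB -cyl_cons [LHS]iX; last 2 first.
- by rewrite /= iJ.
- by move=> j; rewrite inE => /predU1P[->|jJ]; rewrite ?iB// B'J//; exact: mB.
rewrite big_cons iB; congr (_ * _)%E.
by rewrite !big_seq; apply: eq_bigr => j jJ; rewrite B'J.
Qed.

Lemma indep_pair_integral i j (g h : T' -> \bar R) :
  mutually_independent P X -> (i < j)%N ->
  measurable_fun setT g -> measurable_fun setT h ->
  (forall x, 0 <= g x)%E -> (forall x, 0 <= h x)%E ->
  (\int[P]_w (g (X i w) * h (X j w)) =
   \int[P]_w g (X i w) * \int[P]_w h (X j w))%E.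
Proof.
move=> iX ij mg mh g0 h0.
rewrite (@indep_tail_integral j _ _ (X i) (fun z => (g z.1 * h z.2)%E))//=.
- under eq_integral => w _.
    rewrite ge0_integralZl//; last exact: measurableT_comp.
    over.
  rewrite ge0_integralZr//; first exact: measurableT_comp.
  exact: integral_ge0.
- exact: indep_tail_single.
- apply: emeasurable_funM; first exact: (measurableT_comp mg).
  exact: (measurableT_comp mh).
- by move=> z; exact: mule_ge0.
Qed.

Lemma indep_tail_ExM k (V : T -> R) (h : T' -> R) :
  indep_tail k V -> bmf V -> (forall w, 0 <= V w) ->
  measurable_fun setT h -> (forall x, 0 <= h x <= 1) ->
  Ex P (fun w => V w * h (X k w)) = Ex P V * Ex P (h \o X k).
Proof.
move=> iV bV V0 mh h01.
have h0 x : 0 <= h x by case/andP: (h01 x).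
have bh : bmf (h \o X k).
  split; first exact: measurableT_comp.
  by exists 1 => w; rewrite ger0_norm ?h0//; case/andP: (h01 (X k w)).
have mV : measurable_fun setT V by case: bV.
(* The kernel in [indep_tail_integral] must be nonnegative everywhere, not only on the range of [V];
   truncating at 0 achieves this without changing any value taken. *)
have V0' : forall w, (0 <= (Num.max (V w) 0)%:E)%E.
  by move=> w; rewrite lee_fin le_max lexx orbT.
apply: EFin_inj; rewrite EFinM -!ExE//; last exact: bmfM.
transitivity (\int[P]_w ((Num.max (V w) 0)%:E * (h (X k w))%:E))%E.
  by apply: eq_integral => w _; rewrite max_l.
rewrite (@indep_tail_integral k _ _ V
  (fun z => ((Num.max z.1 0)%:E * (h z.2)%:E)%E))//=.
- under eq_integral => w _.
    rewrite ge0_integralZl//; last 2 first.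
    + by apply/measurable_EFinP; case: bh.
    + by move=> w' _; rewrite lee_fin.
    over.
  rewrite ge0_integralZr//=.
  + by congr (_ * _)%E; apply: eq_integral => w _; rewrite max_l.
  + by apply/measurable_EFinP; apply: measurable_maxr.
  + by apply: integral_ge0 => w _; rewrite lee_fin; exact: h0.
- apply: emeasurable_funM; apply/measurable_EFinP; last exact: (measurableT_comp mh).
  by apply: measurable_maxr => //; exact: measurable_cst.
- by move=> z; rewrite mule_ge0// lee_fin ?h0// le_max lexx orbT.
Qed.

Lemma indep_Ex_prod n (h : nat -> T' -> R) : mutually_independent P X ->
  (forall i, measurable_fun setT (h i)) -> (forall i x, 0 <= h i x <= 1) ->
  Ex P (fun w => \prod_(i < n) h i (X i w)) = \prod_(i < n) Ex P (h i \o X i).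
Proof.
move=> iX mh h01.
have bh i : bmf (h i \o X i).
  split; first exact: measurableT_comp.
  exists 1 => w /=; case/andP: (h01 i (X i w)) => h0 h1.
  by rewrite ger0_norm.
pose V n w := \prod_(i < n) h i (X i w).
have bV m : bmf (V m) by apply: bmf_prod => i _; exact: bh.
have V0 m w : 0 <= V m w.
  by apply: prodr_ge0 => i _; case/andP: (h01 i (X i w)).
(* The independence of the partial product is carried along with its mean, since the next factor is
   split off by means of it. *)
suff [_ ->] : indep_tail n (V n) /\ Ex P (V n) = \prod_(i < n) Ex P (h i \o X i) by [].
elim: n => [|n [IHi IHe]].
  rewrite big_ord0 (_ : V 0%N = fun=> 1); last first.
    by apply/funext => w; rewrite /V big_ord0.
  by split; [exact: indep_tail_cst|exact: Ex_cst].
have VS : V n.+1 = fun w => V n w * h n (X n w).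
  by apply/funext => w; rewrite /V big_ord_recr.
split; last by rewrite big_ord_recr -IHe VS indep_tail_ExM.
rewrite (_ : V n.+1 = (fun z : R * T' => z.1 * h n z.2) \o (fun w => (V n w, X n w)))//.
apply: indep_tail_comp.
  by apply: measurable_funM => //; exact: (measurableT_comp (mh n)).
by apply: indep_tail_step => //; case: (bV n).
Qed.

End independence.

(** * Integration against the exponential law *)

Section exponential_law.
Context {d} {T : measurableType d} {R : realType} (P : probability T R).
Local Notation mu := (@lebesgue_measure R).

Let ltr01R : 0 < 1 :> R := ltr01.
Let eP : probability (measurableTypeR R) R.
Proof.
pose f : probability (measurableTypeR R) R := exponential_prob 1.
exact (f ltr01R).
Defined.

Let eP_dom : eP `<< mu.
Proof.
apply/null_content_dominatesP => A mA muA0.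
rewrite /eP/= /exponential_prob.
apply: null_set_integral => //.
apply/measurable_EFinP; apply: measurable_funTS; exact: measurable_exponential_pdf.
Qed.

Let integral_eP (f : R -> \bar R) : measurable_fun setT f ->
  (\int[eP]_x `|f x| < +oo)%E ->
  (\int[eP]_x f x = \int[mu]_x (f x * (exponential_pdf 1 x)%:E))%E.
Proof.
move=> mf finf.
rewrite -(Radon_Nikodym_change_of_variables eP_dom)//=; last first.
  by apply/integrableP; split.
apply: ae_eq_integral => //.
- by apply: emeasurable_funM.
- by apply: emeasurable_funM => //; apply/measurable_EFinP; exact: (measurable_exponential_pdf 1).
- suff : ae_eq mu setT (Radon_Nikodym (charge_of_finite_measure eP) mu)
      (EFin \o exponential_pdf 1).
    by apply: filterS => x /= h _; rewrite h.
  rewrite (@Radon_NikodymE _ _ _ (charge_of_finite_measure eP) mu eP_dom)/=; case: cid => /= h [h1 h2 h3].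
  apply: integral_ae_eq => //=.
  + by apply/measurable_EFinP; exact: (measurable_exponential_pdf 1).
  + by move=> E E01 mE; rewrite -h3.
Qed.

(** The law is known only through its values on measurable sets; [integral_eP] recovers the density
    as a Radon-Nikodym derivative, which vanishes off [[0, +oo[]. *)
Lemma Ex_exponential (X : T -> R) (h : R -> R) : measurable_fun setT X ->
  (forall A, measurable A -> P (X @^-1` A) = exponential_prob 1 A) ->
  bmf h ->
  (\int[P]_w (h (X w))%:E =
   \int[mu]_(x in `[0%R, +oo[) (h x * expR (- x))%:E)%E.
Proof.
move=> mX lX bh.
have mh : measurable_fun setT h by case: bh.
pose fX : {mfun T >-> measurableTypeR R} := @MeasurableFun.Pack _ _ _ (measurableTypeR R) X
  (MeasurableFun.Class (isMeasurableFun.Build _ _ _ (measurableTypeR R) X mX)).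
have ih : P.-integrable setT ((EFin \o h) \o X).
  apply: (@bmf_integrable _ _ _ P (h \o X)).
  split; first exact: measurableT_comp.
  by case: bh => _ [M bM]; exists M => w /=.
have -> : (\int[P]_w (h (X w))%:E = \int[distribution P fX]_x (h x)%:E)%E.
  by rewrite integral_distribution//; exact/measurable_EFinP.
have -> : (\int[distribution P fX]_x (h x)%:E = \int[eP]_x (h x)%:E)%E.
  apply: eq_measure_integral => A mA _; exact: lX.
have /integrableP[_ h2] := bmf_integrable eP bh.
rewrite integral_eP//; last exact/measurable_EFinP.
rewrite [RHS]integral_mkcond/=; apply: eq_integral => x _.
rewrite /exponential_pdf !patchE; case: ifPn => _; last by rewrite mule0.
by rewrite mulN1r mul1r EFinM.
Qed.

End exponential_law.

(** * The Laplace functional of the points Gamma_i *)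

Section laplace_functional.
Context {R : realType}.
Local Notation mu := (@lebesgue_measure R).
Variable kap : R -> R.
Hypothesis kapc : continuous kap.
Hypothesis kap01 : forall x, 0 <= kap x <= 1.
Hypothesis kap_fin : (\int[mu]_(x in `[0%R, +oo[) (1 - kap x)%:E < +oo)%E.

Let g x := 1 - kap x.

Let g01 x : 0 <= g x <= 1.
Proof. by rewrite /g; have := kap01 x; lra. Qed.

Let gc : continuous g.
Proof. by move=> x; apply: cvgB; [exact: cvg_cst|exact: kapc]. Qed.

Let mg (D : set R) : measurable_fun D g.
Proof. by apply: measurable_funTS; exact: continuous_measurable_fun. Qed.

Let ig z : mu.-integrable `[z, +oo[ (EFin \o g).
Proof.
apply/integrableP; split; first by apply/measurable_EFinP; exact: mg.
have gn x : `|g x| = g x by rewrite ger0_norm//; case/andP: (g01 x).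
under eq_integral => x _ do rewrite /= gn.
have [z0|z0] := leP 0 z.
  apply: le_lt_trans kap_fin; apply: ge0_subset_integral => //=.
  - by apply/measurable_EFinP; exact: mg.
  - by move=> x _; rewrite lee_fin; case/andP: (g01 x).
  - by apply: subset_itvr; rewrite bnd_simp.
(* For negative [z] the extra stretch up to 0 has finite length and an integrand at most 1. *)
rewrite (@itv_bndbnd_setU _ _ _ (BLeft 0))//=; last by rewrite bnd_simp ltW.
rewrite ge0_integral_setU//=.
- apply: lte_add_pinfty; last exact: kap_fin.

  apply: (@le_lt_trans _ _ (\int[mu]_(x in `[z, 0%R[) 1%:E)%E).
    apply: ge0_le_integral => //=.
    + by move=> x _; rewrite lee_fin; case/andP: (g01 x).
    + by apply/measurable_EFinP; exact: mg.
    + by move=> x _; rewrite lee_fin; case/andP: (g01 x).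
  by rewrite integral_cst//= mul1e lebesgue_measure_itv/=; case: ifP => _; rewrite ?ltry.
- by apply/measurable_EFinP; exact: mg.
- by move=> x _; rewrite lee_fin; case/andP: (g01 x).
- apply/disj_setPS => x [] /=; rewrite !in_itv/= => /andP[_ x0].
  by rewrite andbT leNgt x0.
Qed.

Definition tailI (z : R) : R := \int[mu]_(t in `[z, +oo[) (1 - kap t).

Let tailI_ge0 z : 0 <= tailI z.
Proof. by apply: Rintegral_ge0 => x _; case/andP: (g01 x). Qed.

Let tailI_split a z : a <= z ->
  tailI z = tailI a - \int[mu]_(t in `[a, z]) g t.
Proof.
move=> az; rewrite /tailI.
rewrite (@Rintegral_itvB _ g (BLeft a) +oo%O z)//.
  rewrite Rintegral_itv_obnd_cbnd//.
  by apply: integrableS (ig z) => //; apply: subset_itvr; rewrite bnd_simp.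
Qed.

Let is_derive_tailI (z : R) : is_derive z (1 : R) tailI (- g z).
Proof.
have gz : {for z, continuous g} by exact: gc.
(* A base point below [z] writes the tail near [z] as a constant minus an integral with variable
   upper end, to which the fundamental theorem applies. *)
pose a := z - 1.
pose F x := \int[mu]_(t in `[a, x]) g t.
have [|||dF DF] := @continuous_FTC1_closed R g a z (z + 1) _ _ _ gz.
- by rewrite ltrDl.
- by apply: integrableS (ig a) => //; apply: subset_itvl; rewrite bnd_simp.
- by rewrite /a ltrBlDr ltrDl.
have isF : is_derive z (1 : R) F (g z).
  by split; [exact: dF|rewrite -derive1E].
apply: (@near_eq_is_derive _ _ _ (fun x => tailI a - F x)).
  near=> x; rewrite [RHS](@tailI_split a)//.
  apply: ltW; near: x; apply: lt_nbhsr.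
  by rewrite /a ltrBlDr ltrDl.
rewrite -[X in is_derive _ _ _ X]add0r.
exact: is_deriveB.
Unshelve. all: by end_near. Qed.

(* [tailG v] is the mean of [\prod_i kap (v + Gamma_i)]; conditioning on Gamma_1
   gives the renewal equation [tailG_eq], which is all that is used. *)
Definition tailG (z : R) : R := expR (- tailI z).

Let is_derive_tailG (z : R) : is_derive z (1 : R) tailG (g z * tailG z).
Proof.
rewrite -[g z]opprK mulrC.
have h : is_derive z (1 : R) (fun z => - tailI z) (- (- g z)) by exact: is_deriveN.
exact: (@is_derive1_comp _ expR (fun z => - tailI z)).
Qed.

Lemma tailG_le1 z : tailG z <= 1.
Proof. by rewrite /tailG expR_le1 oppr_le0. Qed.

Lemma tailG_gt0 z : 0 < tailG z.
Proof. exact: expR_gt0. Qed.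

Lemma continuous_tailG : continuous tailG.
Proof.
move=> z; apply/differentiable_continuous/derivable1_diffP.
exact: (@ex_derive _ _ _ _ _ _ _ (is_derive_tailG z)).
Qed.

(** Since [G' = (1 - kap) G], the function [- exp (- x) G (v + x)] has derivative [kap G exp (- x)];
    it tends to 0 at infinity because [G <= 1], and equals [- G v] at 0. *)
Lemma tailG_eq v : (\int[mu]_(x in `[0%R, +oo[)
  (kap (v + x) * tailG (v + x) * expR (- x))%:E = (tailG v)%:E)%E.
Proof.
pose F x := - (expR (- x) * tailG (v + x)).
have isF (x : R) : is_derive x (1 : R) F (kap (v + x) * tailG (v + x) * expR (- x)).
  have h1 : is_derive x (1 : R) (fun x : R => expR (- x)) (- expR (- x)).
    rewrite -[X in is_derive _ _ _ X]mulrN1.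
    by apply: (@is_derive1_comp _ expR (fun x => - x)); exact: is_deriveN.
  have h2 : is_derive x (1 : R) (fun x : R => tailG (v + x)) (g (v + x) * tailG (v + x)).
    rewrite -[X in is_derive _ _ _ X]mulr1.
    apply: (@is_derive1_comp _ tailG (fun x => v + x)).
      exact: is_derive_tailG.
    rewrite (_ : (fun x => v + x) = shift v); first exact: is_derive_shift.
    by apply/funext => y; rewrite /= addrC.
  have h3 := is_deriveN (is_deriveM h1 h2).
  apply: is_derive_eq h3 _; rewrite /g /GRing.scale/=; ring.
rewrite (@ge0_continuous_FTC2y _ _ F 0 0)//.
- by rewrite /F oppr0 expR0 addr0 mul1r EFinN oppeK add0e.
- move=> x _; apply: mulr_ge0; last exact: expR_ge0.
  by apply: mulr_ge0; [case/andP: (kap01 (v + x))|rewrite ltW// tailG_gt0].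
- apply: continuous_subspaceT => x.
  have cv : {for x, continuous (fun x => v + x)}.
    by apply: cvgD; [exact: cvg_cst|exact: cvg_id].
  apply: cvgM; first apply: cvgM.
  + by apply: (@continuous_comp _ _ _ (fun x => v + x) kap) => //; exact: kapc.
  + by apply: (@continuous_comp _ _ _ (fun x => v + x) tailG) => //; exact: continuous_tailG.
  + apply: (@continuous_comp _ _ _ (fun x => - x) expR); last exact: continuous_expR.
    by apply: cvgN; exact: cvg_id.
- apply/cvgrPdist_le => e e0.
  have := @cvgr_expR R; move/cvgrPdist_le => /(_ e e0).
  apply: filterS => x; rewrite !sub0r !normrN => h; apply: le_trans h.
  rewrite normrM ger0_norm ?expR_ge0// ler_piMr ?expR_ge0//.
  by rewrite ger0_norm ?tailG_le1// ltW// tailG_gt0.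
- apply: cvg_at_right_filter; apply/differentiable_continuous/derivable1_diffP.
  exact: (@ex_derive _ _ _ _ _ _ _ (isF 0)).
- move=> x _; rewrite derive1E.
  exact: (@derive_val _ _ _ _ _ _ _ (isF x)).
Qed.

Lemma tailG_nd : {homo tailG : x y / x <= y}.
Proof.
move=> x y xy; rewrite /tailG ler_expR lerN2 (tailI_split xy) gerBl.
by apply: Rintegral_ge0 => t _; case/andP: (g01 t).
Qed.

Lemma tailG_cvg1 e : 0 < e -> exists C, 1 - e <= tailG C.
Proof.
move=> e0.
suff c0 : tailI n%:R @[n --> \oo] --> (0 : R).
  have : tailG n%:R @[n --> \oo] --> expR (- 0).
    apply: (cvg_comp _ expR); last exact: continuous_expR.
    exact: cvgN.
  rewrite oppr0 expR0 => /cvgrPdist_le/(_ e e0)[N _ /(_ N (leqnn N))] h.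
  by exists N%:R; move: h; rewrite ler_norml; lra.
pose f_ n := (EFin \o g) \_ `[n%:R, +oo[.
have [|||||_ _] := @dominated_convergence _ _ _ mu `[0, +oo[ _
  f_ (cst 0%E) (EFin \o g) _ _ _ (ig 0).
- by [].
- move=> n; apply/measurable_restrict => //.
  by apply/measurable_EFinP; exact: mg.
- exact: measurable_cst.
- apply/aeW => x _; apply: cvg_near_cst.
  near=> n; rewrite /f_ patchE ifF//; apply/negbTE/negP; rewrite inE/= in_itv/= andbT.
  by apply/negP; rewrite -ltNge; near: n; exact: nbhs_infty_gtr.
- apply/aeW => x n _; rewrite /f_ patchE; case: ifPn => _ /=.
    by rewrite lee_fin ger0_norm//; case/andP: (g01 x).
  by rewrite normr0 lee_fin; case/andP: (g01 x).
rewrite integral0 => c; have /fine_cvgP[_] : (\int[mu]_(x in `[0%R, +oo[) f_ n x)%E @[n --> \oo] --> 0%:E by [].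
rewrite (_ : fine \o _ = fun n => tailI n%:R)//; apply/funext => n /=.
rewrite /tailI /Rintegral /f_ -integral_mkcondr; congr (fine (integral _ _ _)).
apply/seteqP; split=> x /=; rewrite !in_itv/= !andbT; first by case.
by move=> nx; split=> //; apply: le_trans nx.
Unshelve. all: by end_near. Qed.

End laplace_functional.

(** * Laplace functional of the partial sums of exponential variables *)

Section gamma_process.
Context {d} {T : measurableType d} {R : realType} (P : probability T R).
Local Notation mu := (@lebesgue_measure R).
Variable xi : nat -> T -> R.
Hypothesis mxi : forall i, measurable_fun [set: T] (xi i).
Hypothesis ixi : mutually_independent P xi.
Hypothesis lxi : forall i (A : set R), measurable A ->
  P (xi i @^-1` A) = exponential_prob 1 A.

Lemma ae_xi_gt0 : {ae P, forall w, forall i, 0 < xi i w}.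
Proof.
have p0 i : P (xi i @^-1` `]-oo, 0]%classic) = 0%E.
  rewrite lxi// /exponential_prob -integral_itv_bndo_bndc; last first.
    apply/measurable_EFinP; apply: measurable_funTS.
    exact: measurable_exponential_pdf.
  apply: integral0_eq => x /=; rewrite in_itv/= => x0.
  by rewrite lt0_exponential_pdf.
apply/ae_foralln => i; exists (xi i @^-1` `]-oo, 0]); split.
- by rewrite -[X in measurable X]setTI; exact: mxi.
- exact: p0.
- by move=> w /= /negP; rewrite -leNgt in_itv.
Qed.

(** The truncation makes the function bounded on the whole line and agrees almost surely with
    [exp (- xi)]. The mean 1/2 gives the geometric decay of [E exp (- S_k)] by which [laplace_gamma]
    expresses that [S_k] is large. *)
Lemma Ex_expN_exponential i :
  Ex P (fun w => expR (- Num.max (xi i w) 0)) = 2^-1.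
Proof.
rewrite /Ex (@Ex_exponential _ _ _ P (xi i) (fun x => expR (- Num.max x 0)))//.
- rewrite (_ : (2^-1 : R) = fine (2^-1)%:E)//; congr fine.
  pose F (x : R) := - (2^-1 * expR (- (x + x))).
  have isF (x : R) : is_derive x (1 : R) F (expR (- (x + x))).
    have h1 : is_derive x (1 : R) (fun x : R => expR (- (x + x))) (- 2 * expR (- (x + x))).
      rewrite mulrC; apply: (@is_derive1_comp _ expR (fun x => - (x + x))).
    have h3 := is_deriveN (is_deriveZ (2^-1) h1).
    apply: is_derive_eq h3 _; rewrite /GRing.scale/=; lra.
  transitivity (\int[mu]_(x in `[0%R, +oo[) (expR (- (x + x)))%:E)%E.
    apply: eq_integral => x; rewrite inE/= in_itv/= andbT => x0.
    by rewrite max_l// -expRD -opprD.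
  rewrite (@ge0_continuous_FTC2y _ _ F 0 0)//.
  + by rewrite /F addr0 oppr0 expR0 mulr1 EFinN oppeK add0e.
  + apply: continuous_subspaceT => x.
    apply: (@continuous_comp _ _ _ (fun x : R => - (x + x)) expR); last exact: continuous_expR.
    by apply: cvgN; apply: cvgD; exact: cvg_id.
  + apply/cvgrPdist_le => e e0.
    have := @cvgr_expR R; move/cvgrPdist_le => /(_ e e0) h.
    near=> x.
    have : `|0 - expR (- x)| <= e by near: x.
    rewrite !sub0r !normrN !ger0_norm ?expR_ge0//.
    apply: le_trans; apply: (@le_trans _ _ (expR (- (x + x)))).
      by rewrite ler_piMl ?expR_ge0// invf_le1// ler1n.
    rewrite ler_expR lerN2 lerDl; near: x; exact: nbhs_pinfty_ge.
  + apply: cvg_at_right_filter; apply/differentiable_continuous/derivable1_diffP.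
    exact: (@ex_derive _ _ _ _ _ _ _ (isF 0)).
  + move=> x _; rewrite derive1E.
    exact: (@derive_val _ _ _ _ _ _ _ (isF x)).
- exact: lxi.
- split.
    apply: (@measurableT_comp _ _ _ _ _ _ expR); first exact: measurable_expR.
    by apply: measurable_funN; apply: measurable_maxr.
  exists 1 => x; rewrite ger0_norm ?expR_ge0// expR_le1 oppr_le0.
  by rewrite le_max lexx orbT.
Unshelve. all: by end_near. Qed.

Variable kap : R -> R.
Hypothesis kapc : continuous kap.
Hypothesis kap01 : forall x, 0 <= kap x <= 1.
Hypothesis kap_fin : (\int[mu]_(x in `[0%R, +oo[) (1 - kap x)%:E < +oo)%E.
Let G := tailG kap.
Let S k w := \sum_(j < k) xi j w.
Let Y k w := \prod_(i < k) kap (gam xi i w).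

Let mS k : measurable_fun setT (S k).
Proof. by apply: measurable_sum => j; exact: mxi. Qed.

Let mkap : measurable_fun setT kap.
Proof. exact: continuous_measurable_fun. Qed.

Let mG : measurable_fun setT G.
Proof. by apply: continuous_measurable_fun; exact: continuous_tailG. Qed.

Let bkap k : bmf (fun w => kap (gam xi k w)).
Proof.
split; first by apply: (measurableT_comp mkap); exact: (mS k.+1).
exists 1 => w; have /andP[k0 k1] := kap01 (gam xi k w).
by rewrite ger0_norm.
Qed.

Let bY k : bmf (Y k).
Proof. by apply: bmf_prod => i _; exact: bkap. Qed.

Let Y01 k w : 0 <= Y k w <= 1.
Proof.
apply/andP; split; first by apply: prodr_ge0 => i _; case/andP: (kap01 (gam xi i w)).
by apply: prodr_ile1 => // i _; exact: kap01.
Qed.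

Let YS k w : Y k.+1 w = Y k w * kap (S k w + xi k w).
Proof. by rewrite /Y big_ord_recr /gam /S big_ord_recr. Qed.

Let bG (Z : T -> R) : measurable_fun setT Z -> bmf (fun w => G (Z w)).
Proof.
move=> mZ; split; first exact: (measurableT_comp mG).
by exists 1 => w; rewrite ger0_norm ?tailG_le1// ltW// tailG_gt0.
Qed.

Let V k w := (Y k w, S k w).

Let mV k : measurable_fun setT (V k).
Proof. by apply: measurable_fun_pair; [case: (bY k)|exact: mS]. Qed.

Let indepV k : indep_tail P xi k (V k).
Proof.
elim: k => [|k IH].
  rewrite (_ : V 0 = fun=> (1, 0)); first exact: indep_tail_cst.
  by apply/funext => w; rewrite /V /Y /S !big_ord0.
rewrite (_ : V k.+1 = (fun z : R * R * R => (z.1.1 * kap (z.1.2 + z.2), z.1.2 + z.2))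
                       \o (fun w => (V k w, xi k w))); last first.
  by apply/funext => w; rewrite /V YS /= /S big_ord_recr.
apply: indep_tail_comp; last exact: indep_tail_step.
have m1 : measurable_fun setT (fun z : R * R * R => z.1.2 + z.2).
  apply: measurable_funD => //; exact: (measurableT_comp measurable_snd).
apply: measurable_fun_pair => //.
apply: measurable_funM; first exact: (measurableT_comp measurable_fst).
exact: (measurableT_comp mkap).
Qed.

(** The variables [Y_k G (S_k)] form a martingale: given the first [k] gaps, averaging over [xi_k]
    is the renewal equation at [v = S_k]. *)
Let mart k : Ex P (fun w => Y k w * G (S k w)) = G 0.
Proof.
elim: k => [|k IH].
  rewrite (_ : (fun w => _) = fun=> G 0); first exact: Ex_cst.
  by apply/funext => w; rewrite /Y /S !big_ord0 mul1r.
have bM j : bmf (fun w => Y j w * G (S j w)) := bmfM (bY j) (bG (mS j)).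
transitivity (Ex P (fun w => Y k w * G (S k w))); last exact: IH.
apply: EFin_inj.
apply: eq_trans (esym (ExE P (bM k.+1))) _.
apply: eq_trans _ (ExE P (bM k)).
pose h (z : R * R * R) := ((Num.max z.1.1 0) *
   (kap (z.1.2 + z.2) * G (z.1.2 + z.2)))%:E.
have m1 : measurable_fun setT (fun z : R * R * R => z.1.2 + z.2).
  apply: measurable_funD => //; exact: (measurableT_comp measurable_snd).
have h0 z : (0 <= h z)%E.
  rewrite /h lee_fin mulr_ge0//; first by rewrite le_max lexx orbT.
  by rewrite mulr_ge0//; [case/andP: (kap01 (z.1.2 + z.2))|rewrite ltW// tailG_gt0].
transitivity (\int[P]_w h (V k w, xi k w))%E.
  apply: eq_integral => w _; rewrite /h /V/= max_l; last by case/andP: (Y01 k w).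
  by rewrite YS -mulrA /S big_ord_recr.
rewrite (@indep_tail_integral _ _ _ _ _ _ xi)//; last first.
  apply/measurable_EFinP; apply: measurable_funM.
    apply: measurable_maxr; last exact: measurable_cst.
    exact: (measurableT_comp measurable_fst).
  by apply: measurable_funM; [exact: (measurableT_comp mkap)|exact: (measurableT_comp mG)].
apply: eq_integral => w _.
rewrite /h /V/= max_l; last by case/andP: (Y01 k w).
under eq_integral => w' _ do rewrite EFinM.
have mkG : measurable_fun setT (fun x => kap (S k w + x) * G (S k w + x)).
  have ma : measurable_fun setT (fun x : R => S k w + x) by apply: measurable_funD.
  by apply: measurable_funM; [exact: (measurableT_comp mkap)|exact: (measurableT_comp mG)].
rewrite ge0_integralZl//; last 3 first.
- by apply/measurable_EFinP; exact: (measurableT_comp mkG).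
- move=> x _; rewrite lee_fin mulr_ge0//; last by rewrite ltW// tailG_gt0.
  by case/andP: (kap01 (S k w + xi k x)).
- by rewrite lee_fin; case/andP: (Y01 k w).
rewrite EFinM; congr (_ * _)%E.
rewrite (@Ex_exponential _ _ _ P (xi k) (fun x => kap (S k w + x) * G (S k w + x)))//.
- exact: tailG_eq.
- exact: lxi.
- split => //; exists 1 => x; rewrite normrM.
  have /andP[k0 k1] := kap01 (S k w + x).
  rewrite (ger0_norm k0) ger0_norm; last by rewrite ltW// tailG_gt0.
  by rewrite mulr_ile1// ?tailG_le1// ltW// tailG_gt0.
Qed.

Let h (x : R) := expR (- Num.max x 0).

Let mh : measurable_fun setT h.
Proof.
apply: (@measurableT_comp _ _ _ _ _ _ expR); first exact: measurable_expR.
by apply: measurable_funN; apply: measurable_maxr.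
Qed.

Let h01 x : 0 <= h x <= 1.
Proof. by rewrite expR_ge0/= expR_le1 oppr_le0 le_max lexx orbT. Qed.

Let Z k w := \prod_(i < k) h (xi i w).

Let bZ k : bmf (Z k).
Proof.
apply: bmf_prod => i _; split; first exact: (measurableT_comp mh).
by exists 1 => w; have /andP[a b] := h01 (xi i w); rewrite ger0_norm.
Qed.

Let ExZk k : Ex P (Z k) = 2^-1 ^+ k.
Proof.
rewrite /Z (@indep_Ex_prod _ _ _ _ _ P xi mxi k (fun=> h))//.
rewrite (eq_bigr (fun=> 2^-1)); first by rewrite prodr_const card_ord.
by move=> i _; rewrite -[RHS](Ex_expN_exponential i).
Qed.

(** By [mart] the mean of [Y_k G (S_k)] is the constant [G 0], and replacing [G (S_k)] by 1 costs at
    most [E (1 - G (S_k))]. Beyond [C] the integrand is at most [e / 2], and below [C] it is at most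
    [exp (C - S_k)], whose mean is [exp C / 2^k]. *)
Lemma laplace_gamma :
  Ex P (fun w => \prod_(i < k) kap (gam xi i w)) @[k --> \oo] --> tailG kap 0.
Proof.
apply/cvgrPdist_le => e e0.
have e2 : 0 < e / 2 by rewrite divr_gt0.
have [C GC] := tailG_cvg1 kapc kap01 kap_fin e2.
(* The sum of the truncated gaps: almost surely equal to [S_k], and with [exp (- S')] equal to the
   bounded product [Z] at every point. *)
pose S' k w := \sum_(j < k) Num.max (xi j w) 0.
have mS' k : measurable_fun setT (S' k).
  by apply: measurable_sum => j; apply: measurable_maxr => //; exact: mxi.
have bM k : bmf (fun w => Y k w * G (S k w)) := bmfM (bY k) (bG (mS k)).
have zc : (2^-1 : R) ^+ k @[k --> \oo] --> (0 : R).
  by apply: cvg_expr; rewrite ger0_norm ?invr_ge0// invf_lt1// ltr1n.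
near=> k.
have : Ex P (Z k) <= e / 2 / expR C.
  rewrite ExZk; have : `|0 - (2^-1 : R) ^+ k| <= e / 2 / expR C.
    near: k; move/cvgrPdist_le : zc; apply.
    by rewrite divr_gt0// expR_gt0.
  by rewrite sub0r normrN ger0_norm// exprn_ge0// invr_ge0.
rewrite ler_pdivlMr ?expR_gt0// => hZ.
suff : `|Ex P (fun w => Y k w * G (S k w)) - Ex P (Y k)| <= e by rewrite (mart k).
apply: (le_trans (Ex_dist P (bM k) (bY k))).
have b1 : bmf (fun w => 1 - G (S k w)) by apply: bmfB; [exact: bmf_cst|exact: bG].
apply: (@le_trans _ _ (Ex P (fun w => 1 - G (S k w)))).
  apply: Ex_le => //; first by apply: bmf_norm; exact: bmfB.
  move=> w; have /andP[y0 y1] := Y01 k w.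
  have g1 := tailG_le1 kap01 (S k w).
  have := tailG_gt0 kap (S k w); rewrite -/G => g0.
  rewrite -/G in g1.
  rewrite ler_norml; nra.
have -> : Ex P (fun w => 1 - G (S k w)) = Ex P (fun w => 1 - G (S' k w)).
  apply: Ex_ae_eq.
  - by case: b1.
  - apply: measurable_funB => //; exact: (measurableT_comp mG).
  - move: ae_xi_gt0; apply: filterS => w w0; congr (1 - G _).
    by apply: eq_bigr => j _; rewrite max_l// ltW.
apply: (@le_trans _ _ (Ex P (fun w => e / 2 + expR C * Z k w))); last first.
  rewrite ExD; [|exact: bmf_cst|exact: bmfM (bmf_cst _) _].
  by rewrite Ex_cst ExZ// mulrC; move: hZ; lra.
apply: Ex_le.
- by apply: bmfB; [exact: bmf_cst|exact: bG].
- by apply: bmfD; [exact: bmf_cst|exact: bmfM (bmf_cst _) _].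
move=> w; have -> : Z k w = expR (- S' k w).
  by rewrite /Z /h -expR_sum /S' sumrN.
rewrite -expRD; have [CS|SC] := leP C (S' k w).
  have := tailG_nd kapc kap01 kap_fin CS; rewrite -/G.
  have := expR_ge0 (C + - S' k w); move: GC; rewrite -/G; lra.
have := tailG_gt0 kap (S' k w); rewrite -/G.
have : 1 <= expR (C + - S' k w) by rewrite -expR0 ler_expR; lra.
by have e2' := e2; lra.
Unshelve. all: by end_near. Qed.

End gamma_process.

(** * An integrable majorant with a power tail *)

Section power_tail.
Context {R : realType}.
Local Notation mu := (@lebesgue_measure R).
Variable q : R.
Hypothesis q1 : 1 < q.

(** The common shape of the dominating functions below: functions [1 - exp (- y)] are at most 1 near
    the origin and at most [y], hence a power, at infinity. *)
Definition powdom (x : R) : R := if x <= 1 then 1 else x `^ (- q).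

Lemma powdom_ge0 x : 0 <= powdom x.
Proof. by rewrite /powdom; case: ifP => // _; exact: powR_ge0. Qed.

Lemma measurable_powdom : measurable_fun [set: R] powdom.
Proof.
apply: measurable_fun_ifT => //.
  by apply: measurable_fun_ler => //.
Qed.

Lemma integral_powR_tail :
  (\int[mu]_(x in `[1%R, +oo[) (x `^ (- q))%:E < +oo)%E.
Proof.
have qn0 : q - 1 != 0 by rewrite subr_eq0 gt_eqF.
pose F (x : R) := - ((q - 1)^-1 * x `^ (1 - q)).
have isF (x : R) : 0 < x -> is_derive x (1 : R) F (x `^ (- q)).
  move=> x0; have h := is_deriveN (is_deriveZ ((q - 1)^-1) (is_derive1_powR (1 - q) x0)).
  apply: is_derive_eq h _; rewrite /GRing.scale/=.
  rewrite (_ : 1 - q - 1 = - q); last by ring.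
  by rewrite mulrA -mulNr -mulrN opprB mulVf// mul1r.
rewrite (@ge0_continuous_FTC2y _ _ F 1 0)//.
- by rewrite -EFinB ltry.
- by move=> x _; exact: powR_ge0.
- apply: continuous_in_subspaceT => x; rewrite inE/= in_itv/= andbT => x1.
  have x0 : 0 < x by rewrite (lt_le_trans _ x1).
  apply/differentiable_continuous/derivable1_diffP.
  exact: (@ex_derive _ _ _ _ _ _ _ (is_derive1_powR (- q) x0)).
- rewrite -oppr0 -[in X in _ --> X](mulr0 (q - 1)^-1); apply: cvgN; apply: cvgMr.
  apply/cvgrPdist_le => e e0; near=> x.
  have x1 : 1 <= x by near: x; exact: nbhs_pinfty_ge.
  have x0 : 0 < x by rewrite (lt_le_trans _ x1).
  rewrite sub0r normrN ger0_norm ?powR_ge0// /powR gt_eqF//.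
  have hx : expR (ln e / (1 - q)) <= x.
    by near: x; apply: nbhs_pinfty_ge; exact: num_real.
  have hl : ln e / (1 - q) <= ln x by rewrite -ler_expR [leRHS]lnK ?posrE.
  rewrite -[leRHS](@lnK _ e) ?posrE// ler_expR mulrC.
  by rewrite -ler_ndivrMr// subr_lt0.
- move=> x x1; have x0 : 0 < x by rewrite (lt_trans _ x1).
  exact: (@ex_derive _ _ _ _ _ _ _ (isF x x0)).
- apply: cvg_at_right_filter; apply/differentiable_continuous/derivable1_diffP.
  exact: (@ex_derive _ _ _ _ _ _ _ (isF 1 ltr01)).
- move=> x; rewrite in_itv/= andbT => x1; have x0 : 0 < x by rewrite (lt_trans _ x1).
  rewrite derive1E.
  exact: (@derive_val _ _ _ _ _ _ _ (isF x x0)).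
Unshelve. all: by end_near. Qed.

Lemma integrable_powdom : mu.-integrable `[0%R, +oo[ (EFin \o powdom).
Proof.
have mp (D : set R) : measurable_fun D (EFin \o powdom).
  by apply/measurable_EFinP; apply: measurable_funTS; exact: measurable_powdom.
apply/integrableP; split; first exact: mp.
under eq_integral => x _ do rewrite /= (ger0_norm (powdom_ge0 x)).
rewrite (@itv_bndbnd_setU _ _ _ (BRight 1))//=; last by rewrite bnd_simp.
rewrite ge0_integral_setU//=.
- apply: lte_add_pinfty.
    apply: (@le_lt_trans _ _ (\int[mu]_(x in `[0%R, 1%R]) 1%:E)%E).
      apply: ge0_le_integral => //=.
      + by move=> x _; rewrite lee_fin powdom_ge0.
      + exact: mp.
      + move=> x; rewrite in_itv/= => /andP[_ x1].
        by rewrite lee_fin /powdom x1.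
    by rewrite integral_cst//= mul1e lebesgue_measure_itv/=; case: ifP => _; rewrite ?ltry.
  apply: le_lt_trans integral_powR_tail.
  rewrite -[leRHS]integral_itv_obnd_cbnd; last first.
    by apply/measurable_EFinP; apply: measurable_funTS; exact: measurable_powR.
  rewrite le_eqVlt; apply/orP; left; apply/eqP; apply: eq_integral => x.
  by rewrite inE/= in_itv/= andbT /powdom leNgt => ->.
- exact: mp.
- by move=> x _; rewrite lee_fin powdom_ge0.
- apply/disj_setPS => x [] /=; rewrite !in_itv/= => /andP[_ x0].
  by rewrite andbT ltNge x0.
Qed.

End power_tail.

(** * The Laplace exponent of the two stable series *)

Section stable_kernel.
Context {R : realType}.
Local Notation mu := (@lebesgue_measure R).
Variable gamma : R.
Hypothesis g12 : 1 < gamma < 2.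

Definition phi (s t x : R) : R :=
  s * x `^ (- (2 / gamma)) + t * x `^ (- (3 / gamma)).

(** The value 0 on the negative half-line is the limit of [exp (- phi)] at [0+] when [s + t > 0],
    which makes [kap] continuous on all of [R] as the section on the Laplace functional requires. *)
Definition kap (s t x : R) : R := if 0 < x then expR (- phi s t x) else 0.

Definition lapI (s t : R) : R := tailI (kap s t) 0.

Let g0 : 0 < gamma. Proof. by case/andP: g12; lra. Qed.

(** The bound [gamma < 2] is what makes [1 - kap] integrable at infinity. *)
Let q2 : 1 < 2 / gamma. Proof. by case/andP: g12 => ? ?; rewrite ltr_pdivlMr//; lra. Qed.

Let q23 : 2 / gamma <= 3 / gamma.
Proof. by rewrite ler_pM2r ?invr_gt0//; lra. Qed.

Lemma phi_ge0 s t x : 0 <= s -> 0 <= t -> 0 <= phi s t x.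
Proof. by move=> s0 t0; rewrite /phi addr_ge0// mulr_ge0// powR_ge0. Qed.

Lemma kap01 s t : 0 <= s -> 0 <= t -> forall x, 0 <= kap s t x <= 1.
Proof.
move=> s0 t0 x; rewrite /kap; case: ifP => _; last by rewrite lexx ler01.
by rewrite expR_ge0/= expR_le1 oppr_le0 phi_ge0.
Qed.

Let continuous_phi s t x : 0 < x -> {for x, continuous (phi s t)}.
Proof.
move=> x0.
have cp a : {for x, continuous (fun y : R => y `^ a)}.
  apply/differentiable_continuous/derivable1_diffP.
  exact: (@ex_derive _ _ _ _ _ _ _ (is_derive1_powR _ x0)).
by apply: cvgD; apply: cvgM; [exact: cvg_cst|exact: cp|exact: cvg_cst|exact: cp].
Qed.

(* For 0 < x <= 1 one has phi s t x >= (s + t) / x, and exp(-y) <= 1 / y. *)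
Let kap_near0 s t x : 0 <= s -> 0 <= t -> 0 < s + t -> x <= 1 ->
  kap s t x <= `|x| / (s + t).
Proof.
move=> s0 t0 st x1; rewrite /kap; case: ifP => [x0|_]; last first.
  by rewrite divr_ge0// ltW.
have xp q : 1 < q -> x^-1 <= x `^ (- q).
  move=> q1; rewrite -[leLHS](powR_inv1 (ltW x0)).
  by apply: ger_powR; [rewrite x0 x1|rewrite lerN2 ltW].
have h : (s + t) / x <= phi s t x.
  rewrite mulrDl /phi lerD// ler_wpM2l// xp//; exact: lt_le_trans q23.
have st0 : 0 < (s + t) / x by rewrite divr_gt0.
apply: (@le_trans _ _ (expR (- ((s + t) / x)))).
  by rewrite ler_expR lerN2.
rewrite expRN gtr0_norm// -[leRHS]invf_div lef_pV2 ?posrE ?expR_gt0//.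
have := expR_ge1Dx ((s + t) / x); lra.
Qed.

Lemma continuous_kap s t : 0 <= s -> 0 <= t -> 0 < s + t -> continuous (kap s t).
Proof.
move=> s0 t0 st x.
have [x0|x0|->] := ltgtP x 0.
- have : \forall y \near x, kap s t y = 0.
    near=> y; rewrite /kap ifF//; apply/negbTE; rewrite -leNgt ltW//.
    by near: y; exact: lt_nbhsl.
  move=> h; have : kap s t y @[y --> x] --> (0 : R) by apply: cvg_near_cst.
  have kx : kap s t x = 0 by rewrite /kap ltNge (ltW x0).
  by rewrite /continuous_at kx.
- have h : \forall y \near x, expR (- phi s t y) = kap s t y.
    near=> y; rewrite /kap ifT//.
    by near: y; exact: lt_nbhsr.
  have : expR (- phi s t y) @[y --> x] --> expR (- phi s t x).
    apply: (@continuous_comp _ _ _ (fun y => - phi s t y) expR); last exact: continuous_expR.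
    by apply: cvgN; exact: continuous_phi.
  have kx : kap s t x = expR (- phi s t x) by rewrite /kap x0.
  rewrite /continuous_at kx; apply: cvg_trans.
  exact: near_eq_cvg.
- have kx : kap s t 0 = 0 by rewrite /kap ltxx.
  rewrite /continuous_at kx.
  apply/cvgrPdist_le => e e0; near=> y.
  rewrite sub0r normrN ger0_norm; last by case/andP: (kap01 s0 t0 y).
  apply: le_trans (kap_near0 s0 t0 st _) _.
    apply: ltW; near: y; apply: lt_nbhsl; exact: ltr01.
  rewrite ler_pdivrMr//.
  have : `|0 - y| <= e * (s + t).
    near: y; apply: (@cvgr_dist_le _ _ _ (nbhs (0:R)) _ id 0); first exact: cvg_id.
    by rewrite mulr_gt0.
  by rewrite sub0r normrN.
Unshelve. all: by end_near. Qed.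

Lemma phi_le s t x : 0 <= s -> 0 <= t -> 1 <= x ->
  phi s t x <= (s + t) * x `^ (- (2 / gamma)).
Proof.
move=> s0 t0 x1; rewrite /phi (mulrDl s t); apply: lerD => //; apply: ler_wpM2l => //.
by apply: ler_powR => //; rewrite lerN2.
Qed.

Lemma kap_dom s t x : 0 <= s -> 0 <= t ->
  0 <= 1 - kap s t x <= (1 + s + t) * powdom (2 / gamma) x.
Proof.
move=> s0 t0; have /andP[k0 k1] := kap01 s0 t0 x; rewrite subr_ge0 k1/=.
rewrite /powdom; case: ifPn => [_|]; first lra.
rewrite -ltNge => x1; have x0 : 0 < x by rewrite (lt_trans _ x1).
rewrite /kap x0; have := expR_ge1Dx (- phi s t x).
have := phi_le s0 t0 (ltW x1); have := powR_ge0 x (- (2 / gamma)); lra.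
Qed.

Lemma measurable_kap s t : measurable_fun [set: R] (kap s t).
Proof.
apply: measurable_fun_ifT => //; first exact: measurable_fun_ltr.
apply: (@measurableT_comp _ _ _ _ _ _ expR); first exact: measurable_expR.
by apply: measurable_funN; apply: measurable_funD; apply: measurable_funM => //;
  exact: measurable_powR.
Qed.

Let idom s t : mu.-integrable `[0%R, +oo[
  (fun x => ((1 + s + t) * powdom (2 / gamma) x)%:E).
Proof.
have mi : measurable (`[0%R, +oo[ : set (measurableTypeR R)) by [].
have := integrableZl mi (1 + s + t) (integrable_powdom q2).
by apply: eq_integrable => // x _; rewrite /= EFinM.
Qed.

Lemma kap_fin s t : 0 <= s -> 0 <= t ->
  (\int[mu]_(x in `[0%R, +oo[) (1 - kap s t x)%:E < +oo)%E.
Proof.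
move=> s0 t0; have /integrableP[mI] := idom s t; apply: le_lt_trans.
apply: ge0_le_integral => //.
- by move=> x _; rewrite lee_fin; case/andP: (kap_dom x s0 t0).
- apply/measurable_EFinP; apply: measurable_funTS; apply: measurable_funB => //.
  exact: measurable_kap.
- exact: measurableT_comp mI.
- move=> x _; rewrite /= lee_fin; case/andP: (kap_dom x s0 t0) => h1 h2.
  by rewrite ger0_norm// (le_trans h1).
Qed.

Lemma lapIE s t : 0 <= s -> 0 <= t ->
  (\int[mu]_(x in `[0%R, +oo[) (1 - kap s t x)%:E)%E = (lapI s t)%:E.
Proof.
move=> s0 t0; rewrite /lapI /tailI /Rintegral fineK// ge0_fin_numE; first exact: kap_fin.
by apply: integral_ge0 => x _; rewrite lee_fin; case/andP: (kap_dom x s0 t0).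
Qed.

(** Continuity of the exponent at the origin: it rules out infinite values of the series, and later
    bounds the mass at large values. *)
Lemma lapI_small e : 0 < e -> exists2 s, 0 < s & lapI s s <= e.
Proof.
move=> e0.
pose f_ n x := (1 - kap n.+1%:R^-1 n.+1%:R^-1 x)%:E.
have n0 n : 0 <= n.+1%:R^-1 :> R by rewrite invr_ge0.
have n1 n : n.+1%:R^-1 <= 1 :> R by rewrite invf_le1// ler1n.
have nc : (n.+1%:R^-1 : R) @[n --> \oo] --> (0 : R) by exact: cvg_harmonic.
(* At [x = 0] the integrand is 1 for every [n], hence the case distinction in the limit function;
   this single point is then discarded as a null set. *)
have [|||||_ _] := @dominated_convergence _ _ _ mu `[0, +oo[ _
  f_ (fun x => (if 0 < x then 0 else 1)%:E) _ _ _ _ (idom 1 1).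
- by [].
- move=> n; apply/measurable_EFinP; apply: measurable_funTS; apply: measurable_funB => //.
  exact: measurable_kap.
- apply/measurable_EFinP; apply: measurable_funTS; apply: measurable_fun_ifT => //.
  exact: measurable_fun_ltr.
- apply/aeW => x _; rewrite /f_ /kap; case: ifP => x0; last first.
    by rewrite subr0; exact: cvg_cst.
  apply/fine_cvgP; split; first exact: nearW.
  rewrite [X in _ --> X](_ : 0 = 1 - expR (- (0 * x `^ (- (2 / gamma)) + 0 * x `^ (- (3 / gamma))))); last first.
    by rewrite !mul0r addr0 oppr0 expR0 subrr.
  apply: cvgB; first exact: cvg_cst.
  apply: (cvg_comp _ expR); last exact: continuous_expR.
  by apply: cvgN; apply: cvgD; apply: cvgM => //; exact: cvg_cst.
- apply/aeW => x n _; rewrite /f_ /= lee_fin.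
  have /andP[h1 h2] := kap_dom x (n0 n) (n0 n).
  rewrite ger0_norm// (le_trans h2)// ler_wpM2r ?powdom_ge0//.
  by move: (n1 n); move: (n.+1%:R^-1) => z ?; lra.
rewrite (_ : \int[mu]_(x in _) _ = 0)%E; last first.
  rewrite -integral_itv_obnd_cbnd; last first.
    apply/measurable_EFinP; apply: measurable_funTS; apply: measurable_fun_ifT => //.
    exact: measurable_fun_ltr.
  by apply: integral0_eq => x /=; rewrite in_itv/= andbT => ->.
move=> c; have /fine_cvgP[_] : (\int[mu]_(x in `[0%R, +oo[) f_ n x)%E @[n --> \oo] --> 0%:E by [].
move=> /cvgrPdist_le/(_ e e0)[N _ /(_ N (leqnn N))] /=.
rewrite /f_ lapIE// sub0r normrN => h.
exists N.+1%:R^-1; first by rewrite invr_gt0.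
by apply: le_trans h; exact: ler_norm.
Qed.

(** This keeps the denominator away from 0. With [t = X^(3/gamma)] the exponent [phi] is at least 1
    on []0, X]], so [1 - kap >= 1/2] there and the integral is at least [X / 2]. *)
Lemma lapI_large M : exists2 t, 0 < t & M <= lapI 0 t.
Proof.
pose X := Num.max 1 (2 * M).
have X1 : 1 <= X by rewrite le_max lexx.
have X0 : 0 < X by rewrite (lt_le_trans _ X1).
have p0 : 0 < X `^ (- (3 / gamma)) by rewrite powR_gt0.
exists (X `^ (- (3 / gamma)))^-1; first by rewrite invr_gt0.
set t := _^-1; have t0 : 0 <= t by rewrite invr_ge0 ltW.
have h : 2 * M <= X by rewrite le_max lexx orbT.
apply: (@le_trans _ _ (2^-1 * X)); first lra.
rewrite -lee_fin -lapIE//.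
have mk : measurable_fun [set: R] (fun x => 1 - kap 0 t x).
  by apply: measurable_funB => //; exact: measurable_kap.
apply: (@le_trans _ _ (\int[mu]_(x in `[0%R, X]) (2^-1)%:E)%E).
  rewrite integral_cst//= lebesgue_measure_itv/= lte_fin X0.
  by rewrite sube0 -EFinM.
apply: (@le_trans _ _ (\int[mu]_(x in `[0%R, X]) (1 - kap 0 t x)%:E)%E); last first.
  apply: ge0_subset_integral => //=.
  - by apply/measurable_EFinP; exact: measurable_funTS.
  - by move=> x _; rewrite lee_fin; case/andP: (kap_dom x (lexx 0) t0).
  - by apply: subset_itvl; rewrite bnd_simp.
apply: ge0_le_integral => //=.
- by apply/measurable_EFinP; exact: measurable_funTS.
move=> x; rewrite in_itv/= => /andP[x0 xX]; rewrite lee_fin.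
rewrite /kap; case: ifP => [{}x0|_]; last lra.
have h1 : 1 <= phi 0 t x.
  rewrite /phi mul0r add0r; apply: (@le_trans _ _ (t * X `^ (- (3 / gamma)))).
    by rewrite mulVf// lt0r_neq0.
  rewrite ler_pM2l ?invr_gt0//.
  rewrite !powRN lef_pV2 ?posrE ?powR_gt0//.
  by apply: (@ge0_ler_powR _ (3 / gamma) _ x X) => //; rewrite ?nnegrE ?ltW// divr_gt0.
have : expR (- phi 0 t x) <= 2^-1; last by lra.
rewrite expRN lef_pV2 ?posrE ?expR_gt0//.
by have := expR_ge1Dx (phi 0 t x); lra.
Qed.

End stable_kernel.

(** * Finiteness and joint transform of the stable series *)

Section stable_series.
Context {d} {T : measurableType d} {R : realType} (P : probability T R).
Variables (xi : nat -> T -> R) (gamma : R).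
Hypothesis g12 : 1 < gamma < 2.
Hypothesis mxi : forall i, measurable_fun [set: T] (xi i).
Hypothesis ixi : mutually_independent P xi.
Hypothesis lxi : forall i (A : set R), measurable A ->
  P (xi i @^-1` A) = exponential_prob 1 A.

Let term (p i : nat) w : R := gam xi i w `^ (- (p%:R / gamma)).
Let psum (p k : nat) w : R := \sum_(i < k) term p i w.
Let S p w := stable_S xi gamma p w.
Definition fS (p : nat) (w : T) : R := fine (stable_S xi gamma p w).

Let term_ge0 p i w : 0 <= term p i w.
Proof. exact: powR_ge0. Qed.

Let mgam i : measurable_fun setT (gam xi i).
Proof. by apply: measurable_sum => j; exact: mxi. Qed.

Let mterm p i : measurable_fun setT (term p i).
Proof. exact: (measurableT_comp (@measurable_powR R (- (p%:R / gamma)))). Qed.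

Lemma measurable_stable_S p : measurable_fun setT (stable_S xi gamma p).
Proof.
apply: ge0_emeasurable_sum => [i w _ _|i _]; first by rewrite lee_fin powR_ge0.
by apply/measurable_EFinP; exact: (mterm p i).
Qed.

Lemma measurable_fS p : measurable_fun setT (fS p).
Proof.
by apply: (measurableT_comp (fine_measurable _)) => //; exact: measurable_stable_S.
Qed.

Let S_ge0 p w : (0 <= S p w)%E.
Proof. by apply: nneseries_ge0 => i _ _; rewrite lee_fin powR_ge0. Qed.

Lemma fS_ge0 p w : 0 <= fS p w.
Proof. by rewrite fine_ge0. Qed.

Let cvgS p w : (psum p k w)%:E @[k --> \oo] --> S p w.
Proof.
have cv : cvgn (fun k => \sum_(0 <= i < k | true) (term p i w)%:E)%E.
  by apply: is_cvg_nneseries => i _ _; rewrite lee_fin term_ge0.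
rewrite (_ : (fun k => _) = fun k => (\sum_(0 <= i < k | true) (term p i w)%:E)%E).
  exact: cv.
by apply/funext => k; rewrite /psum sumEFin big_mkord.
Qed.

Let prod_kap s t k w : (forall i, 0 < xi i w) ->
  \prod_(i < k) kap gamma s t (gam xi i w) =
  expR (- (s * psum 2 k w + t * psum 3 k w)).
Proof.
move=> w0; have g0 i : 0 < gam xi i w.
  rewrite /gam big_ord_recl ltr_wpDr// sumr_ge0// => j _; exact: ltW.
under eq_bigr => i _ do rewrite /kap g0.
rewrite -expR_sum sumrN big_split/= -!mulr_sumr.
by [].
Qed.

Let Y s t k w := \prod_(i < k) kap gamma s t (gam xi i w).

Let mY s t k : measurable_fun setT (Y s t k).
Proof.
apply: measurable_prod => i _.
exact: (measurableT_comp (measurable_kap gamma s t)).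
Qed.

Let Y1 s t k w : 0 <= s -> 0 <= t -> `|Y s t k w| <= 1.
Proof.
move=> s0 t0; rewrite ger0_norm.
  by apply: prodr_ile1 => // i _; exact: kap01.
by apply: prodr_ge0 => i _; case/andP: (kap01 gamma s0 t0 (gam xi i w)).
Qed.

Let cvgY s t : 0 <= s -> 0 <= t -> 0 < s + t ->
  Ex P (Y s t k) @[k --> \oo] --> expR (- lapI gamma s t).
Proof.
move=> s0 t0 st; apply: (laplace_gamma mxi ixi lxi).
- exact: continuous_kap.
- exact: kap01.
- exact: kap_fin.
Qed.

Let good w := (S 2 w < +oo)%E && (S 3 w < +oo)%E.

Let cvgYgood s t w : (forall i, 0 < xi i w) -> good w ->
  Y s t k w @[k --> \oo] --> expR (- (s * fS 2 w + t * fS 3 w)).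
Proof.
move=> w0 /andP[S2 S3].
have c p : (S p w < +oo)%E -> psum p k w @[k --> \oo] --> fS p w.
  move=> Sp; have := @cvgS p w; rewrite -(@fineK _ (S p w)) ?ge0_fin_numE//.
  by move=> /fine_cvgP[_].
under eq_fun do rewrite /Y prod_kap//.
apply: (cvg_comp _ expR); last exact: continuous_expR.
by apply: cvgN; apply: cvgD; apply: cvgM; try exact: cvg_cst; exact: c.
Qed.

(** Both series carry the same positive weight, so the divergence of either one drives the product
    to 0. *)
Let cvgYbad s w : 0 < s -> (forall i, 0 < xi i w) -> ~~ good w ->
  Y s s k w @[k --> \oo] --> (0 : R).
Proof.
move=> s0 w0 bad.
have [p [p23 Sp]] : exists p, (p = 2%N \/ p = 3%N) /\ S p w = +oo%E.
  move: bad; rewrite negb_and -!leNgt !leye_eq => /orP[]/eqP h.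
    by exists 2%N; split => //; left.
  by exists 3%N; split => //; right.
have pp k q : 0 <= psum q k w by apply: sumr_ge0 => i _; exact: term_ge0.
have := @cvgS p w; rewrite Sp => /cvgeryP /cvgryPge h.
apply/cvgrPdist_le => e e0; near=> k.
rewrite sub0r normrN /Y prod_kap// ger0_norm ?expR_ge0//.
have hk : (1 / e) / s <= psum p k w by near: k; exact: h.
rewrite expRN -[leRHS]invrK lef_pV2 ?posrE ?invr_gt0 ?expR_gt0//.
have h1 : e^-1 <= s * psum p k w by move: hk; rewrite ler_pdivrMr// div1r mulrC.
have h2 : s * psum p k w <= s * psum 2 k w + s * psum 3 k w.
  have := mulr_ge0 (ltW s0) (pp k 2%N); have := mulr_ge0 (ltW s0) (pp k 3%N).
  by case: p23 => -> ; lra.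
have := expR_ge1Dx (s * psum 2 k w + s * psum 3 k w); lra.
Unshelve. all: by end_near. Qed.

(** The limit [Z] of the products vanishes where a series diverges, so the probability of divergence
    is at most [1 - E Z = 1 - exp (- lapI s s) <= lapI s s], which [lapI_small] makes arbitrarily
    small. *)
Lemma ae_stable_fin : {ae P, forall w, (S 2 w < +oo)%E /\ (S 3 w < +oo)%E}.
Proof.
pose bad := [set w | ~~ good w].
have mgood : measurable_fun setT good.
  apply: measurable_and; apply: measurable_fun_lte => //; exact: measurable_stable_S.
have mbad : measurable bad.
  rewrite (_ : bad = ~` (good @^-1` [set true])).
    apply: measurableC; rewrite -[X in measurable X]setTI; exact: mgood.
  by apply/seteqP; split => w; rewrite /bad/=; case: (good w).
suff p0 : P bad = 0%E.
  exists bad; split => // w /=; rewrite /bad/= /good.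
  by case: (S 2 w < +oo)%E; case: (S 3 w < +oo)%E => // h; exfalso; apply: h.
have pf : P bad \is a fin_num by rewrite fin_num_measure.
have be : Ex P (\1_bad : T -> R) = fine (P bad).
  by rewrite /Ex integral_indic// setIT.
suff h : forall e, 0 < e -> Ex P (\1_bad : T -> R) <= e.
  rewrite -(fineK pf) -be; congr EFin; apply/eqP; rewrite eq_le; apply/andP; split.
    by apply/ler_addgt0Pl => e e0; rewrite addr0; exact: h.
  by apply: Ex_ge0 => w; rewrite indicE.
move=> e e0; have [s s0 Is] := lapI_small g12 e0.
pose Z w := if good w then expR (- (s * fS 2 w + s * fS 3 w)) else 0.
have mZ : measurable_fun setT Z.
  apply: measurable_fun_ifT => //.
  apply: (@measurableT_comp _ _ _ _ _ _ expR); first exact: measurable_expR.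
  apply: measurable_funN; apply: measurable_funD; apply: measurable_funM => //;
  exact: measurable_fS.
have Z01 w : 0 <= Z w <= 1.
  rewrite /Z; case: ifP => _; last by rewrite lexx ler01.
  rewrite expR_ge0 expR_le1 oppr_le0 addr_ge0// mulr_ge0 ?fS_ge0// ltW//.
have cZ : Ex P (Y s s k) @[k --> \oo] --> Ex P Z.
  apply: (@Ex_cvg _ _ _ P (Y s s) Z 1) => //.
    by move=> n w; apply: Y1; exact: ltW.
  move: (ae_xi_gt0 mxi lxi); apply: filterS => w w0; rewrite /Z.
  case: ifPn => gw; first exact: cvgYgood.
  exact: cvgYbad.
have ZE : Ex P Z = expR (- lapI gamma s s).
  have c2 := cvgY (ltW s0) (ltW s0) (addr_gt0 s0 s0).
  by rewrite -(cvg_lim (@Rhausdorff R) cZ) (cvg_lim (@Rhausdorff R) c2).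
have bZ : bmf Z.
  by split => //; exists 1 => w; have /andP[h1 h2] := Z01 w; rewrite ger0_norm.
have b1 : bmf (\1_bad : T -> R).
  split; first exact: measurable_indic.
  by exists 1 => w; rewrite indicE; case: (_ \in _); rewrite ?normr1 ?normr0.
have : Ex P (\1_bad : T -> R) <= Ex P (fun w => 1 - Z w).
  apply: Ex_le => //; first by apply: bmfB => //; exact: bmf_cst.
  move=> w; have /andP[_ Z1] := Z01 w.
  rewrite indicE; have [wb|wb] := boolP (w \in bad); last by rewrite subr_ge0.
  by move: wb; rewrite inE /bad/= /Z => /negbTE ->; rewrite subr0.
rewrite ExB//; last exact: bmf_cst.
rewrite Ex_cst ZE; have := expR_ge1Dx (- lapI gamma s s); lra.
Qed.

Lemma laplace_stable s t : 0 <= s -> 0 <= t -> 0 < s + t ->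
  Ex P (fun w => expR (- (s * fS 2 w + t * fS 3 w))) = expR (- lapI gamma s t).
Proof.
move=> s0 t0 st; rewrite -(cvg_lim (@Rhausdorff R) (cvgY s0 t0 st)).
apply/esym/(cvg_lim (@Rhausdorff R)).
apply: (@Ex_cvg _ _ _ P (Y s t) _ 1) => //.
- apply: (@measurableT_comp _ _ _ _ _ _ expR); first exact: measurable_expR.
  apply: measurable_funN; apply: measurable_funD; apply: measurable_funM => //;
  exact: measurable_fS.
- by move=> n w; exact: Y1.
- have := ae_stable_fin; have := ae_xi_gt0 mxi lxi.
  apply: filterS2 => w w0 [h2 h3].
  by apply: cvgYgood => //; rewrite /good h2 h3.
Qed.

End stable_series.

(** * Quantiles of a regularly varying tail *)

Lemma gt1_ltr_powR {R : realType} (a x y : R) : 1 < a -> x < y -> a `^ x < a `^ y.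
Proof.
move=> a1 xy; rewrite /powR gt_eqF ?(lt_trans _ a1)//.
by rewrite ltr_expR ltr_pM2r// ln_gt0.
Qed.

Lemma powR_div {R : realType} (x y b : R) : 0 <= x -> 0 <= y ->
  (x / y) `^ b = x `^ b / y `^ b.
Proof.
move=> x0 y0; rewrite powRM ?invr_ge0//; congr (_ * _).
by rewrite -(powR_inv1 y0) -powRrM mulN1r powRN.
Qed.

Section regular_variation.
Context {R : realType}.
Variables (gamma : R) (Fb : R -> R).
Hypothesis g0 : 0 < gamma.
Hypothesis Fb_ni : forall x y, x <= y -> Fb y <= Fb x.
Hypothesis Fb_gt0 : forall x, 0 < Fb x.
Hypothesis Fb_le1 : forall x, Fb x <= 1.
Hypothesis Fb_rv : forall lam, 0 < lam ->
  (Fb (lam * t) / Fb t) @[t --> +oo] --> lam `^ (- gamma).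

Let powR_nat_iter (b c : R) k : 0 <= b -> (b `^ c) ^+ k = (b ^+ k) `^ c.
Proof. by move=> b0; rewrite -powR_mulrn ?powR_ge0// -powR_mulrn// powRAC. Qed.

Let dyadic (x : R) : 1 <= x -> exists k, 2 ^+ k <= x < 2 ^+ k.+1.
Proof.
move=> x1.
have ex : exists k, x < 2 ^+ k.
  have [n xn] : exists n : nat, x < n%:R.
    by exists (Num.bound x); have := archi_boundP (le_trans ler01 x1).
  by exists n; rewrite (lt_trans xn)// -natrX ltr_nat ltn_expl.
case: (ex_minnP ex) => [[|k]] xk mk; first by move: xk; rewrite expr0 ltNge x1.
exists k; rewrite xk andbT leNgt; apply/negP => /mk; rewrite ltnn//.
Qed.

(** The limiting factor [2^(-gamma)] of a doubling is strictly below [2^(-q)], so from some [t1] on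
    every doubling gains at least [2^(-q)]; monotonicity fills in between the points [2^k t1]. *)
Lemma tail_powR_ub q : 0 <= q < gamma -> exists C t0, [/\ 0 < C, 0 < t0 &
  forall t, t0 <= t -> Fb t <= C * t `^ (- q)].
Proof.
move=> /andP[q0 qg].
have : \forall t \near +oo, Fb (2 * t) / Fb t <= 2 `^ (- q).
  have H := @Fb_rv 2 (ltr0Sn _ 1).
  apply: (cvgr_le _ H).
  by apply: gt1_ltr_powR => //; rewrite ?ltr1n// ltrN2.
move=> [M [_ hM]].
pose t1 := Num.max (M + 1) 1.
have t11 : 1 <= t1 by rewrite le_max lexx orbT.
have t10 : 0 < t1 by rewrite (lt_le_trans _ t11).
have t1M t : t1 <= t -> M < t.
  by rewrite ge_max => /andP[h _]; rewrite (lt_le_trans _ h)// ltrDl.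
have step t : t1 <= t -> Fb (2 * t) <= 2 `^ (- q) * Fb t.
  by move=> /t1M /hM; rewrite ler_pdivrMr.
have it k : Fb (2 ^+ k * t1) <= (2 `^ (- q)) ^+ k.
  elim: k => [|k IH]; first by rewrite expr0 expr0 Fb_le1.
  rewrite exprS -mulrA; apply: (le_trans (step _ _)).
    by apply: ler_peMl; [exact: ltW|rewrite exprn_ege1// ler1n].
  by rewrite exprS ler_wpM2l ?powR_ge0.
exists ((2 * t1) `^ q), t1; split => //; first by rewrite powR_gt0// mulr_gt0.
move=> t t1t.
have t0 : 0 < t by rewrite (lt_le_trans t10).
have [k /andP[k1 k2]] := @dyadic (t / t1) ltac:(by rewrite ler_pdivlMr// mul1r).
rewrite ler_pdivlMr// in k1; rewrite ltr_pdivrMr// in k2.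
apply: (le_trans (Fb_ni k1)); apply: (le_trans (it k)).
rewrite powR_nat_iter// !powRN -[leRHS]invf_div lef_pV2 ?posrE ?divr_gt0 ?powR_gt0 ?exprn_gt0 ?mulr_gt0//.
rewrite ler_pdivrMr ?powR_gt0 ?mulr_gt0// -powRM ?exprn_ge0//; last by rewrite mulr_ge0// ltW.
apply: ge0_ler_powR => //; rewrite ?nnegrE ?(ltW t0)//.
  by rewrite mulr_ge0 ?exprn_ge0// mulr_ge0// ltW.
by rewrite mulrA -exprSr ltW.
Qed.

(* For [t <= 0] the set may be empty, and then [aN t = 0]. *)
Definition aN (t : R) : nat :=
  xget 0%N [set k | Fb k%:R <= t^-1 /\ forall j, Fb j%:R <= t^-1 -> (k <= j)%N].

Let ex_tail e : 0 < e -> exists k : nat, Fb k%:R <= e.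
Proof.
move=> e0; have hg : 0 <= gamma / 2 < gamma.
  by rewrite divr_ge0 ?ltW//=; move: g0; lra.
have [C [t0 [C0 t00 h]]] := tail_powR_ub hg.
pose x := Num.max t0 ((C / e) `^ (gamma / 2)^-1).
have x0 : 0 < x by rewrite lt_max t00.
have h2 : 0 < gamma / 2 by rewrite divr_gt0.
have hx : Fb x <= e.
  apply: (le_trans (h _ _)); first by rewrite le_max lexx.
  rewrite powRN ler_pdivrMr ?powR_gt0// mulrC -ler_pdivrMr//.
  have -> : C / e = ((C / e) `^ (gamma / 2)^-1) `^ (gamma / 2).
    by rewrite -powRrM mulVf ?gt_eqF// powRr1 ?divr_ge0 ?ltW.
  apply: ge0_ler_powR; rewrite ?nnegrE ?powR_ge0 ?(ltW h2) ?(ltW x0)//.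
  by rewrite le_max lexx orbT.
exists (Num.bound x); apply: le_trans hx; apply: Fb_ni.
by apply: ltW; exact: archi_boundP (ltW x0).
Qed.

(** Galois connection between quantile and tail. The set defining [aN t] is inhabited for [t > 0]
    because the tail falls below every positive level. *)
Lemma aN_leq t k : 0 < t -> (aN t <= k)%N = (Fb k%:R <= t^-1).
Proof.
move=> t0; rewrite /aN; case: xgetP => [m -> [h1 h2]|]; last first.
  have [|k0 hk0] := @ex_tail t^-1; first by rewrite invr_gt0.
  have ex : exists k : nat, Fb k%:R <= t^-1 by exists k0.
  by case: (ex_minnP ex) => m hm mm /(_ m) /= []; split.
apply/idP/idP; last exact: h2.
by move=> mk; apply: le_trans h1; apply: Fb_ni; rewrite ler_nat.
Qed.

Lemma aN_nd s t : s <= t -> (aN s <= aN t)%N.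
Proof.
move=> st; have [s0|s0] := leP s 0.
  rewrite {1}/aN; case: xgetP => // m _ [h1 _]; exfalso.
  by move: (lt_le_trans (Fb_gt0 m%:R) h1); rewrite invr_gt0 ltNge s0.
have t0 := lt_le_trans s0 st.
rewrite aN_leq//; apply: (@le_trans _ _ t^-1); first by rewrite -aN_leq.
by rewrite lef_pV2.
Qed.

Definition aR (t : R) : R := (aN t)%:R.

Lemma aR_ge0 t : 0 <= aR t. Proof. exact: ler0n. Qed.

Lemma aR_nd s t : s <= t -> aR s <= aR t.
Proof. by move=> st; rewrite ler_nat aN_nd. Qed.

Lemma Fb_aR t : 0 < t -> Fb (aR t) <= t^-1.
Proof. by move=> t0; rewrite -aN_leq. Qed.

(** The quantile is minimal among integers only, so the strict lower bound on the tail starts one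
    unit below it; the shifts by 1 in the next lemmas come from here. *)
Lemma lt_Fb_aR t x : 0 < t -> 0 <= x -> x <= aR t - 1 -> t^-1 < Fb x.
Proof.
move=> t0 x0 xa; case e : (aN t) => [|k].
  by exfalso; move: xa; rewrite /aR e; move: x0; lra.
have : (aN t <= k)%N = false by rewrite e ltnn.
rewrite aN_leq// leNgt => /negbFE h; apply: (lt_le_trans h); apply: Fb_ni.
by move: xa; rewrite /aR e -natr1; lra.
Qed.

Lemma aR_le t x : 0 < t -> 0 <= x -> Fb x <= t^-1 -> aR t <= x + 1.
Proof.
move=> t0 x0 hx; rewrite leNgt; apply/negP => h.
have := @lt_Fb_aR t x t0 x0; rewrite ltNge hx /= => /(_ _)/negP; apply => //.
by move: h; lra.
Qed.

Lemma aR_gt t x : 0 < t -> t^-1 < Fb x -> x < aR t.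
Proof.
move=> t0 hx; rewrite ltNge; apply/negP => /Fb_ni; rewrite leNgt => /negP; apply.
exact: le_lt_trans (Fb_aR t0) hx.
Qed.

Lemma aR_cvgy : aR t @[t --> +oo] --> +oo.
Proof.
apply/cvgryPge => K; exists (Fb K)^-1; split; first exact: num_real.
move=> t ht; apply: ltW; apply: aR_gt; first by apply: lt_trans ht; rewrite invr_gt0.
by rewrite invf_plt ?posrE ?Fb_gt0//; apply: lt_trans ht; rewrite invr_gt0.
Qed.

Let rv_comp lam (u : R -> R) : 0 < lam -> u t @[t --> +oo] --> +oo ->
  (Fb (lam * u t) / Fb (u t)) @[t --> +oo] --> lam `^ (- gamma).
Proof. by move=> l0 uy; exact: (cvg_comp _ _ uy (@Fb_rv lam l0)). Qed.

Let powRVg lam : 0 < lam -> (lam `^ gamma^-1) `^ (- gamma) = lam^-1.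
Proof.
by move=> l0; rewrite -powRrM mulrN mulVf ?gt_eqF// powR_inv1// ltW.
Qed.

Let powR_lt y z : 0 < y -> y < z -> z `^ (- gamma) < y `^ (- gamma).
Proof.
move=> y0 yz; have z0 := lt_trans y0 yz.
rewrite !powRN ltf_pV2 ?posrE ?powR_gt0//.
by apply: gt0_ltr_powR => //; rewrite nnegrE ltW.
Qed.

(** For [y'] strictly between the limit and [y], the tail at [y' aR t] is eventually below
    [1 / (lam t)], so the quantile at [lam t] is at most [y' aR t + 1]; the gap [(y - y') aR t]
    absorbs the 1. *)
Lemma aR_ratio_le lam y : 0 < lam -> lam `^ gamma^-1 < y ->
  \forall t \near +oo, aR (lam * t) <= y * aR t.
Proof.
move=> l0 ly; pose y' := (lam `^ gamma^-1 + y) / 2.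
have p0 : 0 < lam `^ gamma^-1 by rewrite powR_gt0.
have y'1 : lam `^ gamma^-1 < y' by rewrite /y'; lra.
have y'2 : y' < y by rewrite /y'; lra.
have y'0 : 0 < y' by exact: lt_trans p0 y'1.
have h : \forall t \near +oo, Fb (y' * aR t) / Fb (aR t) <= lam^-1.
  apply: (cvgr_le _ (rv_comp y'0 aR_cvgy)).
  by rewrite -powRVg//; exact: powR_lt.
near=> t.
have ht : Fb (y' * aR t) / Fb (aR t) <= lam^-1 by near: t.
have a1 : (y - y')^-1 <= aR t.
  by near: t; move/cvgryPge : aR_cvgy; apply.
apply: (le_trans (@aR_le (lam * t) (y' * aR t) _ _ _)).
- by rewrite mulr_gt0.
- by rewrite mulr_ge0 ?aR_ge0// ltW.
- move: ht; rewrite ler_pdivrMr// => ht; rewrite invfM (le_trans ht)//.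
  by rewrite ler_pM2l ?invr_gt0// Fb_aR.
- have yy : 0 < y - y' by lra.
  by move: a1; rewrite -[_^-1]mul1r ler_pdivrMr// mulrBr; lra.
Unshelve. all: by end_near. Qed.

(** Regular variation is applied at [aR t - 1] rather than at [aR t], because it is there that the
    tail is known to exceed [1 / t]. *)
Lemma aR_ratio_ge lam y : 0 < lam -> 0 < y -> y < lam `^ gamma^-1 ->
  \forall t \near +oo, y * aR t <= aR (lam * t).
Proof.
move=> l0 y0 ly; pose y' := (lam `^ gamma^-1 + y) / 2.
have y'1 : y' < lam `^ gamma^-1 by rewrite /y'; lra.
have y'2 : y < y' by rewrite /y'; lra.
have y'0 : 0 < y' by exact: lt_trans y0 y'2.
have ay : aR t - 1 @[t --> +oo] --> +oo.
  apply/cvgryPge => K; have := aR_cvgy => /cvgryPge/(_ (K + 1)).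
  by apply: filterS => t; lra.
have h : \forall t \near +oo, lam^-1 <= Fb (y' * (aR t - 1)) / Fb (aR t - 1).
  apply: (cvgr_ge _ (rv_comp y'0 ay)).
  by rewrite -powRVg//; exact: powR_lt.
near=> t.
have ht : lam^-1 <= Fb (y' * (aR t - 1)) / Fb (aR t - 1) by near: t.
have a1 : y' / (y' - y) <= aR t.
  by near: t; move/cvgryPge : aR_cvgy; apply.
have a2 : 1 <= aR t by near: t; move/cvgryPge : aR_cvgy; apply.
apply: (@le_trans _ _ (y' * (aR t - 1))).
  have yy : 0 < y' - y by lra.
  by move: a1; rewrite ler_pdivrMr// mulrBr; lra.
apply: ltW; apply: aR_gt; first by rewrite mulr_gt0.
move: ht; rewrite ler_pdivlMr// => ht; rewrite invfM (lt_le_trans _ ht)//.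
rewrite ltr_pM2l ?invr_gt0//; apply: lt_Fb_aR => //.
by rewrite subr_ge0.
Unshelve. all: by end_near. Qed.

Lemma aR_ratio lam : 0 < lam ->
  (aR (lam * t) / aR t) @[t --> +oo] --> lam `^ gamma^-1.
Proof.
move=> l0; have p0 : 0 < lam `^ gamma^-1 by rewrite powR_gt0.
apply/cvgrPdist_le => e e0.
pose y := Num.max (lam `^ gamma^-1 - e) (lam `^ gamma^-1 / 2).
have y0 : 0 < y by rewrite lt_max divr_gt0// orbT.
have yl : y < lam `^ gamma^-1 by rewrite gt_max; apply/andP; split; lra.
have ye : lam `^ gamma^-1 - e <= y by rewrite le_max lexx.
near=> t.
have a0 : 0 < aR t.
  by near: t; move/cvgryPgt : aR_cvgy; apply.
have h1 : y * aR t <= aR (lam * t) by near: t; exact: aR_ratio_ge.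
have h2 : aR (lam * t) <= (lam `^ gamma^-1 + e) * aR t.
  by near: t; apply: aR_ratio_le => //; rewrite ltrDl.
have h3 : y <= aR (lam * t) / aR t by rewrite ler_pdivlMr.
have h4 : aR (lam * t) / aR t <= lam `^ gamma^-1 + e by rewrite ler_pdivrMr.
by rewrite ler_norml; apply/andP; split; lra.
Unshelve. all: by end_near. Qed.

(** Potter's bound for the quantile, by iterating one doubling as for the tail. When [t / x] is
    below the threshold [t1], monotonicity replaces [x] by [t / t1] and the loss is the factor
    [t1^b] of the constant. *)
Lemma aR_potter b : 0 < b < gamma^-1 -> exists C t0, [/\ 0 < C, 1 <= t0, 1 <= aR t0 &
  forall t x, t0 <= t -> 1 <= x -> x <= t -> aR (t / x) <= C * x `^ (- b) * aR t].
Proof.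
move=> /andP[b0 bg].
have : \forall t \near +oo, 2 `^ b * aR t <= aR (2 * t) /\ 1 <= aR t.
  near=> t; split; near: t; last by move/cvgryPge : aR_cvgy; apply.
  apply: aR_ratio_ge; rewrite ?powR_gt0//.
  by apply: gt1_ltr_powR => //; rewrite ltr1n.
move=> [M [_ hM]].
pose t1 := Num.max (M + 1) 1.
have t11 : 1 <= t1 by rewrite le_max lexx orbT.
have t10 : 0 < t1 by rewrite (lt_le_trans _ t11).
have t1M t : t1 <= t -> M < t.
  by rewrite ge_max => /andP[h _]; rewrite (lt_le_trans _ h)// ltrDl.
have it k t : t1 <= t -> (2 ^+ k) `^ b * aR t <= aR (2 ^+ k * t).
  move=> t1t; rewrite -powR_nat_iter//; elim: k => [|k IH]; first by rewrite expr0 !mul1r.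
  rewrite !exprS -!mulrA; apply: (@le_trans _ _ (2 `^ b * aR (2 ^+ k * t))).
    by rewrite ler_wpM2l ?powR_ge0.
  apply: (hM _ _).1; apply: t1M; apply: (le_trans t1t).
  by apply: ler_peMl; [exact: ltW (lt_le_trans t10 t1t)|rewrite exprn_ege1// ler1n].
have main t x : 1 <= x -> t1 <= t / x -> aR (t / x) <= 2 `^ b * x `^ (- b) * aR t.
  move=> x1 t1x; have x0 : 0 < x by rewrite (lt_le_trans _ x1).
  have [k /andP[k1 k2]] := dyadic x1.
  have t0 : 0 < t by have := lt_le_trans t10 t1x; rewrite pmulr_lgt0// invr_gt0.
  have h1 : aR (2 ^+ k * (t / x)) <= aR t.
    apply: aR_nd; rewrite mulrCA ler_piMr ?(ltW t0)//.
    by rewrite ler_pdivrMr// mul1r.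
  have h2 := le_trans (it k _ t1x) h1.
  have h3 : x `^ b <= 2 `^ b * (2 ^+ k) `^ b.
    rewrite -powRM// ?exprn_ge0//; apply: ge0_ler_powR; rewrite ?(ltW b0)//.
    - by rewrite nnegrE ltW.
    - by rewrite nnegrE mulr_ge0// exprn_ge0.
    - by rewrite -exprS ltW.
  rewrite powRN mulrAC ler_pdivlMr ?powR_gt0//.
  apply: (@le_trans _ _ (aR (t / x) * (2 `^ b * (2 ^+ k) `^ b))).
    by rewrite ler_wpM2l ?aR_ge0.
  by rewrite mulrCA ler_wpM2l ?powR_ge0// mulrC.
have t1b : 1 <= t1 `^ b.
  have -> : 1 = 1 `^ b :> R by rewrite powR1.
  by apply: ge0_ler_powR; rewrite ?nnegrE ?(ltW b0)// ltW.
exists (2 `^ b * t1 `^ b), t1; split => //.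
- by rewrite mulr_gt0 ?powR_gt0.
- by apply: (hM _ (t1M _ (lexx _))).2.
move=> t x t1t x1 xt; have x0 : 0 < x by rewrite (lt_le_trans _ x1).
have t0 : 0 < t := lt_le_trans t10 t1t.
have [h|h] := leP t1 (t / x).
  apply: (le_trans (main t x x1 h)); rewrite ler_wpM2r ?aR_ge0//.
  by rewrite ler_wpM2r ?powR_ge0// ler_peMr ?powR_ge0.
apply: (@le_trans _ _ (aR t1)); first by apply: aR_nd; exact: ltW.
have tt : t / (t / t1) = t1 by rewrite invf_div mulrC divfK ?gt_eqF.
have := main t (t / t1); rewrite tt; move=> /(_ _ (lexx _)) h1.
apply: (le_trans (h1 _)); first by rewrite ler_pdivlMr// mul1r.
rewrite ler_wpM2r ?aR_ge0// -mulrA ler_wpM2l ?powR_ge0//.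
rewrite !powRN powR_div ?(ltW t10) ?(ltW t0)//.
rewrite invf_div ler_wpM2l ?powR_ge0//.
rewrite lef_pV2 ?posrE ?powR_gt0//.
by apply: ge0_ler_powR; rewrite ?nnegrE ?(ltW b0)// ltW.
Unshelve. all: by end_near. Qed.

(** Potter's bound at [x = t / t0], where the left-hand side is the fixed value [aR t0 >= 1]. *)
Lemma aR_growth b : 0 < b < gamma^-1 -> exists2 c, 0 < c &
  \forall t \near +oo, c * t `^ b <= aR t.
Proof.
move=> hb; have [C [t0 [C0 t01 a1 h]]] := aR_potter hb.
have t00 : 0 < t0 by rewrite (lt_le_trans _ t01).
exists ((C * t0 `^ b)^-1); first by rewrite invr_gt0 mulr_gt0 ?powR_gt0.
exists t0; split; first exact: num_real.
move=> t tt; have tp : 0 < t := lt_trans t00 tt.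
have tt' : t / (t / t0) = t0 by rewrite invf_div mulrC divfK ?gt_eqF.
have := h t (t / t0) (ltW tt); rewrite tt' => /(_ _ _)/(le_trans a1) h1.
rewrite mulrC ler_pdivrMr ?mulr_gt0 ?powR_gt0// mulrC.
move: h1; rewrite powRN powR_div ?(ltW tp) ?(ltW t00)// invf_div => h2.
have : t `^ b * 1 <= t `^ b * (C * (t0 `^ b / t `^ b) * aR t).
  rewrite ler_wpM2l ?powR_ge0//; apply: h2.
  - by rewrite ler_pdivlMr// mul1r ltW.
  - by rewrite ler_pdivrMr// ler_peMr// ltW.
rewrite mulr1; congr (_ <= _).
have tn : t `^ b != 0 by rewrite gt_eqF// powR_gt0.
by field.
Qed.

(** Choose [1 < q < gamma]. With [x = aR t - 1] one has [1 / t < Fb x <= C x^(-q)], hence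
    [x / t <= C x^(1 - q)], and [x] tends to infinity. *)
Lemma aR_sublinear : 1 < gamma -> (aR t / t) @[t --> +oo] --> (0 : R).
Proof.
move=> g1; pose q := (1 + gamma) / 2.
have hq : 0 <= q < gamma by rewrite /q; apply/andP; split; move: g1; lra.
have q1 : 0 < q - 1 by rewrite /q; move: g1; lra.
have [C [t0 [C0 t00 h]]] := tail_powR_ub hq.
apply/cvgrPdist_le => e e0; near=> t.
pose K := (2 * C / e) `^ (q - 1)^-1.
have aK : Num.max (Num.max t0 1) K + 1 <= aR t.
  by near: t; move/cvgryPge : aR_cvgy; apply.
set x := aR t - 1.
have : Num.max (Num.max t0 1) K <= x by rewrite /x; move: aK; lra.
rewrite !ge_max => /andP[/andP[xt0 x1] xK].
have x0 : 0 < x by rewrite (lt_le_trans _ x1).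
have h1 : t^-1 < C * x `^ (- q).
  by apply: lt_le_trans (h _ xt0); apply: lt_Fb_aR => //; exact: ltW.
have h2 : x * (C * x `^ (- q)) <= e / 2.
  rewrite mulrCA -{1}(powRr1 (ltW x0)) -powRD ?(gt_eqF x0) ?implybT//.
  rewrite (_ : 1 - q = - (q - 1)); last by ring.
  rewrite powRN ler_pdivrMr ?powR_gt0//.
  have hK : 2 * C / e <= x `^ (q - 1).
    have -> : 2 * C / e = K `^ (q - 1).
      rewrite /K -powRrM mulVf ?gt_eqF// powRr1// divr_ge0 ?(ltW e0)//.
      by rewrite mulr_ge0// ltW.
    apply: ge0_ler_powR; rewrite ?nnegrE ?powR_ge0 ?(ltW q1) ?(ltW x0)//.
  by move: hK; rewrite ler_pdivrMr// mulrAC ler_pdivlMr// mulrC (mulrC (x `^ _)).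
rewrite sub0r normrN ger0_norm; last by rewrite divr_ge0 ?aR_ge0// ltW.
apply: (@le_trans _ _ (2 * x / t)).
  by rewrite ler_pM2r ?invr_gt0//; move: x1; rewrite /x; lra.
rewrite -mulrA mulrC -ler_pdivlMr//; apply: le_trans h2.
by rewrite ler_wpM2l// ltW.
Unshelve. all: by end_near. Qed.

End regular_variation.

(** * Power sums of the degrees *)

(** Only level sets are assumed measurable, so one formula serves both the degree on its probability
    space and the quantile on an interval of the line. *)
Lemma ge0_integral_countval {d} {T : measurableType d} {R : realType}
    (m : {measure set T -> \bar R}) (E : set T) (f : T -> nat) (h : nat -> R) :
  measurable E -> (forall k, measurable (E `&` f @^-1` [set k])) ->
  (forall k, 0 <= h k) ->
  (\int[m]_(x in E) (h (f x))%:E =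
   \sum_(k <oo) (h k)%:E * m (E `&` f @^-1` [set k]))%E.
Proof.
move=> mE mf h0.
have EU : E = \bigcup_k (E `&` f @^-1` [set k]).
  by apply/seteqP; split => [x Ex|x [k _ []//]]; exists (f x).
have tf : trivIset setT (fun k => E `&` f @^-1` [set k]).
  apply/trivIsetP => i j _ _ ij; apply/seteqP; split => // x [[_ /= fi] [_ /= fj]].
  by rewrite -fi -fj eqxx in ij.
have mh : measurable_fun E (fun x => (h (f x))%:E).
  move=> _ B _.
  rewrite (_ : _ `&` _ = \bigcup_(k in [set k | B (h k)%:E]) (E `&` f @^-1` [set k])).
    by apply: bigcup_measurable.
  apply/seteqP; split => [x [Ex Bx]|x [k /= Bk [Ex /= fx]]]; first by exists (f x).
  by split => //=; rewrite fx.
rewrite {1}EU ge0_integral_bigcup//; last 2 first.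
- by rewrite -EU.
- by move=> x _; rewrite lee_fin.
apply: eq_eseriesr => k _.
rewrite -integral_cst//; apply: eq_integral => x.
by rewrite inE => -[_ /= ->].
Qed.

(** With [y = u n / n], the squeeze is [exp (- y / (1 - y)) <= 1 - y <= exp (- y)] raised to the
    power [n]. *)
Lemma cvg_expn_exp {R : realType} (u : nat -> R) (x : R) :
  u n @[n --> \oo] --> x -> (1 - u n / n%:R) ^+ n @[n --> \oo] --> expR (- x).
Proof.
move=> ux.
have nV : (n%:R : R)^-1 @[n --> \oo] --> (0 : R).
  by rewrite -cvg_shiftS; exact: cvg_harmonic.
have u0 : u n / n%:R @[n --> \oo] --> (0 : R).
  by rewrite -[X in _ --> X](mulr0 x); exact: cvgM.
have c1 : expR (- u n) @[n --> \oo] --> expR (- x).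
  apply: (cvg_comp _ expR); last exact: continuous_expR.
  by apply: cvgN.
have c2 : expR (- (u n / (1 - u n / n%:R))) @[n --> \oo] --> expR (- x).
  apply: (cvg_comp _ expR); last exact: continuous_expR.
  apply: cvgN; rewrite -[X in _ --> X](divr1 x); apply: cvgM => //.
  apply: cvgV; first exact: oner_neq0.
  by rewrite -[X in _ --> X](subr0 1); apply: cvgB => //; exact: cvg_cst.
apply: (squeeze_cvgr _ c2 c1).
near=> n.
have n0 : 0 < n%:R :> R by rewrite ltr0n; near: n; exact: nbhs_infty_gt.
have y1 : u n / n%:R < 2^-1.
  near: n; apply: (cvgr_lt _ u0); by rewrite invr_gt0.
set y := u n / n%:R in y1 *.
have un : u n = n%:R * y by rewrite /y mulrCA divff ?mulr1// gt_eqF.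
have y1' : 0 < 1 - y by lra.
rewrite un -mulrA -(mulrN n%:R (y / (1 - y))) -(mulrN n%:R y) !expRM_natl; apply/andP; split.
  rewrite lerXn2r// ?nnegrE ?expR_ge0 ?(ltW y1')//.
  rewrite expRN -[leRHS]invrK lef_pV2 ?posrE ?invr_gt0 ?expR_gt0//.
  apply: le_trans (expR_ge1Dx _).
  rewrite le_eqVlt; apply/orP; left; apply/eqP.
  by field; rewrite gt_eqF.
rewrite lerXn2r// ?nnegrE ?expR_ge0 ?(ltW y1')//.
exact: expR_ge1Dx.
Unshelve. all: by end_near. Qed.

(** * The degree law and its quantile representation *)

Section sample.
Context {R : realType} (gamma : R) (L : R -> R)
  {dD : measure_display} {TD : measurableType dD} (PD : probability TD R)
  (D : nat -> TD -> nat).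
Local Notation mu := (@lebesgue_measure R).
Hypothesis g12 : 1 < gamma < 2.
Hypothesis Lsv : slowly_varying L.
Hypothesis mD : forall i, measurable_fun [set: TD] (D i).
Hypothesis tD : forall t : R, 0 < t ->
  PD [set w | t < (D 0%N w)%:R] = (L t * t `^ (- gamma))%:E.

Definition Fb (t : R) : R := fine (PD [set w | t < (D 0%N w)%:R]).

Lemma gamma_gt0 : 0 < gamma. Proof. by case/andP: g12; lra. Qed.

Lemma measurable_natset i (B : set nat) : measurable (D i @^-1` B).
Proof. by rewrite -[X in measurable X]setTI; exact: mD. Qed.

Lemma FbE t : PD [set w | t < (D 0%N w)%:R] = (Fb t)%:E.
Proof.
by rewrite fineK// fin_num_measure//; exact: (measurable_natset 0 [set k | t < k%:R]).
Qed.

Lemma Fb_ni x y : x <= y -> Fb y <= Fb x.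
Proof.
move=> xy; rewrite -lee_fin -!FbE; apply: le_measure; rewrite ?inE.
- exact: (measurable_natset 0 [set k | y < k%:R]).
- exact: (measurable_natset 0 [set k | x < k%:R]).
- by move=> w /=; exact: le_lt_trans.
Qed.

Lemma Fb_le1 x : Fb x <= 1.
Proof.
rewrite -lee_fin -FbE probability_le1//.
exact: (measurable_natset 0 [set k | x < k%:R]).
Qed.

Lemma FbL t : 0 < t -> Fb t = L t * t `^ (- gamma).
Proof. by move=> t0; apply: EFin_inj; rewrite -FbE tD. Qed.

Lemma Fb_gt0 x : 0 < Fb x.
Proof.
have [_ [[M [_ hM]] _]] := Lsv.
pose t := Num.max (Num.max x 1) (M + 1).
have t0 : 0 < t by rewrite !lt_max ltr01 orbT.
have Mt : M < t by rewrite !lt_max ltrDl ltr01 orbT.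
have xt : x <= t by rewrite !le_max lexx.
apply: lt_le_trans (Fb_ni xt).
by rewrite FbL// mulr_gt0 ?powR_gt0//; exact: hM.
Qed.

Lemma Fb_rv lam : 0 < lam ->
  (Fb (lam * t) / Fb t) @[t --> +oo] --> lam `^ (- gamma).
Proof.
move=> l0; have [_ [_ /(_ lam l0) h]] := Lsv.
rewrite -[X in _ --> X]mul1r.
have c : (L (lam * t) / L t) * lam `^ (- gamma) @[t --> +oo] --> 1 * lam `^ (- gamma).
  by apply: cvgM => //; exact: cvg_cst.
apply: cvg_trans c; apply: near_eq_cvg; near=> t.
have t0 : 0 < t by near: t; exact: nbhs_pinfty_gt.
rewrite !FbL ?mulr_gt0// powRM ?(ltW l0) ?(ltW t0)//.
have tn : t `^ (- gamma) != 0 by rewrite gt_eqF// powR_gt0.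
have Ln : L t != 0.
  by apply/eqP => L0; have := Fb_gt0 t; rewrite FbL// L0 mul0r ltxx.
by field; apply/andP.
Unshelve. all: by end_near. Qed.

Definition an (n : nat) : R := aR Fb n%:R.

(** Subtracting in [R] covers [k = 0] as well, since [Fb (- 1) = 1]. *)
Lemma Fb_pred (k : nat) : PD (D 0%N @^-1` [set k]) = (Fb (k%:R - 1) - Fb k%:R)%:E.
Proof.
rewrite EFinB -!FbE.
have -> : ([set w | (k%:R - 1 : R) < (D 0%N w)%:R] : set TD) =
          D 0%N @^-1` [set k] `|` [set w | (k%:R : R) < (D 0%N w)%:R].
  apply/seteqP; split => w /=.
    rewrite ltrBlDr natr1 ltr_nat ltnS leq_eqVlt ltr_nat => /orP[/eqP->|]; [by left|by right].
  move=> [->|]; rewrite ltrBlDr natr1 !ltr_nat ?ltnS//; exact: ltnW.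
rewrite measureU//.
- rewrite addeK// fin_num_measure//.
  exact: (measurable_natset 0 [set j | k%:R < j%:R]).
- exact: measurable_natset.
- exact: (measurable_natset 0 [set j | k%:R < j%:R]).
- by apply/seteqP; split => // w [/= -> ]; rewrite ltxx.
Qed.

(** The interval has length [n P(D = k)]: for [x] uniform on []0, n[] the quantile at [n / x] has
    the law of the degree. *)
Lemma aN_level (n : nat) (k : nat) : (0 < n)%N ->
  `]0%R, n%:R[ `&` (fun x => aN Fb (n%:R / x)) @^-1` [set k] =
  `[n%:R * Fb k%:R, n%:R * Fb (k%:R - 1)[%classic.
Proof.
move=> n0; have n0' : 0 < n%:R :> R by rewrite ltr0n.
have leqk x j : 0 < x -> (aN Fb (n%:R / x) <= j)%N = (n%:R * Fb j%:R <= x).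
  move=> x0; rewrite (aN_leq gamma_gt0 Fb_ni Fb_gt0 Fb_le1 Fb_rv) ?divr_gt0// invf_div.
  by rewrite ler_pdivlMr// mulrC.
have Fb1 : Fb (0 - 1) = 1.
  apply: EFin_inj; rewrite -FbE (_ : [set w | _] = setT) ?probability_setT//.
  by apply/seteqP; split => // w _ /=; rewrite ltrBlDr natr1 ltr0n.
apply/seteqP; split => x /=; rewrite !in_itv/=.
  move=> [/andP[x0 xn] xk]; apply/andP; split; first by rewrite -leqk// xk.
  rewrite ltNge; apply/negP; case: k xk => [|k] xk.
    by rewrite Fb1 mulr1 leNgt xn.
  by rewrite -natr1 addrK -leqk// xk ltnn.
move=> /andP[h1 h2].
have x0 : 0 < x by apply: lt_le_trans h1; rewrite mulr_gt0// Fb_gt0.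
split.
  rewrite x0/=; apply: lt_le_trans h2 _.
  by rewrite ler_piMr ?(ltW n0')// Fb_le1.
apply/eqP; rewrite eqn_leq leqk// h1/=.
case: k h1 h2 => // k h1 h2; rewrite ltnNge leqk// -ltNge.
by move: h2; rewrite -natr1 addrK.
Qed.

Lemma quantile_integral (n : nat) (h : nat -> R) : (0 < n)%N ->
  (forall k, 0 <= h k) ->
  (\int[mu]_(x in `]0%R, n%:R[) (h (aN Fb (n%:R / x)))%:E =
   n%:R%:E * \int[PD]_w (h (D 0%N w))%:E)%E.
Proof.
move=> n0 h0; have n0' : 0 < n%:R :> R by rewrite ltr0n.
rewrite (@ge0_integral_countval _ _ _ mu _ (fun x => aN Fb (n%:R / x)))//; last first.
  by move=> k; rewrite aN_level.
rewrite (@ge0_integral_countval _ _ _ PD setT (D 0%N))//; last first.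
  by move=> k; rewrite setTI; exact: measurable_natset.
rewrite -nneseriesZl; last first.
  by move=> k _; rewrite mule_ge0// lee_fin.
apply: eq_eseriesr => k _; rewrite aN_level// setTI.
rewrite [X in (_ = _ * (_ * X))%E](Fb_pred k).
have e : mu `[n%:R * Fb k%:R, n%:R * Fb (k%:R - 1)[%classic =
    (n%:R * (Fb (k%:R - 1) - Fb k%:R))%:E.
  rewrite lebesgue_measure_itv/= lte_fin ltr_pM2l//.
  have := @Fb_ni (k%:R - 1) k%:R ltac:(by rewrite gerBl).
  rewrite le_eqVlt => /predU1P[->|h1]; first by rewrite ltxx subrr mulr0.
  by rewrite h1 -EFinB -mulrBr.
rewrite [X in (_ * X = _)%E]e -!EFinM; congr EFin; ring.
Qed.

Definition psi (s t y : R) : R := s * y ^+ 2 + t * y ^+ 3.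

Lemma psi_ge0 s t y : 0 <= s -> 0 <= t -> 0 <= y -> 0 <= psi s t y.
Proof. by move=> s0 t0 y0; rewrite addr_ge0// mulr_ge0// exprn_ge0. Qed.

Lemma an_cvgy : an n @[n --> \oo] --> +oo.
Proof.
apply: (@cvg_comp _ _ _ (fun n : nat => n%:R : R) (aR Fb) _ _ _ (@cvgr_idn R)).
exact: (aR_cvgy gamma_gt0 Fb_ni Fb_gt0 Fb_le1 Fb_rv).
Qed.

(** An exponent admissible in Potter's bound for which [x^(- 2 b)] is still integrable at infinity;
    [gamma < 2] leaves room for it. *)
Let q2 : exists b, 2^-1 < b < gamma^-1.
Proof.
exists ((2^-1 + gamma^-1) / 2).
have : 2^-1 < gamma^-1 by rewrite ltf_pV2 ?posrE ?gamma_gt0//; case/andP: g12.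
by move=> h; apply/andP; split; lra.
Qed.

(** After the change to quantiles this is dominated convergence: [aR_ratio] gives the pointwise
    limit [x^(-1/gamma)] of the ratio to [an n], and [aR_potter] gives the majorant. *)
Lemma cvg_tail_integral s t : 0 <= s -> 0 <= t ->
  n%:R * Ex PD (fun w => 1 - expR (- psi s t ((D 0%N w)%:R / an n)))
    @[n --> \oo] --> lapI gamma s t.
Proof.
move=> s0 t0; have [b /andP[b1 b2]] := q2.
have b0 : 0 < b by apply: lt_trans b1; rewrite invr_gt0.
have [C [t1 [C0 t11 a1 pot]]] := aR_potter gamma_gt0 Fb_ni Fb_gt0 Fb_le1 Fb_rv
  (introT andP (conj b0 b2)).
have [N hN] : exists N : nat, t1 <= N%:R.
  by exists (Num.bound t1); apply: ltW; apply: archi_boundP; rewrite (le_trans _ t11).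
have N0 n : (N <= n)%N -> t1 <= n%:R.
  by move=> Nn; apply: (le_trans hN); rewrite ler_nat.
have an1 n : (N <= n)%N -> 1 <= an n.
  by move=> /N0 h; apply: (le_trans a1); apply: (aR_nd gamma_gt0 Fb_ni Fb_gt0 Fb_le1 Fb_rv).
pose h n k := 1 - expR (- psi s t (k%:R / an n)).
have h0 n k : 0 <= h n k.
  by rewrite subr_ge0 expR_le1 oppr_le0 psi_ge0// divr_ge0// aR_ge0.
pose f n (x : R) := (h n (aN Fb (n%:R / x)))%:E.
have b2' : 1 < 2 * b by move: b1; rewrite -(ltr_pM2l (ltr0Sn R 1)) divff//.
pose K := 1 + (s + t) * C ^+ 2.
have K0 : 0 <= K by rewrite addr_ge0// mulr_ge0 ?addr_ge0// exprn_ge0// ltW.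
have dom n x : (N <= n)%N -> 0 < x -> x < n%:R ->
    h n (aN Fb (n%:R / x)) <= K * powdom (2 * b) x.
  move=> Nn x0 xn; rewrite /powdom; case: ifPn => [_|].
    rewrite mulr1; apply: (@le_trans _ _ 1); last first.
      by rewrite /K lerDl mulr_ge0 ?addr_ge0// exprn_ge0// ltW.
    by rewrite /h gerBl expR_ge0.
  rewrite -ltNge => x1.
  set r := (aN Fb (n%:R / x))%:R / an n.
  have an0 : 0 < an n by rewrite (lt_le_trans _ (an1 _ Nn)).
  have r0 : 0 <= r by rewrite divr_ge0// ltW.
  have r1 : r <= 1.
    rewrite ler_pdivrMr// mul1r.
    apply: (aR_nd gamma_gt0 Fb_ni Fb_gt0 Fb_le1 Fb_rv).
    by rewrite ler_pdivrMr// ler_peMr ?ler0n// ltW.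
  have rC : r <= C * x `^ (- b).
    rewrite ler_pdivrMr//; apply: pot; [exact: N0|exact: ltW|exact: ltW].
  have hr : h n (aN Fb (n%:R / x)) <= psi s t r.
    by rewrite /h -/r; have := expR_ge1Dx (- psi s t r); lra.
  apply: (le_trans hr).
  (* Past [x = 1] the ratio is at most 1, so the cubic term is controlled by the quadratic one. *)
  have r3 : r ^+ 3 <= r ^+ 2 by rewrite exprS ler_piMl// exprn_ge0.
  have p2 : r ^+ 2 <= C ^+ 2 * x `^ (- (2 * b)).
    rewrite (_ : x `^ (- (2 * b)) = (x `^ (- b)) ^+ 2).
      by rewrite -exprMn lerXn2r ?nnegrE// mulr_ge0 ?powR_ge0// ltW.
    by rewrite -powR_mulrn ?powR_ge0// -powRrM mulNr mulrC.
  have P0 := powR_ge0 x (- (2 * b)).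
  rewrite /psi /K; set P := x `^ _ in p2 P0 *.
  have h1 : t * r ^+ 3 <= t * r ^+ 2 by rewrite ler_wpM2l.
  have h2 : (s + t) * r ^+ 2 <= (s + t) * (C ^+ 2 * P) by rewrite ler_wpM2l// addr_ge0.
  have e1 : (1 + (s + t) * C ^+ 2) * P = P + (s + t) * (C ^+ 2 * P) by ring.
  have e2 : (s + t) * r ^+ 2 = s * r ^+ 2 + t * r ^+ 2 by ring.
  by rewrite e1; move: h1 h2; rewrite e2; move: P0; lra.
have mfn n : (0 < n)%N ->
    measurable_fun (`]0%R, n%:R[%classic : set (measurableTypeR R)) (f n).
  move=> n0 _ B _.
  rewrite (_ : _ `&` _ = \bigcup_(k in [set k | B (h n k)%:E])
    (`]0%R, n%:R[ `&` (fun x => aN Fb (n%:R / x)) @^-1` [set k])).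
    by apply: bigcup_measurable => k _; rewrite aN_level.
  apply/seteqP; split => [x [Ex Bx]|x [k /= Bk [Ex /= fx]]].
    by exists (aN Fb (n%:R / x)).
  by split => //=; rewrite /f fx.
(* The shift starts the sequence where Potter's bound holds and keeps the index positive; the
   restriction moves all integrals to one domain. *)
pose g n := (f (n + N.+1)%N) \_ `]0%R, (n + N.+1)%:R[.
have := @dominated_convergence _ _ _ mu `]0%R, +oo[ _ g
  (fun x => (1 - kap gamma s t x)%:E) (fun x => (K * powdom (2 * b) x)%:E).
have mi : measurable (`]0%R, +oo[ : set (measurableTypeR R)) by [].
case.
- by [].
- move=> n; apply: measurable_funTS; apply/(measurable_restrictT _ _).1 => //.
  by apply: mfn; rewrite addnS.
- apply/measurable_EFinP; apply: measurable_funTS; apply: measurable_funB => //.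
  exact: measurable_kap.
- apply/aeW => x; rewrite /= in_itv/= andbT => x0; rewrite /kap x0.
  have rc : aR Fb (x^-1 * n%:R) / aR Fb n%:R @[n --> \oo] --> x^-1 `^ gamma^-1.
    have xi : 0 < x^-1 by rewrite invr_gt0.
    exact: (cvg_comp _ _ (@cvgr_idn R) (aR_ratio gamma_gt0 Fb_ni Fb_gt0 Fb_le1 Fb_rv xi)).
  have rc' : (aN Fb (n%:R / x))%:R / an n @[n --> \oo] --> x^-1 `^ gamma^-1.
    move: rc; rewrite (_ : (fun n => _) = (fun n => (aN Fb (n%:R / x))%:R / an n))//.
    by apply/funext => n; rewrite [x^-1 * _]mulrC.
  have xp p : (x^-1 `^ gamma^-1) ^+ p = x `^ (- (p%:R / gamma)).
    rewrite -powR_mulrn ?powR_ge0// -(powR_inv1 (ltW x0)) -!powRrM.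
    by congr (_ `^ _); ring.
  have c : h n (aN Fb (n%:R / x)) @[n --> \oo] --> 1 - expR (- phi gamma s t x).
    apply: cvgB; first exact: cvg_cst.
    apply: (cvg_comp _ expR); last exact: continuous_expR.
    apply: cvgN; rewrite /phi -!xp; apply: cvgD; apply: cvgM; try exact: cvg_cst.
      by apply: (cvg_comp _ (fun y : R => y ^+ 2) rc'); exact: exprn_continuous.
    by apply: (cvg_comp _ (fun y : R => y ^+ 3) rc'); exact: exprn_continuous.
  apply/fine_cvgP; split.
    by apply: nearW => n; rewrite /g patchE; case: ifP.
  have : h (n + N.+1)%N (aN Fb ((n + N.+1)%N%:R / x)) @[n --> \oo] --> 1 - expR (- phi gamma s t x).
    by move: c; rewrite -(cvg_shiftn N.+1).
  apply: cvg_trans; apply: near_eq_cvg; near=> n.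
  rewrite /g /= patchE ifT// inE/= in_itv/= x0/=.
  apply: (@lt_le_trans _ _ n%:R); last by rewrite ler_nat leq_addr.
  near: n; exact: nbhs_infty_gtr.
- have ip : mu.-integrable `]0%R, +oo[ (EFin \o powdom (2 * b)).
    apply: integrableS (integrable_powdom b2') => //.
    by apply: subset_itvr; rewrite bnd_simp.
  have := integrableZl mi K ip.
  by apply: eq_integrable => // x _; rewrite /= EFinM.
- apply/aeW => x n; rewrite /= in_itv/= andbT => x0.
  rewrite /g patchE; case: ifPn => [|_]; last first.
    by rewrite abse0 lee_fin mulr_ge0 ?powdom_ge0.
  rewrite inE/= in_itv/= => /andP[_ xn]; rewrite /f /= lee_fin ger0_norm ?h0//.
  by apply: dom => //; rewrite addnS leqW// leq_addl.
move=> _ _.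
rewrite integral_itv_obnd_cbnd; last first.
  apply/measurable_EFinP; apply: measurable_funTS; apply: measurable_funB => //.
  exact: measurable_kap.
rewrite lapIE// => c.
have bh n : bmf (fun w => h n (D 0%N w)).
  split.
    apply: (measurableT_comp (f := h n)); last exact: mD.
    by move=> _ B _; rewrite setTI.
  by exists 1 => w; rewrite ger0_norm ?h0// /h gerBl expR_ge0.
rewrite -(cvg_shiftn N.+1).
have /fine_cvgP[_] : (\int[mu]_(x in `]0%R, +oo[) g n x)%E @[n --> \oo] --> (lapI gamma s t)%:E by [].
rewrite (_ : fine \o _ = fun n => (n + N.+1)%:R * Ex PD (fun w => h (n + N.+1)%N (D 0%N w)))//.
apply/funext => n /=.
rewrite /g -integral_mkcondr.
rewrite (_ : _ `&` _ = `]0%R, (n + N.+1)%:R[%classic); last first.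
  apply/seteqP; split => x /=; rewrite !in_itv/=; first by case.
  by move=> /andP[x0 xn]; rewrite x0 xn.
rewrite /f quantile_integral//; last by rewrite addnS.
by rewrite (ExE PD (bh _)) -EFinM.
Unshelve. all: by end_near. Qed.

End sample.

(** * Transforms, moments and law of large numbers for the sample *)

Section sample_sums.
Context {R : realType} (gamma : R) (L : R -> R)
  {dD : measure_display} {TD : measurableType dD} (PD : probability TD R)
  (D : nat -> TD -> nat).
Local Notation mu := (@lebesgue_measure R).
Hypothesis g12 : 1 < gamma < 2.
Hypothesis Lsv : slowly_varying L.
Hypothesis mD : forall i, measurable_fun [set: TD] (D i).
Hypothesis iD : mutually_independent PD D.
Hypothesis idD : forall i k, PD (D i @^-1` [set k]) = PD (D 0%N @^-1` [set k]).
Hypothesis tD : forall t : R, 0 < t ->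
  PD [set w | t < (D 0%N w)%:R] = (L t * t `^ (- gamma))%:E.
Local Notation an := (an PD D).
Local Notation Fb := (Fb PD D).

Let mnat (h : nat -> R) : measurable_fun [set: nat] h.
Proof. by move=> _ B _; rewrite setTI. Qed.

Lemma integral_idD i (h : nat -> R) : (forall k, 0 <= h k) ->
  (\int[PD]_w (h (D i w))%:E = \int[PD]_w (h (D 0%N w))%:E)%E.
Proof.
move=> h0; rewrite !(@ge0_integral_countval _ _ _ PD setT _ h)//.
- by apply: eq_eseriesr => k _; rewrite !setTI; congr (_ * _)%E; exact: idD.
- by move=> k; rewrite setTI; exact: measurable_natset.
- by move=> k; rewrite setTI; exact: measurable_natset.
Qed.

Lemma Ex_sample_prod n (h : nat -> R) : (forall k, 0 <= h k <= 1) ->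
  Ex PD (fun w => \prod_(i < n) h (D i w)) = Ex PD (fun w => h (D 0%N w)) ^+ n.
Proof.
move=> h01; rewrite (@indep_Ex_prod _ _ _ _ _ PD D mD n (fun=> h))//.
rewrite (eq_bigr (fun=> Ex PD (fun w => h (D 0%N w)))).
  by rewrite prodr_const card_ord.
move=> i _; rewrite /Ex; congr fine; apply: (@integral_idD i h) => k.
by case/andP: (h01 k).
Qed.

Definition An n w : R := \sum_(i < n) ((D i w)%:R / an n) ^+ 2.
Definition Bn n w : R := \sum_(i < n) ((D i w)%:R / an n) ^+ 3.
Definition Ln n w : R := \sum_(i < n) (D i w)%:R.

Lemma An_ge0 n w : 0 <= An n w.
Proof. by apply: sumr_ge0 => i _; rewrite exprn_ge0// divr_ge0// aR_ge0. Qed.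

Lemma Bn_ge0 n w : 0 <= Bn n w.
Proof. by apply: sumr_ge0 => i _; rewrite exprn_ge0// divr_ge0// aR_ge0. Qed.

Lemma bmf_natD i (h : nat -> R) (M : R) : (forall k, `|h k| <= M) ->
  bmf (fun w => h (D i w)).
Proof.
move=> hM; split; last by exists M => w; exact: hM.
exact: (measurableT_comp (mnat h)).
Qed.

(** Independence turns the transform into the [n]-th power of [1 - u / n], where [u] is the sequence
    of [cvg_tail_integral]. *)
Lemma laplace_sample s t : 0 <= s -> 0 <= t ->
  Ex PD (fun w => expR (- (s * An n w + t * Bn n w))) @[n --> \oo] -->
  expR (- lapI gamma s t).
Proof.
move=> s0 t0.
pose h n k : R := expR (- psi s t (k%:R / an n)).
have h01 n k : 0 <= h n k <= 1.
  by rewrite expR_ge0/= expR_le1 oppr_le0 psi_ge0// divr_ge0// aR_ge0.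
have bh n : bmf (fun w => h n (D 0%N w)).
  apply: (@bmf_natD 0%N (h n) 1) => k.
  by have /andP[a b] := h01 n k; rewrite ger0_norm.
have := cvg_expn_exp (cvg_tail_integral g12 Lsv mD tD s0 t0).
apply: cvg_trans; apply: near_eq_cvg; near=> n.
have n0 : n%:R != 0 :> R by rewrite pnatr_eq0 -lt0n; near: n; exact: nbhs_infty_gt.
rewrite mulrAC divff// mul1r (ExB PD (bmf_cst _) (bh n)) Ex_cst subKr.
rewrite -Ex_sample_prod//; congr Ex; apply/funext => w.
rewrite /h -expR_sum; congr expR; rewrite sumrN; congr (- _).
by rewrite /psi big_split/= -!mulr_sumr.
Unshelve. all: by end_near. Qed.

(** The layer-cake formula gives [E D^p] as the integral of [Fb (r^(1/p))], which decays like
    [r^(- q/p)] for some [q] between [p] and [gamma]. *)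
Lemma moment_fin p : 0 < p < gamma -> exists2 C : R, 0 < C &
  (\int[PD]_w (((D 0%N w)%:R + 1) `^ p)%:E <= C%:E)%E.
Proof.
move=> /andP[p0 pg]; pose q := (p + gamma) / 2.
have hq : 0 <= q < gamma by rewrite /q; apply/andP; split; lra.
have pq : p < q by rewrite /q; lra.
have q0 : 0 < q by exact: lt_trans pq.
have [C [t0 [C0 t00 hC]]] := tail_powR_ub (@Fb_ni _ _ _ PD D mD)
  (Fb_gt0 Lsv mD tD) (Fb_le1 PD mD) (@Fb_rv _ _ _ _ _ PD D Lsv mD tD) hq.
have qp : 1 < q / p by rewrite ltr_pdivlMr// mul1r.
pose h (k : nat) : R := k%:R `^ p.
have mX : measurable_fun setT (fun w => h (D 0%N w)) by exact: (measurableT_comp (mnat h)).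
pose X := @MeasurableFun.Pack _ _ _ _ (fun w => h (D 0%N w))
  (MeasurableFun.Class (isMeasurableFun.Build _ _ _ _ (fun w => h (D 0%N w)) mX)).
(* The three terms cover three ranges: [r <= 1], the range of the power bound, and
   [r^(1/p) < t0]. *)
pose K := 1 + C + t0 `^ q.
have K0 : 0 <= K by rewrite !addr_ge0 ?powR_ge0// ltW.
have kp r : 0 <= r -> Fb (r `^ p^-1) <= K * powdom (q / p) r.
  move=> r0; rewrite /powdom; case: ifPn => [_|].
    rewrite mulr1; apply: (le_trans (Fb_le1 PD mD _)).
    by rewrite /K -addrA lerDl addr_ge0 ?powR_ge0// ltW.
  rewrite -ltNge => r1; have {}r0 : 0 < r by exact: lt_trans r1.
  have [h1|h1] := leP t0 (r `^ p^-1).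
    apply: (le_trans (hC _ h1)); rewrite -powRrM mulrN mulrC (mulrC p^-1).
    rewrite mulrC ler_wpM2r ?powR_ge0// /K.
    by have := powR_ge0 t0 q; lra.
  apply: (le_trans (Fb_le1 PD mD _)).
  apply: (@le_trans _ _ (t0 `^ q * r `^ (- (q / p)))); last first.
    by rewrite ler_wpM2r ?powR_ge0// /K lerDr addr_ge0// ltW.
  rewrite powRN ler_pdivlMr ?powR_gt0// mul1r (mulrC q) powRrM.
  by apply: ge0_ler_powR; rewrite ?nnegrE ?powR_ge0 ?(ltW q0)// ltW.
have : (\int[PD]_w (h (D 0%N w))%:E <= \int[mu]_(x in `[0%R, +oo[) (K * powdom (q / p) x)%:E)%E.
  have := @ge0_expectation_ccdf _ _ _ PD X (fun w => powR_ge0 _ _).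
  rewrite unlock => ->; apply: ge0_le_integral => //.
  - by apply: measurable_funTS; exact: ccdf_measurable.
  - apply/measurable_EFinP; apply: measurable_funTS; apply: measurable_funM => //.
    exact: measurable_powdom.
  - move=> r; rewrite /= in_itv/= andbT => r0.
    rewrite (_ : ccdf X r = (Fb (r `^ p^-1))%:E); first by rewrite lee_fin kp.
    rewrite -FbE// /ccdf /distribution /pushforward/=; congr (PD _).
    apply/seteqP; split => w /=; rewrite in_itv/= andbT /h => hw.
      have rp : r = (r `^ p^-1) `^ p by rewrite -powRrM mulVf ?gt_eqF// powRr1.
      rewrite ltNge; apply/negP => hw2; move: hw; rewrite rp ltNge => /negP; apply.
      by apply: ge0_ler_powR; rewrite ?nnegrE ?powR_ge0 ?(ltW p0).
    have rp : r = (r `^ p^-1) `^ p by rewrite -powRrM mulVf ?gt_eqF// powRr1.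
    by rewrite rp; apply: gt0_ltr_powR; rewrite ?nnegrE ?powR_ge0.
move=> hX.
have ik : (\int[mu]_(x in `[0%R, +oo[) (K * powdom (q / p) x)%:E < +oo)%E.
  have mi : measurable (`[0%R, +oo[ : set (measurableTypeR R)) by [].
  have /integrableP[_] := integrableZl mi K (integrable_powdom qp).
  apply: le_lt_trans; rewrite le_eqVlt; apply/orP; left; apply/eqP.
  apply: eq_integral => x _; rewrite /= normrM (ger0_norm K0) ger0_norm ?powdom_ge0//.
pose I := (\int[PD]_w (h (D 0%N w))%:E)%E.
have I0 : (0 <= I)%E by apply: integral_ge0 => w _; rewrite lee_fin powR_ge0.
have If : I \is a fin_num by rewrite ge0_fin_numE// (le_lt_trans hX ik).
exists (1 + 2 `^ p * fine I).
  by rewrite ltr_pwDl// mulr_ge0 ?powR_ge0// fine_ge0.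
apply: (@le_trans _ _ (\int[PD]_w (1%:E + (2 `^ p)%:E * (h (D 0%N w))%:E))%E).
  apply: ge0_le_integral => //.
  - by apply/measurable_EFinP; exact: (measurableT_comp (mnat (fun k => (k%:R + 1) `^ p))).
  - by apply/measurable_EFinP; exact: (measurableT_comp (mnat (fun k => 1 + 2 `^ p * h k))).
  - move=> w _; rewrite -EFinM -EFinD lee_fin /h.
    case: (D 0%N w) => [|k]; first by rewrite add0r powR1 lerDl mulr_ge0 ?powR_ge0.
    rewrite -powRM//; apply: (@le_trans _ _ ((2 * k.+1%:R) `^ p)); last by rewrite lerDr.
    apply: ge0_ler_powR; rewrite ?nnegrE ?(ltW p0) ?addr_ge0 ?mulr_ge0//.
    by rewrite mulr_natl mulr2n lerD2l ler1n.
rewrite ge0_integralD//=; last 2 first.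
- by move=> w _; rewrite -EFinM lee_fin mulr_ge0 ?powR_ge0.
- by apply: (emeasurable_funM (measurable_cst _)); apply/measurable_EFinP.
have mh : measurable_fun setT (fun w => (h (D 0%N w))%:E) by exact/measurable_EFinP.
rewrite integral_cst//= probability_setT mule1 (ge0_integralZl _ measurableT mh)//.
- by rewrite EFinD EFinM fineK.
- by move=> w _; rewrite lee_fin powR_ge0.
Qed.

Definition meanD : R := fine ('E_PD[fun w => (D 0%N w)%:R])%E.

Let mDR i : measurable_fun setT (fun w => (D i w)%:R : R).
Proof. exact: (measurableT_comp (mnat (fun k => k%:R))). Qed.

Lemma integrableD : PD.-integrable setT (EFin \o (fun w => (D 0%N w)%:R : R)).
Proof.
have [|C C0 hC] := @moment_fin 1; first by case/andP: g12; lra.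
apply/integrableP; split; first exact/measurable_EFinP.
apply: le_lt_trans (le_lt_trans hC (ltry C)); apply: ge0_le_integral => //.
- by apply: measurableT_comp => //; exact/measurable_EFinP.
- by apply/measurable_EFinP; exact: (measurableT_comp (mnat (fun k => (k%:R + 1) `^ 1))).
- move=> w _; rewrite /= lee_fin ger0_norm// powRr1 ?addr_ge0//.
  by rewrite lerDl.
Qed.

Lemma meanDE : (\int[PD]_w ((D 0%N w)%:R)%:E)%E = meanD%:E.
Proof.
by rewrite /meanD unlock fineK//; exact: integrable_fin_num integrableD.
Qed.

Lemma meanD_gt0 : 0 < meanD.
Proof.
have h1 : 0 < Fb 0 := Fb_gt0 Lsv mD tD 0.
apply: lt_le_trans h1 _; rewrite -lee_fin -meanDE -FbE//.
have mE := measurable_natset mD 0 [set k | (0 : R) < k%:R].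
rewrite -[leLHS](_ : \int[PD]_w (\1_(D 0%N @^-1` [set k | (0 : R) < k%:R]) w)%:E = _)%E; last first.
  by rewrite integral_indic// setIT.
apply: ge0_le_integral => //.
- by apply/measurable_EFinP; exact: measurable_indic.
- exact/measurable_EFinP.
- move=> w _; rewrite indicE lee_fin; case: (boolP (_ \in _)) => //.
  by rewrite inE/= ltr0n ler1n.
Qed.

(** The rate is now [n (1 - E exp (- s D / n))]; its integrand tends to [s D] and is dominated by
    it. *)
Lemma laplace_mean (s : R) : 0 <= s ->
  Ex PD (fun w => expR (- (s * (Ln n w / n%:R)))) @[n --> \oo] --> expR (- (s * meanD)).
Proof.
move=> s0.
pose h n k : R := expR (- (s * (k%:R / n%:R))).
have h01 n k : 0 <= h n k <= 1.
  by rewrite expR_ge0/= expR_le1 oppr_le0 mulr_ge0// divr_ge0.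
have bh n : bmf (fun w => h n (D 0%N w)).
  apply: (@bmf_natD 0%N (h n) 1) => k.
  by have /andP[a b] := h01 n k; rewrite ger0_norm.
have c : n%:R * Ex PD (fun w => 1 - h n (D 0%N w)) @[n --> \oo] --> s * meanD.
  have mh n : measurable_fun setT (fun w => n%:R * (1 - h n (D 0%N w))).
    exact: (measurableT_comp (mnat (fun k => n%:R * (1 - h n k)))).
  have isD : PD.-integrable setT (EFin \o (fun w => s * (D 0%N w)%:R)).
    have := integrableZl measurableT s integrableD.
    by apply: eq_integrable => // w _; rewrite /= EFinM.
  have hle n k : 0 <= n%:R * (1 - h n k) <= s * k%:R.
    have /andP[a b] := h01 n k; rewrite mulr_ge0 ?subr_ge0//=.
    case: n a b => [|n] a b; first by rewrite mul0r mulr_ge0.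
    have := expR_ge1Dx (- (s * (k%:R / n.+1%:R))); rewrite -/(h n.+1 k) => h1.
    apply: (@le_trans _ _ (n.+1%:R * (s * (k%:R / n.+1%:R)))).
      rewrite ler_wpM2l//; move: h1.
      by move: (h n.+1 k) (s * (k%:R / n.+1%:R)) => u v; lra.
    by rewrite mulrCA (mulrCA n.+1%:R) divff ?pnatr_eq0// mulr1.
  have [||||_ _] := @dominated_convergence _ _ _ PD setT measurableT
    (fun n => EFin \o (fun w => n%:R * (1 - h n (D 0%N w))))
    (EFin \o (fun w => s * (D 0%N w)%:R)) (EFin \o (fun w => s * (D 0%N w)%:R)) _ _ _ isD.
  - by move=> n; exact/measurable_EFinP.
  - by case/integrableP: isD.
  - apply/aeW => w _; apply/fine_cvgP; split; first exact: nearW.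
    set y := s * (D 0%N w)%:R.
    have nV : (n%:R : R)^-1 @[n --> \oo] --> (0 : R).
      by rewrite -cvg_shiftS; exact: cvg_harmonic.
    have c1 : y * expR (- (y * n%:R^-1)) @[n --> \oo] --> y * expR (- (y * 0)).
      apply: cvgM; first exact: cvg_cst.
      apply: (cvg_comp _ expR); last exact: continuous_expR.
      by apply: cvgN; apply: cvgM => //; exact: cvg_cst.
    rewrite mulr0 oppr0 expR0 mulr1 in c1.
    apply: (squeeze_cvgr _ c1 (cvg_cst y)).
    near=> n; rewrite /=.
    have /andP[_ ->] := hle n (D 0%N w); rewrite andbT.
    have n0 : 0 < n%:R :> R by rewrite ltr0n; near: n; exact: nbhs_infty_gt.
    rewrite /h mulrA -/y.
    (* exp(z) >= 1 + z multiplied by exp(-z) *)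
    have h1 := expR_ge1Dx (y * n%:R^-1).
    have h2 : expR (y * n%:R^-1) * expR (- (y * n%:R^-1)) = 1 by rewrite expRxMexpNx_1.
    have h3 := expR_gt0 (- (y * n%:R^-1)).
    set E := expR (- _) in h2 h3 *.
    have h4 : (1 + y * n%:R^-1) * E <= expR (y * n%:R^-1) * E by rewrite ler_wpM2r// ltW.
    rewrite h2 mulrDl mul1r in h4.
    have h5 : n%:R * (y * n%:R^-1 * E) <= n%:R * (1 - E).
      by rewrite ler_pM2l//; move: (y * n%:R^-1 * E) h4 => z; lra.
    apply: le_trans h5; rewrite (_ : n%:R * _ = y * E)//.
    by rewrite mulrA mulrCA divff ?mulr1// gt_eqF.
  - apply/aeW => w n _; rewrite /= lee_fin.
    by have /andP[a b] := hle n (D 0%N w); rewrite ger0_norm.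
  move=> c; have /fine_cvgP[_] : (\int[PD]_w (n%:R * (1 - h n (D 0%N w)))%:E)%E @[n --> \oo] --> (s * meanD)%:E.
    rewrite -(_ : (\int[PD]_w (s * (D 0%N w)%:R)%:E)%E = (s * meanD)%:E); first exact: c.
    under eq_integral => w _ do rewrite EFinM.
    by rewrite (integralZl measurableT integrableD) EFinM meanDE.
  apply: cvg_trans; apply: near_eq_cvg; apply: nearW => n /=.
  exact: (ExZ PD _ (bmfB (bmf_cst _) (bh n))).
have := cvg_expn_exp c.
apply: cvg_trans; apply: near_eq_cvg; near=> n.
have n0 : n%:R != 0 :> R by rewrite pnatr_eq0 -lt0n; near: n; exact: nbhs_infty_gt.
rewrite mulrAC divff// mul1r (ExB PD (bmf_cst _) (bh n)) Ex_cst subKr.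
rewrite -Ex_sample_prod//; congr Ex; apply/funext => w.
rewrite /h -expR_sum; congr expR; rewrite sumrN; congr (- _).
by rewrite /Ln -mulr_sumr -mulr_suml.
Unshelve. all: by end_near. Qed.

Lemma Ln_ge0 n w : 0 <= Ln n w.
Proof. exact: sumr_ge0. Qed.

Lemma measurable_Ln n : measurable_fun setT (Ln n).
Proof. by apply: measurable_sum => i; exact: mDR. Qed.

Lemma wlln : Ex PD (fun w => (expR (- (Ln n w / n%:R)) - expR (- meanD)) ^+ 2)
  @[n --> \oo] --> (0 : R).
Proof.
have bE (s : R) n : 0 <= s -> bmf (fun w => expR (- (s * (Ln n w / n%:R)))).
  move=> s0; split.
    apply: (@measurableT_comp _ _ _ _ _ _ expR); first exact: measurable_expR.
    apply: measurable_funN; apply: measurable_funM => //.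
    by apply: measurable_funM => //; exact: measurable_Ln.
  exists 1 => w; rewrite ger0_norm ?expR_ge0// expR_le1 oppr_le0.
  by rewrite mulr_ge0// divr_ge0// Ln_ge0.
have e n : Ex PD (fun w => (expR (- (Ln n w / n%:R)) - expR (- meanD)) ^+ 2) =
   Ex PD (fun w => expR (- (2 * (Ln n w / n%:R)))) +
   (- 2 * expR (- meanD)) * Ex PD (fun w => expR (- (1 * (Ln n w / n%:R)))) +
   expR (- (2 * meanD)).
  have b1 := bE 1 n ler01; have b2 := bE 2 n ltac:(by []).
  rewrite -(ExZ PD _ b1) -(ExD PD b2 (bmfM (bmf_cst _) b1)).
  rewrite -(Ex_cst PD (expR (- (2 * meanD)))) -ExD; last 2 first.
  - exact: bmfD b2 (bmfM (bmf_cst _) b1).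
  - exact: bmf_cst.
  congr Ex; apply/funext => w; rewrite mul1r.
  rewrite -[2 * (Ln n w / n%:R)]/(2%:R * (Ln n w / n%:R)) -!mulrN !expRM_natl; ring.
have c1 := @laplace_mean 1 ler01; have c2 := @laplace_mean 2 ltac:(by []).
have z : expR (- (2 * meanD)) +
  (- 2 * expR (- meanD)) * expR (- (1 * meanD)) + expR (- (2 * meanD)) = 0.
  by rewrite mul1r -[2 * meanD]/(2%:R * meanD) -!mulrN !expRM_natl; ring.
rewrite -z.
have c3 : Ex PD (fun w => expR (- (2 * (Ln n w / n%:R)))) +
   (- 2 * expR (- meanD)) * Ex PD (fun w => expR (- (1 * (Ln n w / n%:R)))) +
   expR (- (2 * meanD)) @[n --> \oo] --> expR (- (2 * meanD)) +
  (- 2 * expR (- meanD)) * expR (- (1 * meanD)) + expR (- (2 * meanD)).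
  apply: cvgD; last exact: cvg_cst.
  by apply: cvgD => //; apply: cvgM => //; exact: cvg_cst.
apply: cvg_trans c3; apply: near_eq_cvg; apply: nearW => n.
by rewrite e.
Qed.

Lemma moment_pair p i j (C : R) : 0 <= C -> i != j ->
  (\int[PD]_w (((D 0%N w)%:R + 1) `^ p)%:E <= C%:E)%E ->
  (\int[PD]_w ((((D i w)%:R + 1) `^ p) * (((D j w)%:R + 1) `^ p))%:E <= (C ^+ 2)%:E)%E.
Proof.
move=> C0 + hC; wlog ij : i j / (i < j)%N => [h|_].
  rewrite neq_ltn => /orP[ij|ij]; first by apply: h => //; rewrite ltn_eqF.
  under eq_integral => w _ do rewrite mulrC.
  by apply: h => //; rewrite ltn_eqF.
pose g k : R := (k%:R + 1) `^ p.
have mg : measurable_fun setT (EFin \o g) by exact/measurable_EFinP.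
have g0 k : (0 <= (g k)%:E)%E by rewrite lee_fin powR_ge0.
have := indep_pair_integral mD iD ij mg mg g0 g0.
rewrite /= !(@integral_idD _ g); last 2 first.
- by move=> k; exact: powR_ge0.
- by move=> k; exact: powR_ge0.
under eq_integral => w _ do rewrite -EFinM.
move=> ->; rewrite expr2 EFinM; apply: lee_pmul => //.
- by apply: integral_ge0 => w _; rewrite lee_fin powR_ge0.
- by apply: integral_ge0 => w _; rewrite lee_fin powR_ge0.
Qed.

End sample_sums.

(** * Weak convergence from Laplace transforms *)

(** Only [x] has to lie in [K]. The second argument will be a Bernstein node or the coefficient of
    the erased graph, neither of which is confined to the compact set. *)
Lemma heine_cantor {R : realType} {T : pseudoMetricType R} (K : set T) (f : T -> R)
    (e : R) : compact K -> continuous f -> 0 < e ->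
  exists2 dl : R, 0 < dl & forall x y, K x -> ball x dl y -> `|f x - f y| <= e.
Proof.
move=> cK cf e0.
have e2 : 0 < e / 2 by rewrite divr_gt0.
have := (compact_near_coveringP K).1 cK R 0^'+
  (fun dl x => forall y, ball x dl y -> `|f x - f y| <= e) _.
case.
- move=> x Kx.
  have [r /= r0 hr] : exists2 r : R, 0 < r & forall y, ball x r y -> `|f x - f y| <= e / 2.
    have /cvgrPdist_le/(_ _ e2) := cf x.
    by rewrite -nbhs_ballE => -[r r0 h]; exists r.
  have r2 : 0 < r / 2 by rewrite divr_gt0.
  exists (ball x (r / 2), [set dl | 0 < dl < r / 2]) => /=.
    split; first exact: nbhsx_ballx.
    near=> dl; apply/andP; split; near: dl; first exact: nbhs_right_gt.
    exact: nbhs_right_lt.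
  move=> [x' dl] /= [xx' /andP[d0 dr]] y x'y.
  have h1 := hr x' (le_ball (ltW _) xx').
  have h2 : ball x r y.
    rewrite (splitr r); apply: ball_triangle xx' _.
    exact: le_ball (ltW dr) _ x'y.
  have := hr y h2; have := h1 ltac:(by rewrite ltr_pdivrMr// ltr_pMr// ltr1n).
  have -> : f x' - f y = (f x - f y) - (f x - f x') by ring.
  move=> a b; apply: (le_trans (ler_normB _ _)); lra.
- move=> r /= r0 h.
  have r2 : 0 < r / 2 by rewrite divr_gt0.
  exists (r / 2) => // x y Kx; apply: (h (r / 2)) => //=.
  by rewrite sub0r normrN gtr0_norm// ltr_pdivrMr// ltr_pMr// ltr1n.
Unshelve. all: by end_near. Qed.

Lemma unif_continuous_itv {R : realType} (f : R -> R) (a b e : R) :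
  continuous f -> 0 < e ->
  exists2 dl : R, 0 < dl & forall x y, a <= x <= b -> `|x - y| < dl -> `|f x - f y| <= e.
Proof.
move=> cf e0.
have [dl d0 h] := @heine_cantor R R `[a, b] f e (@segment_compact _ _ _) cf e0.
by exists dl => // x y xab xy; apply: h; rewrite /= ?in_itv.
Qed.

(** * Bernstein approximation in two variables *)

Section bernstein.
Context {R : realType}.
Implicit Types (g : nat -> R) (u : R).

(* The Bernstein operator g |-> \sum_j 'C(m, j) u^j (1 - u)^(m - j) g(j),
   written as the expectation of g at time m of the random walk that steps
   with probability u. *)
Fixpoint bern (m : nat) g u : R :=
  if m is m'.+1 then u * bern m' (g \o S) u + (1 - u) * bern m' g u else g 0%N.

Lemma bern_cst m c u : bern m (fun=> c) u = c.
Proof.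
by elim: m => //= m IH; rewrite -[X in u * X]/(bern m (fun=> c) u) IH; ring.
Qed.

Lemma bernD m g1 g2 u :
  bern m (fun j => g1 j + g2 j) u = bern m g1 u + bern m g2 u.
Proof.
elim: m g1 g2 => //= m IH g1 g2.
rewrite -[bern m ((fun j => g1 j + g2 j) \o S) u]/(bern m (fun j => (g1 \o S) j + (g2 \o S) j) u).
by rewrite !IH; ring.
Qed.

Lemma bernZ m c g u : bern m (fun j => c * g j) u = c * bern m g u.
Proof.
elim: m g => //= m IH g.
rewrite -[bern m ((fun j => c * g j) \o S) u]/(bern m (fun j => c * (g \o S) j) u).
by rewrite !IH; ring.
Qed.

Lemma bern_le m g1 g2 u : 0 <= u <= 1 -> (forall j, g1 j <= g2 j) ->
  bern m g1 u <= bern m g2 u.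
Proof.
move=> /andP[u0 u1]; elim: m g1 g2 => //= m IH g1 g2 h.
by apply: lerD; apply: ler_wpM2l; rewrite ?subr_ge0//; apply: IH => j; exact: h.
Qed.

Lemma bern_dist m g c u : 0 <= u <= 1 ->
  `|bern m g u - c| <= bern m (fun j => `|g j - c|) u.
Proof.
move=> u01.
have e : bern m g u - c = bern m (fun j => g j - c) u by rewrite bernD bern_cst.
rewrite e ler_norml; apply/andP; split.
  rewrite -mulN1r -bernZ; apply: bern_le => // j.
  by rewrite mulN1r; have := ler_norm (- (g j - c)); rewrite normrN; lra.
by apply: bern_le => // j; exact: ler_norm.
Qed.

Lemma bern_lin m u : bern m (fun j => j%:R) u = m%:R * u.
Proof.
elim: m => [|m IH] /=; first by rewrite mul0r.
rewrite (_ : _ \o S = fun j => j%:R + 1); last by apply/funext => j /=; rewrite -natr1.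
by rewrite bernD bern_cst IH -natr1; ring.
Qed.

Lemma bern_sqr m u : bern m (fun j => j%:R ^+ 2) u = m%:R * u * (1 - u) + (m%:R * u) ^+ 2.
Proof.
elim: m => [|m IH] /=; first by rewrite !mul0r expr0n addr0.
rewrite (_ : _ \o S = fun j => j%:R ^+ 2 + (2 * j%:R + 1)); last first.
  by apply/funext => j /=; rewrite -natr1; ring.
by rewrite !bernD bernZ bern_cst bern_lin IH -natr1; ring.
Qed.

Lemma bern_var m u : (0 < m)%N -> 0 <= u <= 1 ->
  bern m (fun j => (j%:R / m%:R - u) ^+ 2) u <= m%:R^-1.
Proof.
move=> m0 /andP[u0 u1]; have mn : m%:R != 0 :> R by rewrite pnatr_eq0 -lt0n.
rewrite (_ : (fun j => _) = fun j => m%:R^-1 ^+ 2 * j%:R ^+ 2 +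
   (- (2 * u / m%:R) * j%:R + u ^+ 2)); last first.
  by apply/funext => j; field.
rewrite !bernD !bernZ bern_cst bern_lin bern_sqr.
rewrite (_ : _ + _ = m%:R^-1 * (u * (1 - u))); last by field.
rewrite ler_piMr ?invr_ge0//.
by move: u0 u1; nra.
Qed.

(** Chebyshev's argument: at distance at least [dl] the trivial bound [2 M] is below [c] times the
    squared distance, with [c = 2 M / dl^2]; each of the two averages then contributes a variance of
    at most [1 / m]. *)
Lemma bern2_approx (h : R -> R -> R) (M e dl : R) m (u v : R) :
  (0 < m)%N -> 0 <= u <= 1 -> 0 <= v <= 1 -> 0 <= e -> 0 < dl ->
  (forall x y, `|h x y| <= M) ->
  (forall x y, `|u - x| < dl -> `|v - y| < dl -> `|h u v - h x y| <= e) ->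
  `|bern m (fun j => bern m (fun k => h (j%:R / m%:R) (k%:R / m%:R)) v) u - h u v|
    <= e + 4 * M / dl ^+ 2 / m%:R.
Proof.
move=> m0 u01 v01 e0 d0 hM hu.
have M0 : 0 <= M by exact: le_trans (normr_ge0 _) (hM 0 0).
pose c := 2 * M / dl ^+ 2.
have c0 : 0 <= c by rewrite divr_ge0 ?mulr_ge0 ?exprn_ge0 ?(ltW d0).
have key j k : `|h (j%:R / m%:R) (k%:R / m%:R) - h u v| <=
    e + (c * (j%:R / m%:R - u) ^+ 2 + c * (k%:R / m%:R - v) ^+ 2).
  set x := j%:R / m%:R; set y := k%:R / m%:R.
  have big z : dl <= `|z| -> 2 * M <= c * z ^+ 2.
    move=> dz; rewrite /c mulrAC ler_pdivlMr ?exprn_gt0//.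
    rewrite ler_wpM2l ?mulr_ge0// -(real_normK (num_real z)).
    by rewrite lerXn2r ?nnegrE ?(ltW d0).
  have h2M : `|h x y - h u v| <= 2 * M.
    by rewrite (le_trans (ler_normB _ _))// mulr_natl mulr2n lerD.
  have s1 := mulr_ge0 c0 (sqr_ge0 (x - u)).
  have s2 := mulr_ge0 c0 (sqr_ge0 (y - v)).
  have [hx|hx] := ltP `|u - x| dl; last first.
    have := big (x - u); rewrite distrC => /(_ hx); lra.
  have [hy|hy] := ltP `|v - y| dl; last first.
    have := big (y - v); rewrite distrC => /(_ hy); lra.
  have := hu x y hx hy; rewrite distrC; lra.
apply: (le_trans (bern_dist _ _ _ u01)).
apply: (@le_trans _ _ (bern m (fun j => e + c / m%:R + c * (j%:R / m%:R - u) ^+ 2) u)).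
  apply: bern_le => // j; apply: (le_trans (bern_dist _ _ _ v01)).
  apply: (le_trans (bern_le m v01 (key j))).
  rewrite !bernD !bern_cst bernZ.
  have := ler_wpM2l c0 (bern_var m0 v01); lra.
rewrite bernD bern_cst bernZ.
have := ler_wpM2l c0 (bern_var m0 u01).
rewrite (_ : 4 * M / dl ^+ 2 / m%:R = c / m%:R + c / m%:R); first lra.
by rewrite /c -mulrDl; congr (_ / _); rewrite -mulrDl; congr (_ / _); ring.
Qed.

End bernstein.

(** * From mixed moments to bounded functions on the unit square *)

Section weak_convergence.
Context {R : realType}
  {d : measure_display} {T : measurableType d} (P : probability T R)
  {d' : measure_display} {T' : measurableType d'} (P' : probability T' R).
Variables (U V : nat -> T -> R) (U' V' : T' -> R).
Hypothesis mU : forall n, measurable_fun setT (U n).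
Hypothesis mV : forall n, measurable_fun setT (V n).
Hypothesis mU' : measurable_fun setT U'.
Hypothesis mV' : measurable_fun setT V'.
Hypothesis U01 : forall n w, 0 <= U n w <= 1.
Hypothesis V01 : forall n w, 0 <= V n w <= 1.
Hypothesis U'01 : forall w, 0 <= U' w <= 1.
Hypothesis V'01 : forall w, 0 <= V' w <= 1.
Hypothesis mom : forall a b : nat,
  Ex P (fun w => U n w ^+ a * V n w ^+ b) @[n --> \oo] -->
  Ex P' (fun w => U' w ^+ a * V' w ^+ b).

Let bmf01 {d0} {T0 : measurableType d0} (X : T0 -> R) :
  measurable_fun setT X -> (forall w, 0 <= X w <= 1) -> bmf X.
Proof.
move=> mX X01; split => //; exists 1 => w.
by have /andP[a b] := X01 w; rewrite ger0_norm.
Qed.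

Let bU n := bmf01 (mU n) (U01 n).
Let bV n := bmf01 (mV n) (V01 n).
Let bU' := bmf01 mU' U'01.
Let bV' := bmf01 mV' V'01.

(** Convergence is required against every monomial, not only for [Psi], so that the class is stable
    under multiplication by a monomial and the recursion defining [bern] stays inside it. *)
Let test (Psi : R -> R -> R) : Prop :=
  [/\ forall n, bmf (fun w => Psi (U n w) (V n w)),
      bmf (fun w => Psi (U' w) (V' w)) &
      forall a b : nat,
  Ex P (fun w => U n w ^+ a * V n w ^+ b * Psi (U n w) (V n w)) @[n --> \oo] -->
  Ex P' (fun w => U' w ^+ a * V' w ^+ b * Psi (U' w) (V' w))].

Let test_cst c : test (fun _ _ => c).
Proof.
split; [by move=> n; exact: bmf_cst|exact: bmf_cst|move=> a b].
have e n : Ex P (fun w => U n w ^+ a * V n w ^+ b * c) =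
    c * Ex P (fun w => U n w ^+ a * V n w ^+ b).
  rewrite -(ExZ P c (bmfM (bmfX a (bU n)) (bmfX b (bV n)))).
  by congr Ex; apply/funext => w; rewrite mulrC.
have -> : Ex P' (fun w => U' w ^+ a * V' w ^+ b * c) =
    c * Ex P' (fun w => U' w ^+ a * V' w ^+ b).
  rewrite -(ExZ P' c (bmfM (bmfX a bU') (bmfX b bV'))).
  by congr Ex; apply/funext => w; rewrite mulrC.
have c1 : c * Ex P (fun w => U n w ^+ a * V n w ^+ b) @[n --> \oo] -->
    c * Ex P' (fun w => U' w ^+ a * V' w ^+ b).
  by apply: cvgM; [exact: cvg_cst|exact: mom].
by apply: cvg_trans c1; apply: near_eq_cvg; apply: nearW => n; rewrite e.
Qed.

Let test_step (x : R -> R -> R) (i j : nat) f g :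
  (forall u v, x u v = u ^+ i * v ^+ j) -> test f -> test g ->
  test (fun u v => x u v * f u v + (1 - x u v) * g u v).
Proof.
move=> xE [f1 f2 f3] [g1 g2 g3].
have bx n : bmf (fun w => x (U n w) (V n w)).
  under eq_fun do rewrite xE.
  exact: bmfM (bmfX i (bU n)) (bmfX j (bV n)).
have bx' : bmf (fun w => x (U' w) (V' w)).
  under eq_fun do rewrite xE.
  exact: bmfM (bmfX i bU') (bmfX j bV').
split.
- by move=> n; apply: bmfD; apply: bmfM => //; apply: bmfB => //; exact: bmf_cst.
- by apply: bmfD; apply: bmfM => //; apply: bmfB => //; exact: bmf_cst.
move=> a b.
(* The monomial [x] is absorbed into the exponents, leaving three expectations of the kind covered
   by the hypotheses on [f] and [g]. *)
have eq : forall d0 (T0 : measurableType d0) (Q : probability T0 R) (X Y : T0 -> R),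
    bmf X -> bmf Y -> bmf (fun w => f (X w) (Y w)) -> bmf (fun w => g (X w) (Y w)) ->
    Ex Q (fun w => X w ^+ a * Y w ^+ b *
       (x (X w) (Y w) * f (X w) (Y w) + (1 - x (X w) (Y w)) * g (X w) (Y w))) =
    Ex Q (fun w => X w ^+ (a + i) * Y w ^+ (b + j) * f (X w) (Y w)) +
    Ex Q (fun w => X w ^+ a * Y w ^+ b * g (X w) (Y w)) -
    Ex Q (fun w => X w ^+ (a + i) * Y w ^+ (b + j) * g (X w) (Y w)).
  move=> d0 T0 Q X Y bX bY bf bg.
  have b1 := bmfM (bmfM (bmfX (a + i) bX) (bmfX (b + j) bY)) bf.
  have b2 := bmfM (bmfM (bmfX a bX) (bmfX b bY)) bg.
  have b3 := bmfM (bmfM (bmfX (a + i) bX) (bmfX (b + j) bY)) bg.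
  rewrite -(ExD Q b1 b2) -(ExB Q (bmfD b1 b2) b3); congr Ex; apply/funext => w.
  by rewrite xE !exprD; ring.
rewrite (eq _ _ P' U' V')//.
have c : Ex P (fun w => U n w ^+ (a + i) * V n w ^+ (b + j) * f (U n w) (V n w)) +
    Ex P (fun w => U n w ^+ a * V n w ^+ b * g (U n w) (V n w)) -
    Ex P (fun w => U n w ^+ (a + i) * V n w ^+ (b + j) * g (U n w) (V n w)) @[n --> \oo] -->
    Ex P' (fun w => U' w ^+ (a + i) * V' w ^+ (b + j) * f (U' w) (V' w)) +
    Ex P' (fun w => U' w ^+ a * V' w ^+ b * g (U' w) (V' w)) -
    Ex P' (fun w => U' w ^+ (a + i) * V' w ^+ (b + j) * g (U' w) (V' w)).
  by apply: cvgB; [apply: cvgD|].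
by apply: cvg_trans c; apply: near_eq_cvg; apply: nearW => n; rewrite (eq _ _ P (U n) (V n)).
Qed.

Let test_bernv m (g : nat -> R) : test (fun u v => bern m g v).
Proof.
elim: m g => [|m IH] g /=; first exact: test_cst.
apply: (@test_step (fun u v => v) 0 1) => // u v.
by rewrite expr0 expr1 mul1r.
Qed.

Let test_bernu m (g : nat -> R -> R) : (forall j, test (fun u v => g j v)) ->
  test (fun u v => bern m (fun j => g j v) u).
Proof.
elim: m g => [|m IH] g hg /=; first exact: hg.
apply: (@test_step (fun u v => u) 1 0) => [u v||].
- by rewrite expr0 expr1 mulr1.
- exact: (IH (fun j => g j.+1)).
- exact: IH.
Qed.

Lemma weak_cvg_cube (h : R -> R -> R) (M : R) :
  (forall x y, `|h x y| <= M) ->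
  (forall n, measurable_fun setT (fun w => h (U n w) (V n w))) ->
  measurable_fun setT (fun w => h (U' w) (V' w)) ->
  (forall e, 0 < e -> exists2 dl, 0 < dl & forall u v x y, 0 <= u <= 1 -> 0 <= v <= 1 ->
     `|u - x| < dl -> `|v - y| < dl -> `|h u v - h x y| <= e) ->
  Ex P (fun w => h (U n w) (V n w)) @[n --> \oo] --> Ex P' (fun w => h (U' w) (V' w)).
Proof.
move=> hM mh mh' uc; apply/cvgrPdist_le => e e0.
have M0 : 0 <= M by exact: le_trans (normr_ge0 _) (hM 0 0).
have e8 : 0 < e / 8 by rewrite divr_gt0.
have [dl d0 hd] := uc _ e8.
pose c := 4 * M / dl ^+ 2.
have [m m0 hm] : exists2 m, (0 < m)%N & c / m%:R <= e / 8.
  have c0 : 0 <= c by rewrite divr_ge0 ?mulr_ge0 ?exprn_ge0 ?(ltW d0).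
  exists (Num.bound (c / (e / 8))).+1 => //.
  rewrite ler_pdivrMr// mulrC -ler_pdivrMr//.
  apply: (le_trans (ltW (archi_boundP _))); first by rewrite divr_ge0// ltW.
  by rewrite ler_nat.
pose B u v := bern m (fun j => bern m (fun k => h (j%:R / m%:R) (k%:R / m%:R)) v) u.
have [B1 B2 B3] : test B by apply: test_bernu => j; exact: test_bernv.
have near u v : 0 <= u <= 1 -> 0 <= v <= 1 -> `|B u v - h u v| <= e / 4.
  move=> u01 v01.
  have h1 x y : `|u - x| < dl -> `|v - y| < dl -> `|h u v - h x y| <= e / 8.
    exact: hd.
  have := @bern2_approx _ h M (e / 8) dl m u v m0 u01 v01 (ltW e8) d0 hM h1.
  move=> h2; apply: (le_trans h2); rewrite -/c; move: hm.
  by move: (c / m%:R) => z; lra.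
have bh n : bmf (fun w => h (U n w) (V n w)) by split => //; exists M.
have bh' : bmf (fun w => h (U' w) (V' w)) by split => //; exists M.
have eB n : `|Ex P (fun w => B (U n w) (V n w)) - Ex P (fun w => h (U n w) (V n w))| <= e / 4.
  apply: (le_trans (Ex_dist P (B1 n) (bh n))).
  rewrite -[leRHS](Ex_cst P); apply: Ex_le; [|exact: bmf_cst|].
  - exact: bmf_norm (bmfB (B1 n) (bh n)).
  - by move=> w; exact: near.
have eB' : `|Ex P' (fun w => B (U' w) (V' w)) - Ex P' (fun w => h (U' w) (V' w))| <= e / 4.
  apply: (le_trans (Ex_dist P' B2 bh')).
  rewrite -[leRHS](Ex_cst P'); apply: Ex_le; [|exact: bmf_cst|].
  - exact: bmf_norm (bmfB B2 bh').
  - by move=> w; exact: near.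
have e4 : 0 < e / 4 by rewrite divr_gt0.
have := B3 0%N 0%N; move=> /cvgrPdist_le/(_ _ e4); apply: filterS => n.
rewrite (_ : (fun w => _) = (fun w => B (U' w) (V' w))); last first.
  by apply/funext => w; rewrite !expr0 !mul1r.
rewrite [X in Ex P X](_ : _ = (fun w => B (U n w) (V n w))); last first.
  by apply/funext => w; rewrite !expr0 !mul1r.
have := eB n; move: eB'.
set x1 := Ex P' _; set x2 := Ex P' _; set x3 := Ex P _; set x4 := Ex P _.
rewrite !ler_norml; lra.
Qed.

End weak_convergence.

(** * Convergence of the ratio away from its singularity *)

Lemma measurable_inv_ge0 {d} {T : measurableType d} {R : realType} (X : T -> R) :
  measurable_fun setT X -> (forall w, 0 <= X w) ->
  measurable_fun setT (fun w => (X w)^-1).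
Proof.
move=> mX X0; rewrite (_ : (fun w => _) = (fun w => X w `^ (-1))).
  exact: (measurableT_comp (@measurable_powR R (-1))).
by apply/funext => w; rewrite powR_inv1.
Qed.

(** If [a] or [b] exceeds [K >= 1 / s], then [exp (- (s a + s b)) <= 1/2] and the first summand is
    at least 1; if [b < dl], the second is [exp (1 - b / dl) >= 1]. *)
Lemma one_le_tail_bound {R : realType} (s dl K a b : R) : 0 < s -> 0 < dl ->
  s^-1 <= K -> 0 <= a -> 0 <= b -> ~~ [&& a <= K, dl <= b & b <= K] ->
  1 <= 2 * (1 - expR (- (s * a + s * b))) + expR 1 * expR (- (0 * a + dl^-1 * b)).
Proof.
move=> s0 d0 sK a0 b0 bad.
have e1 : expR (- (s * a + s * b)) <= 1.
  by rewrite expR_le1 oppr_le0 addr_ge0// mulr_ge0// ltW.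
have e2 : 0 <= expR 1 * expR (- (0 * a + dl^-1 * b)) by rewrite mulr_ge0 ?expR_ge0.
have big x : s^-1 <= x -> x <= a + b ->
    1 <= 2 * (1 - expR (- (s * a + s * b))) + expR 1 * expR (- (0 * a + dl^-1 * b)).
  move=> sx xab.
  have h1 : 1 <= s * a + s * b.
    rewrite -mulrDr -(mulfV (lt0r_neq0 s0)) ler_wpM2l ?(ltW s0)//.
    exact: le_trans sx xab.
  have h2 : expR (- (s * a + s * b)) <= 2^-1.
    rewrite expRN lef_pV2 ?posrE ?expR_gt0//.
    by have := expR_ge1Dx (s * a + s * b); lra.
  lra.
move: bad; rewrite !negb_and -!ltNge => /or3P[h|h|h].
- by apply: (big a); [exact: le_trans sK (ltW h)|rewrite lerDl].
- suff : 1 <= expR 1 * expR (- (0 * a + dl^-1 * b)) by lra.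
  rewrite -expRD -[leLHS]expR0 ler_expR mul0r add0r subr_ge0.
  by rewrite mulrC ler_pdivrMr// mul1r ltW.
- by apply: (big b); [exact: le_trans sK (ltW h)|rewrite lerDr].
Qed.

Section ratio_convergence.
Context {R : realType}
  {d : measure_display} {T : measurableType d} (P : probability T R)
  {d' : measure_display} {T' : measurableType d'} (P' : probability T' R).
Variables (A B : nat -> T -> R) (A' B' : T' -> R) (lap : R -> R -> R).
Hypothesis mA : forall n, measurable_fun setT (A n).
Hypothesis mB : forall n, measurable_fun setT (B n).
Hypothesis mA' : measurable_fun setT A'.
Hypothesis mB' : measurable_fun setT B'.
Hypothesis A0 : forall n w, 0 <= A n w.
Hypothesis B0 : forall n w, 0 <= B n w.
Hypothesis A'0 : forall w, 0 <= A' w.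
Hypothesis B'0 : forall w, 0 <= B' w.
Hypothesis lapn : forall s t, 0 <= s -> 0 <= t -> 0 < s + t ->
  Ex P (fun w => expR (- (s * A n w + t * B n w))) @[n --> \oo] --> expR (- lap s t).
Hypothesis lap' : forall s t, 0 <= s -> 0 <= t -> 0 < s + t ->
  Ex P' (fun w => expR (- (s * A' w + t * B' w))) = expR (- lap s t).
Hypothesis lap_small : forall e, 0 < e -> exists2 s, 0 < s & lap s s <= e.
Hypothesis lap_large : forall M, exists2 t, 0 < t & M <= lap 0 t.

Let bexp {dd} {T0 : measurableType dd} (X Y : T0 -> R) s t :
  measurable_fun setT X -> measurable_fun setT Y ->
  (forall w, 0 <= X w) -> (forall w, 0 <= Y w) -> 0 <= s -> 0 <= t ->
  bmf (fun w => expR (- (s * X w + t * Y w))).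
Proof.
move=> mX mY X0 Y0 s0 t0; split.
  apply: (@measurableT_comp _ _ _ _ _ _ expR); first exact: measurable_expR.
  by apply: measurable_funN; apply: measurable_funD; apply: measurable_funM.
exists 1 => w; rewrite ger0_norm ?expR_ge0// expR_le1 oppr_le0.
by rewrite addr_ge0// mulr_ge0.
Qed.

(* Dominates the indicator of [(a, b)] lying outside [[0, K] x [dl, K]], while its
   mean is a combination of Laplace transforms; see [one_le_tail_bound]. *)
Definition tail_bound (s dl a b : R) : R :=
  2 * (1 - expR (- (s * a + s * b))) + expR 1 * expR (- (0 * a + dl^-1 * b)).

Lemma bmf_tail_bound {dd} {T0 : measurableType dd} (X Y : T0 -> R) s dl :
  measurable_fun setT X -> measurable_fun setT Y ->
  (forall w, 0 <= X w) -> (forall w, 0 <= Y w) -> 0 < s -> 0 < dl ->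
  bmf (fun w => tail_bound s dl (X w) (Y w)).
Proof.
move=> mX mY X0 Y0 s0 d0; apply: bmfD; apply: bmfM; try exact: bmf_cst.
  by apply: bmfB; [exact: bmf_cst|apply: bexp => //; exact: ltW].
by apply: bexp => //; rewrite invr_ge0 ltW.
Qed.

Let Ex_tail_bound {dd} {T0 : measurableType dd} (Q : probability T0 R) (X Y : T0 -> R) s dl :
  measurable_fun setT X -> measurable_fun setT Y ->
  (forall w, 0 <= X w) -> (forall w, 0 <= Y w) -> 0 < s -> 0 < dl ->
  Ex Q (fun w => tail_bound s dl (X w) (Y w)) =
  2 * (1 - Ex Q (fun w => expR (- (s * X w + s * Y w)))) +
  expR 1 * Ex Q (fun w => expR (- (0 * X w + dl^-1 * Y w))).
Proof.
move=> mX mY X0 Y0 s0 d0.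
have b1 : bmf (fun w => expR (- (s * X w + s * Y w))) by apply: bexp => //; exact: ltW.
have b2 : bmf (fun w => expR (- (0 * X w + dl^-1 * Y w))).
  by apply: bexp => //; rewrite invr_ge0 ltW.
have b3 := bmfB (bmf_cst 1) b1.
rewrite /tail_bound (ExD Q (bmfM (bmf_cst 2) b3) (bmfM (bmf_cst _) b2)).
by rewrite (ExZ Q 2 b3) (ExZ Q _ b2) (ExB Q (bmf_cst 1) b1) Ex_cst.
Qed.

(** [lap_small] provides [s] against large values, [lap_large] provides [dl = 1 / t] against small
    denominators. The bounds for the sample follow from limits of transforms and hold for all large
    [n] at once. *)
Lemma tightness (e : R) : 0 < e -> exists s dl, [/\ 0 < s, 0 < dl,
  \forall n \near \oo, Ex P (fun w => tail_bound s dl (A n w) (B n w)) <= e &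
  Ex P' (fun w => tail_bound s dl (A' w) (B' w)) <= e].
Proof.
move=> e0.
have e8 : 0 < e / 8 by rewrite divr_gt0.
have [s s0 hs] := lap_small e8.
(* By [exp y >= 1 + y], an exponent of this size gives [exp 1 * exp (- lap 0 t) <= e / 4]. *)
have [t t0 ht] := lap_large (4 * expR 1 / e).
have h1 : 2 * (1 - expR (- lap s s)) <= e / 4.
  by have := expR_ge1Dx (- lap s s); lra.
have h2 : expR 1 * expR (- lap 0 t) <= e / 4.
  rewrite expRN ler_pdivrMr ?expR_gt0// -ler_pdivrMl ?divr_gt0//.
  rewrite (_ : (e / 4)^-1 * expR 1 = 4 * expR 1 / e).
    by apply: (le_trans ht); have := expR_ge1Dx (lap 0 t); lra.
  by rewrite invf_div mulrAC.
have t0' : 0 < t^-1 by rewrite invr_gt0.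
exists s; exists t^-1; split => //.
- have ss : 0 < s + s by rewrite addr_gt0.
  have tt : 0 < 0 + t by rewrite add0r.
  have c1 := lapn (ltW s0) (ltW s0) ss.
  have c2 := lapn (lexx 0) (ltW t0) tt.
  have c : 2 * (1 - Ex P (fun w => expR (- (s * A n w + s * B n w)))) +
      expR 1 * Ex P (fun w => expR (- (0 * A n w + t * B n w))) @[n --> \oo] -->
      2 * (1 - expR (- lap s s)) + expR 1 * expR (- lap 0 t).
    apply: cvgD; apply: cvgM; try exact: cvg_cst; last exact: c2.
    by apply: cvgB; [exact: cvg_cst|exact: c1].
  near=> n.
  rewrite Ex_tail_bound// invrK.
  near: n; apply: (cvgr_le _ c); rewrite /=.
  by apply: (@le_lt_trans _ _ (e / 4 + e / 4)); [exact: lerD|lra].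
- rewrite Ex_tail_bound// invrK !lap' ?(ltW s0) ?(ltW t0)//.
  + by apply: (@le_trans _ _ (e / 4 + e / 4)); [exact: lerD|lra].
  + by rewrite add0r.
  + by rewrite addr_gt0.
Unshelve. all: by end_near. Qed.

Let mexpN {dd} {T0 : measurableType dd} (X : T0 -> R) :
  measurable_fun setT X -> measurable_fun setT (fun w => expR (- X w)).
Proof.
move=> mX; apply: (@measurableT_comp _ _ _ _ _ _ expR); first exact: measurable_expR.
by apply: measurable_funN.
Qed.

Let mratio {dd} {T0 : measurableType dd} (X Y : T0 -> R) (f : R -> R) :
  continuous f -> measurable_fun setT X -> measurable_fun setT Y ->
  (forall w, 0 <= Y w) -> measurable_fun setT (fun w => f (- X w ^+ 2 / Y w)).
Proof.
move=> cf mX mY Y0; have mf : measurable_fun setT f by exact: continuous_measurable_fun.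
apply: (measurableT_comp mf); apply: measurable_funM.
  by apply: measurable_funN; exact: measurable_funX.
exact: measurable_inv_ge0.
Qed.

(** The ratio is replaced by a continuous function [h] of the two exponentials that agrees with it
    on [[0, K] x [dl, K]]; elsewhere the error is at most [2 M], hence at most [2 M] times
    [tail_bound]. *)
Lemma ratio_weak_cvg (f : R -> R) (M : R) : continuous f -> (forall x, `|f x| <= M) ->
  Ex P (fun w => f (- A n w ^+ 2 / B n w)) @[n --> \oo] -->
  Ex P' (fun w => f (- A' w ^+ 2 / B' w)).
Proof.
move=> cf fM; apply/cvgrPdist_le => e e0.
have M0 : 0 <= M by exact: le_trans (normr_ge0 _) (fM 0).
(* The [+ 1] keeps the denominator positive when [M = 0]. *)
pose e1 := e / (8 * (M + 1)).
have e10 : 0 < e1 by rewrite divr_gt0// mulr_gt0// ltr_wpDl.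
have Me1 : 2 * M * e1 <= e / 4.
  rewrite /e1 mulrA ler_pdivrMr ?mulr_gt0 ?ltr_wpDl//.
  by move: M0 e0; nra.
have [s [dl [s0 d0 tn t']]] := tightness e10.
pose K := Num.max s^-1 dl.
have sK : s^-1 <= K by rewrite le_max lexx.
have dK : dl <= K by rewrite le_max lexx orbT.
(* These invert [x |-> exp (- x)] on the good set. [g1] is capped at [K] and [g2] is clamped to
   [[dl, K]], so both are continuous on all of [R] and the division by [g2] is harmless. *)
pose g1 (u : R) := - ln (Num.max u (expR (- K))).
pose g2 (v : R) := - ln (Num.min (Num.max v (expR (- K))) (expR (- dl))).
have mx0 u : 0 < Num.max u (expR (- K)) by rewrite lt_max expR_gt0 orbT.
have mn0 v : 0 < Num.min (Num.max v (expR (- K))) (expR (- dl)).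
  by rewrite lt_min mx0 expR_gt0.
have g2d v : dl <= g2 v.
  rewrite /g2 lerNr -[leRHS]expRK ler_ln ?posrE ?expR_gt0//.
  by rewrite ge_min lexx orbT.
have g20 v : 0 < g2 v by exact: lt_le_trans (g2d v).
have cmx (u : R) : {for u, continuous (fun u : R => Num.max u (expR (- K)))}.
  by apply: (@continuous_max R R id (fun=> expR (- K))); [exact: cvg_id|exact: cvg_cst].
have cg1 : continuous g1.
  move=> u; have c : {for u, continuous (@ln R \o (fun u : R => Num.max u (expR (- K))))}.
    by apply: continuous_comp; [exact: cmx|exact: continuous_ln].
  exact: cvgN c.
have cg2 : continuous g2.
  move=> v; have c : {for v, continuous (fun v : R => Num.min (Num.max v (expR (- K))) (expR (- dl)))}.
    apply: (@continuous_min R R (fun v : R => Num.max v (expR (- K))) (fun=> expR (- dl))).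
      exact: cmx.
    exact: cvg_cst.
  have c2 : {for v, continuous (@ln R \o
      (fun v : R => Num.min (Num.max v (expR (- K))) (expR (- dl))))}.
    by apply: continuous_comp; [exact: c|exact: continuous_ln].
  exact: cvgN c2.
pose h u v := f (- g1 u ^+ 2 / g2 v).
have heq a b : [&& a <= K, dl <= b & b <= K] ->
    h (expR (- a)) (expR (- b)) = f (- a ^+ 2 / b).
  move=> /and3P[aK db bK]; rewrite /h /g1 /g2.
  rewrite max_l ?ler_expR ?lerN2// expRK opprK.
  by rewrite max_l ?ler_expR ?lerN2// min_l ?ler_expR ?lerN2// expRK opprK.
have hbd a b : 0 <= a -> 0 <= b -> `|h (expR (- a)) (expR (- b)) - f (- a ^+ 2 / b)| <=
    2 * M * tail_bound s dl a b.
  move=> a0 b0; have [good|bad] := boolP [&& a <= K, dl <= b & b <= K].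
    rewrite heq// subrr normr0 mulr_ge0 ?mulr_ge0//.
    rewrite addr_ge0 ?mulr_ge0 ?expR_ge0// subr_ge0 expR_le1 oppr_le0.
    by rewrite addr_ge0// mulr_ge0// ltW.
  have := one_le_tail_bound s0 d0 sK a0 b0 bad; rewrite -/(tail_bound s dl a b) => h1.
  apply: (@le_trans _ _ (2 * M)); last by rewrite ler_peMr// mulr_ge0.
  apply: (le_trans (ler_normB _ _)); rewrite mulr_natl mulr2n.
  by apply: lerD; exact: fM.
have mh : forall dd (T0 : measurableType dd) (X Y : T0 -> R),
    measurable_fun setT X -> measurable_fun setT Y ->
    measurable_fun setT (fun w => h (expR (- X w)) (expR (- Y w))).
  move=> dd T0 X Y mX mY.
  apply: (@mratio _ _ (fun w => g1 (expR (- X w))) (fun w => g2 (expR (- Y w)))) => //.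
  - apply: (measurableT_comp (continuous_measurable_fun cg1)); exact: mexpN.
  - apply: (measurableT_comp (continuous_measurable_fun cg2)); exact: mexpN.
  - by move=> w; exact: ltW.
have e01 (x : R) : 0 <= x -> 0 <= expR (- x) <= 1 by move=> x0; rewrite expR_ge0 expR_le1 oppr_le0.
have moments a b : Ex P (fun w => expR (- A n w) ^+ a * expR (- B n w) ^+ b) @[n --> \oo] -->
    Ex P' (fun w => expR (- A' w) ^+ a * expR (- B' w) ^+ b).
  have pe x y : expR (- x) ^+ a * expR (- y) ^+ b = expR (- (a%:R * x + b%:R * y)).
    by rewrite -!expRM_natl -expRD; congr expR; ring.
  under [X in _ --> Ex _ X]eq_fun do rewrite pe.
  have c : Ex P (fun w => expR (- (a%:R * A n w + b%:R * B n w))) @[n --> \oo] -->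
      Ex P' (fun w => expR (- (a%:R * A' w + b%:R * B' w))).
    (* The transforms are given for [0 < s + t] only; the moment of order zero is the constant 1. *)
    have [ab|ab] := eqVneq (a + b)%N 0%N.
      move/eqP: ab; rewrite addn_eq0 => /andP[/eqP -> /eqP ->].
      have e0' x y : expR (- (0%:R * x + 0%:R * y)) = 1 by rewrite !mul0r addr0 oppr0 expR0.
      under [X in _ --> Ex _ X]eq_fun do rewrite e0'.
      rewrite Ex_cst; apply: cvg_near_cst; apply: nearW => n.
      by under eq_fun do rewrite e0'; rewrite Ex_cst.
    have ab0 : 0 < a%:R + b%:R :> R by rewrite -natrD ltr0n lt0n.
    by rewrite lap'//; exact: lapn.
  apply: cvg_trans c; apply: near_eq_cvg; apply: nearW => n.
  by congr Ex; apply/funext => w; rewrite pe.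
have hM x y : `|h x y| <= M by exact: fM.
have uc e' : 0 < e' -> exists2 r, 0 < r & forall u v x y, 0 <= u <= 1 -> 0 <= v <= 1 ->
     `|u - x| < r -> `|v - y| < r -> `|h u v - h x y| <= e'.
  move=> e'0.
  have ch : continuous (fun z : R * R => h z.1 z.2).
    move=> z; apply: (@continuous_comp _ _ _ (fun z : R * R => - g1 z.1 ^+ 2 / g2 z.2) f); last exact: cf.
    apply: cvgM; last first.
      apply: cvgV; first by rewrite gt_eqF.
      by apply: (@continuous_comp _ _ _ (fun z : R * R => z.2) g2); [exact: cvg_snd|exact: cg2].
    apply: cvgN; apply: (@continuous_comp _ _ _ (fun z : R * R => g1 z.1) (fun x => x ^+ 2)); last exact: exprn_continuous.
    by apply: (@continuous_comp _ _ _ (fun z : R * R => z.1) g1); [exact: cvg_fst|exact: cg1].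
  have cK : compact (`[0 : R, 1] `*` `[0 : R, 1]) by apply: compact_setX; exact: segment_compact.
  have [r r0 hr] := @heine_cantor R _ _ _ e' cK ch e'0.
  exists r => // u v x y u01 v01 ux vy.
  by apply: (hr (u, v) (x, y)); split => //=; rewrite in_itv.
have := @weak_cvg_cube R _ _ P _ _ P' (fun n w => expR (- A n w)) (fun n w => expR (- B n w))
  (fun w => expR (- A' w)) (fun w => expR (- B' w)) (fun n => mexpN (mA n)) (fun n => mexpN (mB n))
  (mexpN mA') (mexpN mB') (fun n w => e01 _ (A0 n w)) (fun n w => e01 _ (B0 n w))
  (fun w => e01 _ (A'0 w)) (fun w => e01 _ (B'0 w)) moments h M hM
  (fun n => mh _ _ _ _ (mA n) (mB n)) (mh _ _ _ _ mA' mB') uc.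
have e4 : 0 < e / 4 by rewrite divr_gt0.
have diff : forall dd (T0 : measurableType dd) (Q : probability T0 R) (X Y : T0 -> R),
    measurable_fun setT X -> measurable_fun setT Y ->
    (forall w, 0 <= X w) -> (forall w, 0 <= Y w) ->
    Ex Q (fun w => tail_bound s dl (X w) (Y w)) <= e1 ->
    `|Ex Q (fun w => h (expR (- X w)) (expR (- Y w))) - Ex Q (fun w => f (- X w ^+ 2 / Y w))| <= e / 4.
  move=> dd T0 Q X Y mX mY X0 Y0 ht.
  have b1 : bmf (fun w => h (expR (- X w)) (expR (- Y w))).
    by split; [exact: mh|exists M].
  have b2 : bmf (fun w => f (- X w ^+ 2 / Y w)) by split; [exact: mratio|exists M].
  have b3 := bmf_tail_bound mX mY X0 Y0 s0 d0.
  apply: (le_trans (Ex_dist Q b1 b2)).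
  apply: (@le_trans _ _ (Ex Q (fun w => 2 * M * tail_bound s dl (X w) (Y w)))).
    apply: Ex_le; [exact: bmf_norm (bmfB b1 b2)|exact: bmfM (bmf_cst _) b3|].
    by move=> w; exact: hbd.
  rewrite (ExZ Q _ b3); apply: le_trans Me1.
  by rewrite ler_wpM2l// mulr_ge0.
have dlim := diff _ _ P' A' B' mA' mB' A'0 B'0 t'.
move=> /cvgrPdist_le/(_ _ e4) c.
apply: filterS2 tn c => n tn c.
have dn := diff _ _ P (A n) (B n) (mA n) (mB n) (A0 n) (B0 n) tn.
move: c dlim dn; set x1 := Ex P' _; set x2 := Ex P _; set x3 := Ex P' _; set x4 := Ex P _.
rewrite !ler_norml; lra.
Qed.

End ratio_convergence.

(** * Uniform pairings *)

Section pairing_count.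
Variable l : nat.
Implicit Types (s t : {perm 'I_l}) (h k : 'I_l).

(** The condition of [cm_is_pairing] for an arbitrary number [l] of half-edges: the symmetry
    arguments do not involve the degrees. *)
Definition pairing s : bool := [forall h, (s h != h) && (s (s h) == h)].

Lemma conjpE s t h : (s ^ t)%g h = t (s ((t^-1)%g h)).
Proof. by rewrite conjgE !permM. Qed.

Lemma pairing_conj s t : pairing (s ^ t)%g = pairing s.
Proof.
apply/forallP/forallP => H h.
  have := H (t h); rewrite !conjpE !permK => /andP[h1 h2].
  rewrite -(inj_eq (@perm_inj _ t)) h1/=.
  by move: h2; rewrite (inj_eq (@perm_inj _ t)).
rewrite !conjpE permK; have /andP[h1 h2] := H ((t^-1)%g h).
rewrite (eqP h2) permKV eqxx andbT; apply: contra h1 => /eqP e.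
by apply/eqP; apply: (@perm_inj _ t); rewrite permKV.
Qed.

Lemma pairing_neq s h : pairing s -> s h != h.
Proof. by move=> /forallP/(_ h)/andP[]. Qed.

Definition npair : nat := \sum_(s | pairing s) 1.
Definition cnt1 h k : nat := \sum_(s | pairing s) (s h == k).
Definition cnt2 h1 k1 h2 k2 : nat :=
  \sum_(s | pairing s) ((s h1 == k1) && (s h2 == k2)).

(* Conjugation by the transposition of [k] and [k'] permutes the pairings. *)
Lemma cnt1_eq h k k' : k != h -> k' != h -> cnt1 h k = cnt1 h k'.
Proof.
move=> kh k'h; rewrite /cnt1 (reindex_inj (conjg_inj (tperm k k')))/=.
apply: eq_big => s; first by rewrite pairing_conj.
move=> _; rewrite conjpE tpermV (tpermD kh k'h).
by rewrite -{2}(tpermR k k') (inj_eq (@perm_inj _ _)).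
Qed.

Lemma cnt1_total h : \sum_k cnt1 h k = npair.
Proof.
rewrite exchange_big/=; apply: eq_bigr => s _.
rewrite (bigD1 (s h))//= eqxx big1 ?addn0// => k.
by rewrite eq_sym => /negbTE ->.
Qed.

(** By symmetry the partner of [h] is uniform over the other [l - 1] half-edges. The inequality,
    instead of an equality, includes [k = h], where the count is 0. *)
Lemma cnt1_ub h k : (l.-1 * cnt1 h k <= npair)%N.
Proof.
have [->|kh] := eqVneq k h.
  rewrite /cnt1 big1 ?muln0// => s /pairing_neq sh.
  by rewrite (negbTE (sh h)).
rewrite -(cnt1_total h) (bigD1 h)//= (eq_bigr (fun=> cnt1 h k)); last first.
  by move=> k' k'h; exact: cnt1_eq.
rewrite sum_nat_const (_ : #|_| = l.-1) ?leq_addl//.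
by rewrite cardC1 card_ord.
Qed.

Lemma cnt2_eq h1 k1 h2 k2 k2' :
  k2 \notin [:: h1; k1; h2] -> k2' \notin [:: h1; k1; h2] ->
  cnt2 h1 k1 h2 k2 = cnt2 h1 k1 h2 k2'.
Proof.
rewrite !inE !negb_or => /and3P[a1 a2 a3] /and3P[b1 b2 b3].
rewrite /cnt2 (reindex_inj (conjg_inj (tperm k2 k2')))/=.
apply: eq_big => s; first by rewrite pairing_conj.
move=> _; rewrite !conjpE tpermV (tpermD a1 b1) (tpermD a3 b3).
congr (nat_of_bool (_ && _)).
  by rewrite -[X in _ == X](tpermD a2 b2) (inj_eq (@perm_inj _ _)).
by rewrite -[X in _ == X](tpermR k2 k2') (inj_eq (@perm_inj _ _)).
Qed.

(** Once [h1] is paired with [k1], the partner of [h2] is uniform over the [l - 3] half-edges that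
    remain. *)
Lemma cnt2_ub h1 k1 h2 k2 : uniq [:: h1; k1; h2; k2] ->
  ((l - 3) * cnt2 h1 k1 h2 k2 <= cnt1 h1 k1)%N.
Proof.
rewrite /= !inE !negb_or !andbT => /and3P[/and3P[a1 a2 a3] /andP[b1 b2] c].
have k2n : k2 \notin [:: h1; k1; h2].
  by rewrite !inE !negb_or ![k2 == _]eq_sym a3 b2 c.
have u3 : uniq [:: h1; k1; h2] by rewrite /= !inE !negb_or a1 a2 b1.
have -> : ((l - 3) * cnt2 h1 k1 h2 k2 =
    \sum_(k | k \notin [:: h1; k1; h2]) cnt2 h1 k1 h2 k)%N.
  rewrite (eq_bigr (fun=> cnt2 h1 k1 h2 k2)); last first.
    by move=> k kn; exact: cnt2_eq.
  rewrite sum_nat_const; congr (_ * _)%N.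
  have := cardC (mem [:: h1; k1; h2]); rewrite card_ord (card_uniqP u3) /= => e.
  rewrite -[RHS](addKn 3); congr (_ - _)%N; rewrite -[LHS]e; congr (_ + _)%N.
rewrite /cnt2 exchange_big/=; apply: leq_sum => s _.
rewrite (bigID (fun k => k == s h2))/= [X in (_ + X)%N]big1 ?addn0.
  case: (s h1 == k1) => /=; last by rewrite big1.
  apply: (@leq_trans (\sum_(k | k == s h2) 1)%N).
    rewrite big_mkcondl; apply: leq_sum => k _; case: ifP => // _.
    by case: (_ == _).
  by rewrite big_pred1_eq.
move=> k /andP[_ ks]; rewrite [s h2 == k]eq_sym (negbTE ks) andbF//.
Qed.

End pairing_count.

(** The witness exchanges [2 m] and [2 m + 1]; evenness of [l] keeps the last partner in range. *)
Lemma pairing_exists l : ~~ odd l -> (0 < npair l)%N.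
Proof.
move=> el.
have hP (h : 'I_l) : ((if odd h then h.-1 else h.+1) < l)%N.
  case: ifPn => oh; first exact: leq_ltn_trans (leq_pred _) (ltn_ord h).
  rewrite ltn_neqAle ltn_ord andbT; apply: contra el => /eqP <-.
  by rewrite /= oh.
pose f (h : 'I_l) : 'I_l := Ordinal (hP h).
have ff : involutive f.
  move=> h; apply: val_inj => /=; case: (boolP (odd h)) => oh /=.
    by case: (val h) oh => // m; rewrite /= => /negbTE ->.
  by rewrite oh.
pose s := perm (inv_inj ff).
rewrite /npair (bigD1 s) ?addn_gt0//=; apply/forallP => h.
rewrite !permE ff eqxx andbT; apply/negP => /eqP/(congr1 val)/=.
case: ifPn => [|_] e; last by move/eqP: e; rewrite eqn_leq ltnn.
by case: (val h) e => // m _ /eqP; rewrite /= eqn_leq ltnn andbF.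
Qed.

(** * Half-edges of a vertex and factorial moments of the edge counts *)

Lemma card_ord_ltn m b : (b <= m)%N -> #|[pred h : 'I_m | (h < b)%N]| = b.
Proof.
move=> bm; rewrite -sum1_card (eq_bigl (fun h : 'I_m => (h < b)%N))//.
by rewrite (big_ord_narrow bm) sum1_card card_ord.
Qed.

Section owner.
Variables (n : nat) (d : 'I_n -> nat).
Local Notation L := (cm_L d).
Local Notation dg := (cm_deg d).
Let S (k : nat) : nat := \sum_(u < n | (u < k)%N) dg u.

Let S0 : S 0 = 0%N. Proof. by rewrite /S big_pred0. Qed.

Let SS (i : 'I_n) : S i.+1 = (S i + dg i)%N.
Proof.
rewrite /S (bigD1 i) ?ltnSn//= addnC; congr (_ + _)%N; apply: eq_bigl => u.
by rewrite ltnS [in RHS]ltn_neqAle andbC.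
Qed.

Let Sn : S n = L.
Proof. by apply: eq_bigl => u; rewrite ltn_ord. Qed.

Let S_mono a b : (a <= b)%N -> (S a <= S b)%N.
Proof.
move=> ab; rewrite /S big_mkcond [leqRHS]big_mkcond; apply: leq_sum => u _.
by case: ifP => // /leq_trans/(_ ab) ->.
Qed.

(** [cm_owner] counts the vertices whose block ends at or before [h]; for [h] in the block of [i]
    these are exactly the vertices below [i]. *)
Let owner_in (h : nat) (i : 'I_n) : (S i <= h < S i.+1)%N -> cm_owner d h = i.
Proof.
move=> /andP[h1 h2]; rewrite /cm_owner -[RHS](@card_ord_ltn n i); last exact: ltnW.
apply: eq_card => v; rewrite !inE.
rewrite (_ : \sum_(u < n | (u <= v)%N) dg u = S v.+1)//.
have [vi|iv] := ltnP v i.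
  by rewrite (leq_trans (S_mono vi)).
by apply/negbTE; rewrite -ltnNge (leq_trans h2)// S_mono.
Qed.

Let block_exists (h : 'I_L) : exists i : 'I_n, (S i <= h < S i.+1)%N.
Proof.
have ex : exists k, (h < S k)%N by exists n; rewrite Sn.
case: (ex_minnP ex) => [[|j]] hj mj; first by rewrite S0 in hj.
have jn : (j < n)%N.
  rewrite ltnNge; apply/negP => nj; have := mj n; rewrite Sn ltn_ord => /(_ isT).
  by rewrite leqNgt ltnS nj.
exists (Ordinal jn); rewrite hj andbT leqNgt; apply/negP => /mj.
by rewrite ltnn.
Qed.

Lemma owner_ltn (h : 'I_L) : (cm_owner d h < n)%N.
Proof. by have [i /owner_in ->] := block_exists h. Qed.

Lemma owner_block (h : 'I_L) (i : 'I_n) :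
  (cm_owner d h == i) = (S i <= h < S i.+1)%N.
Proof.
apply/idP/idP => [/eqP e|/owner_in ->//].
by have [j hj] := block_exists h; have := owner_in hj; rewrite e => /val_inj ->.
Qed.

Lemma card_owner (i : 'I_n) : #|[pred h : 'I_L | cm_owner d h == i]| = dg i.
Proof.
have b1 : (S i.+1 <= L)%N by rewrite -Sn S_mono.
have b2 : (S i <= S i.+1)%N by exact: S_mono.
have := cardID [pred h : 'I_L | (h < S i)%N] [pred h : 'I_L | (h < S i.+1)%N].
rewrite (card_ord_ltn b1) (_ : #|[predI _ & _]| = S i); last first.
  rewrite -[RHS](card_ord_ltn (leq_trans b2 b1)); apply: eq_card => h; rewrite !inE.
  by rewrite andbC; case: (ltnP h (S i)) => //= hi; rewrite (leq_trans hi).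
rewrite (_ : #|[predD _ & _]| = #|[pred h : 'I_L | cm_owner d h == i]|); last first.
  by apply: eq_card => h; rewrite !inE owner_block -leqNgt.
by rewrite SS => /addnI.
Qed.

Local Notation X := (@cm_x n d).

Lemma cm_xE s (i j : 'I_n) : X s i j = (
  \sum_(h : 'I_L | cm_owner d h == i) (cm_owner d (s h) == j))%N.
Proof.
rewrite /cm_x -sum1_card (eq_bigl (fun h : 'I_L => (cm_owner d h == i) && (cm_owner d (s h) == j))).
  by rewrite big_mkcondr; apply: eq_bigr => h _; case: (_ == _).
by move=> h; rewrite inE.
Qed.

Lemma sum_cm_x s (i : 'I_n) : (\sum_(j < n) X s i j)%N = dg i.
Proof.
under eq_bigr => j _ do rewrite cm_xE.
rewrite exchange_big/= -card_owner -sum1_card; apply: eq_big => h; first by rewrite inE.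
move=> hi.
rewrite (bigD1 (Ordinal (owner_ltn (s h))))//= eqxx big1 ?addn0// => j.
by apply: contraNeq; rewrite eqb0 negbK => /eqP e; apply/eqP/val_inj.
Qed.

Let hit (s : {perm 'I_L}) (h : 'I_L) (j : 'I_n) :
  ((cm_owner d (s h) == j) = \sum_(k : 'I_L | cm_owner d k == j) (s h == k) :> nat)%N.
Proof.
have [e|e] := boolP (_ == _).
  rewrite (bigD1 (s h))//= eqxx big1 ?addn0// => k /andP[_].
  by rewrite eq_sym => /negbTE ->.
rewrite big1// => k /eqP kj; case: eqP => // sk.
by rewrite sk kj eqxx in e.
Qed.

(** [cnt1_ub] summed over pairs of half-edges. After division by [npair] it reads
    [E X_ij <= d_i d_j / (L - 1)]. *)
Lemma sum_pairing_x (i j : 'I_n) :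
  (L.-1 * \sum_(s | cm_is_pairing s) X s i j <= dg i * dg j * npair L)%N.
Proof.
rewrite (_ : (\sum_(s | _) X s i j)%N =
    (\sum_(h : 'I_L | cm_owner d h == i) \sum_(k : 'I_L | cm_owner d k == j) cnt1 h k)%N); last first.
  under eq_bigr => s _ do rewrite cm_xE.
  rewrite exchange_big/=; apply: eq_bigr => h _.
  under eq_bigr => s _ do rewrite hit.
  by rewrite exchange_big.
rewrite big_distrr/=; apply: (@leq_trans
  (\sum_(h : 'I_L | cm_owner d h == i) \sum_(k : 'I_L | cm_owner d k == j) npair L)%N).
  apply: leq_sum => h _; rewrite big_distrr/=; apply: leq_sum => k _.
  exact: cnt1_ub.
rewrite sum_nat_const sum_nat_const mulnA.
have c (a : 'I_n) : #|(fun h : 'I_L => cm_owner d h == a)| = dg a.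
  by rewrite -card_owner; apply: eq_card.
by rewrite !c.
Qed.

(** For [i != j] the four half-edges are distinct unless [k1 = k2], and in that case injectivity of
    the pairing makes the count 0. *)
Let cnt2_le (i j : 'I_n) (h1 h2 k1 k2 : 'I_L) : i != j -> h1 != h2 ->
  cm_owner d h1 == i -> cm_owner d h2 == i ->
  cm_owner d k1 == j -> cm_owner d k2 == j ->
  (L.-1 * (L - 3) * cnt2 h1 k1 h2 k2 <= npair L)%N.
Proof.
move=> ij h12 /eqP o1 /eqP o2 /eqP p1 /eqP p2.
have neq (h k : 'I_L) : cm_owner d h = i -> cm_owner d k = j -> h != k.
  move=> oh ok; apply: contra ij => /eqP hk; apply/eqP; apply: val_inj.
  by rewrite /= -oh -ok hk.
have [k12|k12] := eqVneq k1 k2.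
  rewrite /cnt2 big1 ?muln0// => s _; case: eqP => //= s1; case: eqP => //= s2.
  by move: h12; rewrite -(inj_eq (@perm_inj _ s)) s1 s2 k12 eqxx.
rewrite -mulnA; apply: leq_trans (cnt1_ub h1 k1); rewrite leq_mul2l; apply/orP; right.
apply: cnt2_ub; rewrite /= !inE !negb_or !andbT.
by rewrite (neq h1 k1)// h12 (neq h1 k2)// k12 eq_sym (neq h2 k1)// (neq h2 k2).
Qed.

(** The diagonal of the double sum for [X^2] is [X], and removing it leaves the ordered pairs of
    distinct half-edges. *)
Let sqr_x s (i j : 'I_n) : (X s i j * (X s i j - 1) =
  \sum_(h1 : 'I_L | cm_owner d h1 == i) \sum_(h2 : 'I_L | (cm_owner d h2 == i) && (h2 != h1))
    (cm_owner d (s h1) == j) * (cm_owner d (s h2) == j))%N.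
Proof.
rewrite mulnBr muln1 {1 3}cm_xE big_distrl/=.
rewrite (_ : (\sum_(h | _) _ * _)%N = (\sum_(h : 'I_L | cm_owner d h == i) (cm_owner d (s h) == j) +
  \sum_(h1 : 'I_L | cm_owner d h1 == i) \sum_(h2 : 'I_L | (cm_owner d h2 == i) && (h2 != h1))
    (cm_owner d (s h1) == j) * (cm_owner d (s h2) == j))%N); first by rewrite addKn.
rewrite -big_split/=; apply: eq_bigr => h hi.
rewrite cm_xE (bigD1 h)//= mulnDr big_distrr/=; congr (_ + _)%N.
by case: (_ == _).
Qed.

Lemma sum_pairing_x2 (i j : 'I_n) : i != j ->
  (L.-1 * (L - 3) * \sum_(s | cm_is_pairing s) (X s i j * (X s i j - 1))
   <= (dg i * dg j) ^ 2 * npair L)%N.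
Proof.
move=> ij.
rewrite (_ : (\sum_(s | _) _)%N =
    (\sum_(h1 : 'I_L | cm_owner d h1 == i)
    \sum_(h2 : 'I_L | (cm_owner d h2 == i) && (h2 != h1))
    \sum_(k1 : 'I_L | cm_owner d k1 == j)
    \sum_(k2 : 'I_L | cm_owner d k2 == j) cnt2 h1 k1 h2 k2)%N); last first.
  under eq_bigr => s _ do rewrite sqr_x.
  rewrite exchange_big/=; apply: eq_bigr => h1 _.
  rewrite exchange_big/=; apply: eq_bigr => h2 _.
  rewrite [RHS](eq_bigr (fun k1 => \sum_(s : {perm 'I_L} | cm_is_pairing s) \sum_(k2 : 'I_L | cm_owner d k2 == j)
     ((s h1 == k1) && (s h2 == k2)))%N); last first.
    by move=> k1 _; rewrite exchange_big.
  rewrite [RHS]exchange_big/=; apply: eq_bigr => s _.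
  rewrite !hit big_distrl/=; apply: eq_bigr => k1 _.
  by rewrite big_distrr/=; apply: eq_bigr => k2 _; rewrite mulnb.
have c (a : 'I_n) : #|(fun h : 'I_L => cm_owner d h == a)| = dg a.
  by rewrite -card_owner; apply: eq_card.
rewrite big_distrr/=; apply: (@leq_trans
  (\sum_(h1 : 'I_L | cm_owner d h1 == i) (dg i * (dg j * (dg j * npair L))))%N).
  apply: leq_sum => h1 o1; rewrite big_distrr/=; apply: (@leq_trans
    (\sum_(h2 : 'I_L | (cm_owner d h2 == i) && (h2 != h1)) (dg j * (dg j * npair L)))%N).
    apply: leq_sum => h2 /andP[q2 h12]; rewrite big_distrr/=.
    rewrite -[X in (_ <= X * _)%N](c j) -sum_nat_const; apply: leq_sum => k1 p1.
    rewrite big_distrr/= -[X in (_ <= X * _)%N](c j) -sum_nat_const; apply: leq_sum => k2 p2.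
    by apply: (cnt2_le ij _ o1 q2 p1 p2); rewrite eq_sym.
  rewrite sum_nat_const leq_mul2r; apply/orP; right; rewrite -(c i).
  by apply: subset_leq_card; apply/fintype.subsetP => h; rewrite unfold_in => /andP[].
rewrite sum_nat_const c; apply: eq_leq; rewrite expnS expn1.
by rewrite -!mulnA; congr (_ * _)%N; rewrite mulnCA; congr (_ * _)%N; rewrite mulnCA.
Qed.

End owner.

(** * Conditional means over a uniform pairing *)

Section average.
Variables (R : realType) (n : nat) (d : 'I_n -> nat).
Hypothesis n0 : (0 < n)%N.
Local Notation L := (cm_L d).
Local Notation dg := (cm_deg d).
Implicit Types (g h : {perm 'I_L} -> R) (s : {perm 'I_L}).

Lemma cm_LE : L = (\sum_(i < n) d i + odd (\sum_(i < n) d i))%N.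
Proof.
rewrite /cm_L /cm_deg big_split/=; congr (_ + _)%N.
set o := odd _; rewrite (bigD1 (Ordinal n0))//= eqxx andbT big1 ?addn0// => i.
by rewrite -val_eqE/= => /negbTE ->; rewrite andbF.
Qed.

Lemma npair_gt0 : (0 < npair L)%N.
Proof. by apply: pairing_exists; rewrite cm_LE oddD oddb addbb. Qed.

Lemma cm_avgE g : cm_avg g = (\sum_(s | cm_is_pairing s) g s) / (npair L)%:R.
Proof.
rewrite /cm_avg; congr (_ / _%:R); rewrite -sum1_card.
by apply: eq_bigl => s; rewrite inE.
Qed.

Let N0 : 0 < (npair L)%:R :> R. Proof. by rewrite ltr0n npair_gt0. Qed.

Lemma cm_avg_le g h : (forall s, cm_is_pairing s -> g s <= h s) ->
  cm_avg g <= cm_avg h.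
Proof.
move=> gh; rewrite !cm_avgE ler_pM2r ?invr_gt0//; exact: ler_sum.
Qed.

Lemma cm_avg_cst c : @cm_avg R n d (fun=> c) = c.
Proof.
rewrite cm_avgE.
have -> : (npair L)%:R = \sum_(s : {perm 'I_L} | cm_is_pairing s) (1 : R).
  by rewrite /npair natr_sum; apply: eq_bigl.
have e : \sum_(s : {perm 'I_L} | cm_is_pairing s) c =
    c * \sum_(s : {perm 'I_L} | cm_is_pairing s) (1 : R).
  by rewrite mulr_sumr; apply: eq_bigr => s _; rewrite mulr1.
rewrite e mulfK// gt_eqF//.
suff <- : (npair L)%:R = \sum_(s : {perm 'I_L} | cm_is_pairing s) (1 : R) by [].
by rewrite /npair natr_sum; apply: eq_bigl.
Qed.

Lemma cm_avgD g h : cm_avg (fun s => g s + h s) = cm_avg g + cm_avg h.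
Proof. by rewrite !cm_avgE big_split mulrDl. Qed.

Lemma cm_avgZ c g : cm_avg (fun s => c * g s) = c * cm_avg g.
Proof. by rewrite !cm_avgE -mulr_sumr mulrA. Qed.

Lemma cm_avg_sum (I : finType) (P : pred I) (F : I -> {perm 'I_L} -> R) :
  cm_avg (fun s => \sum_(i | P i) F i s) = \sum_(i | P i) cm_avg (F i).
Proof.
rewrite cm_avgE exchange_big/= mulr_suml.
by apply: eq_bigr => i _; rewrite cm_avgE.
Qed.

Lemma cm_avg_dist g c : `|cm_avg g - c| <= cm_avg (fun s => `|g s - c|).
Proof.
rewrite -[c in `|_ - c|]cm_avg_cst !cm_avgE -mulrBl -sumrB normrM.
by rewrite [`|_^-1|]gtr0_norm ?invr_gt0// ler_pM2r ?invr_gt0// ler_norm_sum.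
Qed.

Lemma cm_avg_dist_bound g c M : (forall s, `|g s| <= M) -> `|c| <= M ->
  `|cm_avg g - c| <= 2 * M.
Proof.
move=> gM cM; apply: le_trans (cm_avg_dist _ _) _.
rewrite -[leRHS]cm_avg_cst; apply: cm_avg_le => s _.
apply: le_trans (ler_normB _ _) _; have := gM s; lra.
Qed.

(* Interpolating between the first and second moments of the edge counts leaves
   only moments of the degrees of order [p < gamma], which are finite. *)
Lemma min_le_powR (z p : R) : 0 < z -> 1 <= p <= 2 -> Num.min z (z ^+ 2) <= z `^ p.
Proof.
move=> z0 /andP[p1 p2]; rewrite ge_min; have [z1|z1] := leP z 1.
  apply/orP; right; rewrite -powR_mulrn ?(ltW z0)//.
  by apply: ger_powR; rewrite ?z0.
by apply/orP; left; rewrite le1r_powR ?(ltW z1).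
Qed.

Variables (m p : R).
Hypothesis m0 : 0 < m.
Hypothesis mL : m <= (L - 3)%:R.
Hypothesis p12 : 1 <= p <= 2.

(** The parity term of the corrected degree depends on all vertices at once; this majorant depends
    on [d i] alone, so that weights of different vertices stay independent. *)
Definition wt (i : 'I_n) : R := (d i)%:R + 1.

Lemma wt_ge1 i : 1 <= wt i.
Proof. by rewrite lerDr. Qed.

Lemma dg_wt i : (dg i)%:R <= wt i.
Proof. by rewrite /cm_deg natrD lerD2l lern1 leq_b1. Qed.

Let mL1 : m <= (L.-1)%:R.
Proof. by apply: le_trans mL _; rewrite ler_nat -subn1 leq_sub2l. Qed.

(** Since [m <= L - 3 <= L - 1], the same [z] bounds the mean of [X_ij], and its square bounds that
    of [X_ij (X_ij - 1)]. *)
Let z i j := wt i * wt j / m.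
Let z0 i j : 0 < z i j.
Proof.
by rewrite divr_gt0// mulr_gt0// (lt_le_trans ltr01)// wt_ge1.
Qed.

Local Notation X := (@cm_x n d).

Lemma avg_x i j : cm_avg (fun s => (X s i j)%:R) <= z i j.
Proof.
have := sum_pairing_x d i j; rewrite -(ler_nat R) natrM natr_sum natrM natrM => h.
rewrite cm_avgE ler_pdivrMr// /z mulrAC ler_pdivlMr//.
set S := \sum_(s | _) _ in h *.
have S0 : 0 <= S by apply: sumr_ge0.
apply: (@le_trans _ _ ((dg i)%:R * (dg j)%:R * (npair L)%:R)).
  by apply: le_trans h; rewrite mulrC ler_wpM2r.
by rewrite ler_wpM2r// ler_pM// dg_wt.
Qed.

Lemma avg_x2 i j : i != j -> cm_avg (fun s => (X s i j * (X s i j - 1))%:R) <= z i j ^+ 2.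
Proof.
move=> ij.
have := sum_pairing_x2 d ij; rewrite -(ler_nat R) natrM natr_sum natrM natrM natrX natrM => h.
rewrite cm_avgE ler_pdivrMr// /z expr_div_n mulrAC ler_pdivlMr ?exprn_gt0//.
set S := \sum_(s | _) _ in h *.
have S0 : 0 <= S by apply: sumr_ge0.
apply: (@le_trans _ _ (((dg i)%:R * (dg j)%:R) ^+ 2 * (npair L)%:R)).
  apply: le_trans h; rewrite mulrC ler_wpM2r// expr2 ler_pM// ltW//.
by rewrite ler_wpM2r// lerXn2r ?nnegrE ?mulr_ge0// ?ler_pM ?dg_wt//;
  apply: le_trans (wt_ge1 _).
Qed.

(** With truncated subtraction, [X - 1] is at most [X] and at most [X (X - 1)], also at [X = 0]; the
    two means give [min z z^2]. *)
Lemma avg_x_excess i j : i != j -> cm_avg (fun s => (X s i j - 1)%:R) <= z i j `^ p.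
Proof.
move=> ij; apply: le_trans (min_le_powR (z0 i j) p12); rewrite le_min; apply/andP; split.
  apply: le_trans (avg_x i j); apply: cm_avg_le => s _; by rewrite ler_nat leq_subr.
apply: le_trans (avg_x2 ij); apply: cm_avg_le => s _; rewrite ler_nat.
by case: (X s i j) => // k; rewrite leq_pmull.
Qed.

(** The indicator is at most 1 and at most [X]; multiplied by [z], the two means again give
    [min z z^2]. *)
Lemma avg_x_pos i j : z i j * cm_avg (fun s => (0 < X s i j)%N%:R) <= z i j `^ p.
Proof.
apply: le_trans (min_le_powR (z0 i j) p12); rewrite le_min; apply/andP; split.
  rewrite -[leRHS]mulr1 ler_pM2l// -[leRHS]cm_avg_cst; apply: cm_avg_le => s _.
  by rewrite lern1 leq_b1.
rewrite expr2 ler_pM2l//; apply: le_trans (avg_x i j); apply: cm_avg_le => s _.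
by rewrite ler_nat; case: (X s i j).
Qed.

(** The count of self-loops is at most the degree, and its mean at most [wt^2 / m]; with
    [y = wt / m] these bounds are [m y] and [m y^2]. *)
Lemma avg_x_diag i : cm_avg (fun s => (X s i i)%:R) <= m * (wt i / m) `^ p.
Proof.
have w0 : 0 < wt i by apply: lt_le_trans (wt_ge1 _).
have y0 : 0 < wt i / m by rewrite divr_gt0.
apply: (@le_trans _ _ (m * Num.min (wt i / m) ((wt i / m) ^+ 2))); last first.
  by rewrite ler_pM2l// min_le_powR.
rewrite -ler_pdivrMl// le_min; apply/andP; split.
  rewrite ler_pdivrMl// mulrCA mulfV ?gt_eqF// mulr1 -[leRHS]cm_avg_cst; apply: cm_avg_le => s _.
  apply: le_trans (dg_wt i); rewrite ler_nat -(sum_cm_x s i) (bigD1 i)//=.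
  exact: leq_addr.
rewrite ler_pdivrMl//; apply: le_trans (avg_x i i) _; rewrite /z le_eqVlt; apply/orP; left.
by apply/eqP; field; rewrite gt_eqF.
Qed.

Definition erased s : nat := (\sum_i (dg i - ecm_deg s i))%N.
Definition ecm_cross s : R :=
  \sum_i \sum_j (ecm_x s i j)%:R * (ecm_deg s i)%:R * (ecm_deg s j)%:R.

Lemma ecm_x_le s i j : (ecm_x s i j <= X s i j)%N.
Proof. by rewrite /ecm_x; case: (i != j) => //=; case: (X s i j). Qed.

Lemma ecm_deg_le s i : (ecm_deg s i <= dg i)%N.
Proof. by rewrite -(sum_cm_x s i); apply: leq_sum => j _; exact: ecm_x_le. Qed.

Lemma erased_deg s i : (dg i - ecm_deg s i)%N =
  (X s i i + \sum_(j | j != i) (X s i j - 1))%N.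
Proof.
rewrite -(sum_cm_x s i) /ecm_deg -sumnB; last by move=> j _; exact: ecm_x_le.
rewrite (bigD1 i)//=; congr (_ + _)%N.
  by rewrite /ecm_x eqxx subn0.
apply: eq_bigr => j ji; rewrite /ecm_x eq_sym ji/=; by case: (X s i j).
Qed.

Lemma avg_erased : cm_avg (fun s => (erased s)%:R) <=
  m * \sum_i (wt i / m) `^ p + \sum_i \sum_(j | j != i) (wt i * wt j / m) `^ p.
Proof.
have -> : @cm_avg R n d (fun s => (erased s)%:R) = \sum_i (cm_avg (fun s => (X s i i)%:R) +
    \sum_(j | j != i) cm_avg (fun s => (X s i j - 1)%:R)).
  rewrite [RHS](eq_bigr (fun i => cm_avg (fun s => (X s i i)%:R +
    \sum_(j | j != i) (X s i j - 1)%:R))); last by move=> i _; rewrite cm_avgD cm_avg_sum.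
  rewrite -cm_avg_sum !cm_avgE; congr (_ / _).
  apply: eq_bigr => s _; rewrite /erased natr_sum; apply: eq_bigr => i _.
  by rewrite erased_deg natrD natr_sum.
rewrite big_split/=; apply: lerD.
  by rewrite mulr_sumr; apply: ler_sum => i _; exact: avg_x_diag.
apply: ler_sum => i _; apply: ler_sum => j ji.
by rewrite avg_x_excess// eq_sym.
Qed.

(** The degrees are bounded by the weights, and [wt i * wt j = m z i j], so each term is [m] times
    the quantity of [avg_x_pos]. *)
Lemma avg_cross : cm_avg ecm_cross <=
  m * \sum_i \sum_(j | j != i) (wt i * wt j / m) `^ p.
Proof.
pose Y s := \sum_i \sum_(j | j != i) (m * (z i j * (0 < X s i j)%N%:R)).
apply: (@le_trans _ _ (cm_avg Y)).
  apply: cm_avg_le => s _; apply: ler_sum => i _.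
  rewrite (bigD1 i)//= {1}/ecm_x eqxx !mul0r add0r; apply: ler_sum => j ji.
  rewrite /ecm_x eq_sym ji/= /z mulrA [m * _]mulrC divfK ?gt_eqF//.
  rewrite -mulrA mulrC ler_wpM2r// ler_pM//.
    by apply: le_trans (dg_wt _); rewrite ler_nat ecm_deg_le.
  by apply: le_trans (dg_wt _); rewrite ler_nat ecm_deg_le.
rewrite cm_avg_sum mulr_sumr; apply: ler_sum => i _.
rewrite cm_avg_sum mulr_sumr; apply: ler_sum => j ji.
by rewrite cm_avgZ ler_pM2l// cm_avgZ avg_x_pos.
Qed.

End average.

(** * Stability of the correlation coefficient under erasure *)

(** At [A1 = A], [B1 = B], [N1 = al = 0] and [lam = mu] the two fractions coincide. The point is
    that one [z] serves all [A] and [B] in the compact range. *)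
Lemma ratio_estimate {R : realType} (K dl mu eta : R) :
  0 <= K -> 0 < dl -> 0 < mu -> 0 < eta ->
  exists2 z : R, 0 < z & forall A B A1 B1 N1 lam al : R,
    0 <= A <= K -> dl <= B <= K -> `|A1 - A| <= z -> `|B1 - B| <= z ->
    `|N1| <= z -> `|lam - mu| <= z -> 0 <= al <= z ->
    `|mu * (N1 - A1 ^+ 2 / lam) / (B1 - A1 ^+ 2 * al / lam) - (- A ^+ 2 / B)| <= eta.
Proof.
move=> K0 dl0 mu0 eta0.
(* [G] bounds [A1^2 / lam] once [lam >= mu / 2]. [C1] and [C2] are the errors of numerator and
   denominator per unit of [z]; [C3] combines them after cross-multiplication, its [+ 1] ensuring
   positivity. *)
pose G := 2 * (K + 1) ^+ 2 / mu.
have G0 : 0 <= G by rewrite /G divr_ge0 ?(ltW mu0)// mulr_ge0 ?sqr_ge0.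
pose C1 := mu + G + (2 * K + 1).
pose C2 := 1 + G.
pose C3 := C1 * K + K ^+ 2 * C2 + 1.
have C20 : 0 < C2 by rewrite /C2; lra.
have C10 : 0 <= C1 by rewrite /C1; clear -mu0 G0 K0; lra.
have C30 : 0 < C3.
  by rewrite /C3 ltr_wpDl ?ltr01 ?addr_ge0 ?mulr_ge0 ?sqr_ge0 ?(ltW C20).
pose z := Num.min (Num.min 1 (mu / 2)) (Num.min (dl / 2 / C2) (eta * (dl ^+ 2 / 2) / C3)).
have z0 : 0 < z.
  by rewrite !lt_min ltr01 !divr_gt0// mulr_gt0// divr_gt0// exprn_gt0.
have z1 : z <= 1 by rewrite !ge_min lexx.
have z2 : z <= mu / 2 by rewrite !ge_min lexx orbT.
have z3 : C2 * z <= dl / 2.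
  by rewrite mulrC -ler_pdivlMr// !ge_min lexx !orbT.
have z4 : C3 * z <= eta * (dl ^+ 2 / 2).
  by rewrite mulrC -ler_pdivlMr// !ge_min lexx !orbT.
clearbody z.
exists z => // A B A1 B1 N1 lam al /andP[A0 AK] /andP[dB BK] hA hB hN hl /andP[al0 alz].
have lam0 : mu / 2 <= lam by move: hl; rewrite ler_norml; lra.
have lamp : 0 < lam by lra.
pose q := A1 ^+ 2 / lam.
have A1b : A1 ^+ 2 <= (K + 1) ^+ 2.
  rewrite -real_normK ?num_real// lerXn2r ?nnegrE ?normr_ge0 ?addr_ge0//.
  by move: hA; rewrite !ler_norml; lra.
have q0 : 0 <= q by rewrite divr_ge0 ?sqr_ge0 ?(ltW lamp).
have qG : q <= G.
  rewrite /q ler_pdivrMr// /G; apply: (le_trans A1b).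
  rewrite (_ : 2 * (K + 1) ^+ 2 / mu * lam = (K + 1) ^+ 2 * (lam / (mu / 2))); last first.
    by field; rewrite gt_eqF.
  by rewrite ler_peMr ?sqr_ge0// ler_pdivlMr ?mul1r// divr_gt0.
have qlam : q * lam = A1 ^+ 2 by rewrite /q divfK// gt_eqF.
rewrite (mulrAC (A1 ^+ 2)) -/q.
set u := mu * (N1 - q); set v := B1 - q * al.
have hu : `|u + A ^+ 2| <= C1 * z.
  have -> : u + A ^+ 2 = mu * N1 + q * (lam - mu) + (A - A1) * (A + A1).
    by rewrite /u mulrBr mulrBr qlam; ring.
  have t1 : `|mu * N1| <= mu * z by rewrite normrM gtr0_norm// ler_pM2l.
  have t2 : `|q * (lam - mu)| <= G * z by rewrite normrM ger0_norm// ler_pM.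
  have t3 : `|(A - A1) * (A + A1)| <= (2 * K + 1) * z.
    rewrite normrM mulrC ler_pM// 1?distrC//.
    by move: hA; rewrite !ler_norml; lra.
  move: t1 t2 t3; rewrite /C1; generalize (mu * N1) (q * (lam - mu)) ((A - A1) * (A + A1)).
  by move=> a b c; rewrite !ler_norml; lra.
have hv : `|v - B| <= C2 * z.
  have t1 : 0 <= q * al <= G * z by rewrite mulr_ge0//= ler_pM.
  move: t1 hB; rewrite /v /C2; generalize (q * al) => x; rewrite !ler_norml; lra.
have vd : dl / 2 <= v by move: hv z3; rewrite ler_norml; lra.
have v0 : 0 < v by lra.
have B0 : 0 < B by lra.
have -> : u / v - - A ^+ 2 / B = ((u + A ^+ 2) * B + A ^+ 2 * (v - B)) / (v * B).
  by field; rewrite !gt_eqF.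
rewrite normrM [`|_^-1|]gtr0_norm ?invr_gt0 ?mulr_gt0// ler_pdivrMr ?mulr_gt0//.
apply: (@le_trans _ _ (C3 * z)).
  apply: (le_trans (ler_normD _ _)); rewrite normrM (gtr0_norm B0) (normrM (A ^+ 2)) (ger0_norm (sqr_ge0 A)).
  have t1 : `|u + A ^+ 2| * B <= C1 * z * K by rewrite ler_pM// ltW.
  have t2 : A ^+ 2 * `|v - B| <= K ^+ 2 * (C2 * z).
    by rewrite ler_pM ?sqr_ge0// lerXn2r// nnegrE.
  apply: (le_trans (lerD t1 t2)); rewrite /C3 -subr_ge0.
  by rewrite (_ : _ - _ = z); [exact: ltW|ring].
apply: (le_trans z4); rewrite ler_pM2l// expr2 mulrAC ler_pM// ltW//.
by rewrite divr_gt0.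
Qed.

Section erased_close.
Variables (R : realType) (n : nat) (d : 'I_n -> nat) (a : R) (s : {perm 'I_(cm_L d)}).
Hypothesis n0 : (0 < n)%N.
Hypothesis a0 : 0 < a.
Local Notation dg := (cm_deg d).
Local Notation v0 := (Ordinal n0).

(** Scaled degrees: [x] after the parity correction, [y] after erasure, [t] as sampled. Both [y] and
    [t] lie below [x] but need not be comparable, so they are compared through [x]. *)
Let x i : R := (dg i)%:R / a.
Let y i : R := (ecm_deg s i)%:R / a.
Let t i : R := (d i)%:R / a.
Let w0 : R := wt R d v0 / a.
Let eps : R := (erased s)%:R / a.

Let y0 i : 0 <= y i. Proof. by rewrite divr_ge0// ltW. Qed.
Let t0 i : 0 <= t i. Proof. by rewrite divr_ge0// ltW. Qed.
Let yx i : y i <= x i. Proof. by rewrite ler_pM2r ?invr_gt0// ler_nat ecm_deg_le. Qed.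
Let tx i : t i <= x i. Proof. by rewrite ler_pM2r ?invr_gt0// ler_nat leq_addr. Qed.
Let x0 i : 0 <= x i. Proof. exact: le_trans (tx i). Qed.

Let sum_xy : \sum_i (x i - y i) = eps.
Proof.
rewrite /eps /erased natr_sum mulr_suml; apply: eq_bigr => i _.
by rewrite /x /y -mulrBl natrB// ecm_deg_le.
Qed.

Let sum_parity k : \sum_i x i ^+ k.+1 <= \sum_i t i ^+ k.+1 + w0 ^+ k.+1.
Proof.
rewrite (bigD1 v0)// [\sum_i t i ^+ _](bigD1 v0)//= addrAC; apply: lerD; last first.
  apply: ler_sum => i; rewrite -val_eqE/= /x /t /cm_deg => /negbTE ->.
  by rewrite andbF addn0.
apply: (@le_trans _ _ (w0 ^+ k.+1)); last by rewrite lerDr exprn_ge0.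
have w00 : 0 <= w0 by rewrite divr_ge0 ?(ltW a0)// (le_trans _ (wt_ge1 _ _ _)).
by rewrite lerXn2r ?nnegrE// ler_pM2r ?invr_gt0// dg_wt.
Qed.

Let sum_pow_le k (u v : 'I_n -> R) : (forall i, 0 <= u i <= v i) ->
  \sum_i u i ^+ k <= \sum_i v i ^+ k.
Proof.
move=> uv; apply: ler_sum => i _; have /andP[u0 uvi] := uv i.
by rewrite lerXn2r// nnegrE// (le_trans u0).
Qed.

Variables (K z mu : R).
Hypothesis z01 : 0 <= z <= 1.
Hypothesis AK : \sum_i t i ^+ 2 <= K.
Hypothesis w0z : w0 <= z.
Hypothesis epsz : eps <= z.

Let K0 : 0 <= K.
Proof. by apply: le_trans AK; apply: sumr_ge0 => i _; exact: sqr_ge0. Qed.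

Let w00 : 0 <= w0.
Proof. by rewrite divr_ge0 ?(ltW a0)// (le_trans _ (wt_ge1 _ _ _)). Qed.

Let w0X k : w0 ^+ k.+1 <= z.
Proof.
case/andP: z01 => z0 z1; rewrite exprS -[leRHS]mulr1 ler_pM// ?exprn_ge0//.
by rewrite exprn_ile1// (le_trans w0z).
Qed.

Let A1K : \sum_i x i ^+ 2 <= K + 1.
Proof.
have := sum_parity 1; have := w0X 1; case/andP: z01; move: AK; lra.
Qed.

Lemma erased_sum2 : `|\sum_i y i ^+ 2 - \sum_i t i ^+ 2| <= (3 * K + 4) * z.
Proof.
have h1 := sum_parity 1; have h2 := w0X 1.
have h3 : \sum_i y i ^+ 2 <= \sum_i x i ^+ 2 by apply: sum_pow_le => i; rewrite y0 yx.
have h4 : \sum_i t i ^+ 2 <= \sum_i x i ^+ 2 by apply: sum_pow_le => i; rewrite t0 tx.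
have h5 : \sum_i x i ^+ 2 - \sum_i y i ^+ 2 <= 2 * (K + 2) * z.
  apply: (@le_trans _ _ (2 * (K + 2) * eps)); last by rewrite ler_wpM2l// mulr_ge0// addr_ge0.
  rewrite -sumrB -sum_xy mulr_sumr; apply: ler_sum => i _.
  rewrite subr_sqr mulrC ler_wpM2r ?subr_ge0//.
  have xi : x i <= K + 2.
    have : x i ^+ 2 <= K + 1.
      by apply: le_trans A1K; rewrite (bigD1 i)//= lerDl sumr_ge0// => j _; exact: sqr_ge0.
    (* The inequality [2 x <= x^2 + 1] bounds [x] without a square root. *)
    have := sqr_ge0 (x i - 1); rewrite (_ : (x i - 1) ^+ 2 = x i ^+ 2 - 2 * x i + 1); last by ring.
    by move: K0; lra.
  by have := yx i; lra.
case/andP: z01 => z0 z1; have Kz : 0 <= K * z by rewrite mulr_ge0.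
by rewrite ler_norml; lra.
Qed.

Lemma erased_sum3 : `|\sum_i y i ^+ 3 - \sum_i t i ^+ 3| <= (3 * K + 4) * z.
Proof.
have h1 := sum_parity 2; have h2 := w0X 2.
have h3 : \sum_i y i ^+ 3 <= \sum_i x i ^+ 3 by apply: sum_pow_le => i; rewrite y0 yx.
have h4 : \sum_i t i ^+ 3 <= \sum_i x i ^+ 3 by apply: sum_pow_le => i; rewrite t0 tx.
have h5 : \sum_i x i ^+ 3 - \sum_i y i ^+ 3 <= 3 * (K + 1) * z.
  apply: (@le_trans _ _ (3 * (K + 1) * eps)); last by rewrite ler_wpM2l// mulr_ge0// addr_ge0.
  rewrite -sumrB -sum_xy mulr_sumr; apply: ler_sum => i _.
  have -> : x i ^+ 3 - y i ^+ 3 = (x i ^+ 2 + x i * y i + y i ^+ 2) * (x i - y i) by ring.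
  rewrite ler_wpM2r ?subr_ge0//.
  have xi : x i ^+ 2 <= K + 1.
    by apply: le_trans A1K; rewrite (bigD1 i)//= lerDl sumr_ge0// => j _; exact: sqr_ge0.
  have t1 : x i * y i <= x i ^+ 2 by rewrite expr2 ler_wpM2l.
  have t2 : y i ^+ 2 <= x i ^+ 2 by rewrite lerXn2r// nnegrE.
  lra.
case/andP: z01 => z0 z1; have Kz : 0 <= K * z by rewrite mulr_ge0.
by rewrite ler_norml; lra.
Qed.

Hypothesis lz : `|(\sum_i (d i)%:R) / n%:R - mu| <= z.
Hypothesis anz : a / n%:R <= z.
Hypothesis nz : n%:R^-1 <= z.

(** The erased total is the sampled one plus the parity bit minus [erased]; divided by [n], the last
    two are at most [1 / n] and [z a / n]. *)
Lemma erased_sum1 : `|(\sum_i (ecm_deg s i)%:R) / n%:R - mu| <= (3 * K + 4) * z.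
Proof.
case/andP: z01 => z0 z1; have Kz : 0 <= K * z by rewrite mulr_ge0.
have n0' : 0 < n%:R :> R by rewrite ltr0n.
have h1 : \sum_i (ecm_deg s i)%:R = \sum_i (d i)%:R +
    (odd (\sum_i d i))%:R - (erased s)%:R :> R.
  rewrite -!natr_sum -natrD -cm_LE// /cm_L -natrB.
    congr _%:R; rewrite /erased -sumnB; last by move=> i _; exact: leq_subr.
    by apply: eq_bigr => i _; rewrite subKn// ecm_deg_le.
  by apply: leq_sum => i _; exact: leq_subr.
have h2 : (erased s)%:R / n%:R <= z.
  have -> : (erased s)%:R / n%:R = eps * (a / n%:R).
    by rewrite /eps; field; rewrite !gt_eqF.
  rewrite -[leRHS]mulr1 ler_pM ?divr_ge0 ?(ltW a0)//; exact: le_trans z1.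
have h3 : 0 <= (erased s)%:R / n%:R :> R by rewrite divr_ge0.
have h5 : 0 <= (odd (\sum_i d i))%:R / n%:R :> R by rewrite divr_ge0.
have h4 : (odd (\sum_i d i))%:R / n%:R <= z.
  apply: le_trans nz; rewrite -[leRHS]mul1r ler_wpM2r ?invr_ge0//.
  by rewrite lern1 leq_b1.
move: lz h2 h3 h4 h5; rewrite h1 mulrBl mulrDl !ler_norml.
move: (_ / n%:R) ((odd _)%:R / n%:R) ((erased s)%:R / n%:R) => p q r; lra.
Qed.

(** The identity holds even if [l] or the denominator of the coefficient vanishes: their inverses
    are generalised to variables before [field] is called. *)
Lemma pearson_scaled : mu * n%:R / a * ecm_pearson s =
  mu * (n%:R * ecm_cross R s / a ^+ 4 -
      (\sum_i y i ^+ 2) ^+ 2 / ((\sum_i (ecm_deg s i)%:R) / n%:R)) /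
  (\sum_i y i ^+ 3 - (\sum_i y i ^+ 2) ^+ 2 * (a / n%:R) /
      ((\sum_i (ecm_deg s i)%:R) / n%:R)).
Proof.
have n0' : n%:R != 0 :> R by rewrite pnatr_eq0 -lt0n.
have a0' : a != 0 by rewrite gt_eqF.
rewrite /ecm_pearson /pearson -/(ecm_cross R s) /=.
have sy k : \sum_i y i ^+ k = (\sum_i (ecm_deg s i)%:R ^+ k) / a ^+ k.
  by rewrite mulr_suml; apply: eq_bigr => i _; rewrite /y expr_div_n.
rewrite !sy invf_div.
move: (ecm_cross R s) (\sum_i (ecm_deg s i)%:R ^+ 2) (\sum_i (ecm_deg s i)%:R ^+ 3)
  (\sum_i (ecm_deg s i)%:R) => N s2 s3 l.
have -> : s3 / a ^+ 3 - (s2 / a ^+ 2) ^+ 2 * (a / n%:R) * (n%:R / l) = (s3 - s2 ^+ 2 / l) / a ^+ 3.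
  by move: (l^-1) => k; field; rewrite n0' a0'.
rewrite invf_div; move: (l^-1) ((s3 - _)^-1) => k j.
by field; rewrite ?n0' ?a0'.
Qed.

End erased_close.

(** * Comparison of the coefficient with its limit form for fixed degrees *)

Section conditional_estimate.
Variable (R : realType).

Definition pair_sum n (d : 'I_n -> nat) (m p : R) : R :=
  \sum_i \sum_(j | j != i) (wt R d i * wt R d j / m) `^ p.

Definition erased_sum n (d : 'I_n -> nat) (m p : R) : R :=
  m * \sum_i (wt R d i / m) `^ p + pair_sum d m p.

(* Bounds the conditional mean of [erased / a + n ecm_cross / a^4]. *)
Definition defect n (d : 'I_n -> nat) (a m p : R) : R :=
  erased_sum d m p / a + n%:R * (m * pair_sum d m p) / a ^+ 4.

(** Strict monotonicity of the exponential converts a deviation of [Ln / n] from [mu] into a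
    deviation of the variable treated in [wlln]. *)
Lemma expN_separated (mu z : R) : 0 < z -> exists2 rho : R, 0 < rho &
  forall x, z < `|x - mu| -> rho <= `|expR (- x) - expR (- mu)|.
Proof.
move=> z0; pose r1 := expR (- mu) - expR (- (mu + z)).
pose r2 := expR (- (mu - z)) - expR (- mu).
exists (Num.min r1 r2).
  by rewrite lt_min !subr_gt0 !ltr_expR; apply/andP; split; lra.
move=> x; rewrite ltr_normr => /orP[h|h].
  rewrite ge_min; apply/orP; left; rewrite -normrN ler_normr; apply/orP; left.
  by rewrite opprB lerB// ler_expR; lra.
rewrite ge_min; apply/orP; right; rewrite ler_normr; apply/orP; left.
by rewrite lerB// ler_expR; lra.
Qed.

(** The tolerance [z] depends neither on [n] nor on the degrees, so the estimate can be integrated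
    over the sample afterwards. *)
Lemma avg_close (f : R -> R) (M K dl mu eta : R) : continuous f -> (forall x, `|f x| <= M) ->
  0 <= K -> 0 < dl -> 0 < mu -> 0 < eta -> exists2 z : R, 0 < z &
  forall n (d : 'I_n -> nat) (a p : R) (n0 : (0 < n)%N), 0 < a -> 1 <= p <= 2 ->
  let A := \sum_i ((d i)%:R / a) ^+ 2 in
  let B := \sum_i ((d i)%:R / a) ^+ 3 in
  A <= K -> dl <= B <= K -> wt R d (Ordinal n0) / a <= z ->
  `|(\sum_i (d i)%:R) / n%:R - mu| <= z -> a / n%:R <= z -> n%:R^-1 <= z ->
  `|@cm_avg R n d (fun s => f (mu * n%:R / a * ecm_pearson s)) - f (- A ^+ 2 / B)| <=
  eta + 2 * M * (z^-1 * defect d a (mu / 4 * n%:R) p).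
Proof.
move=> cf fM K0 dl0 mu0 eta0.
have M0 : 0 <= M by exact: le_trans (normr_ge0 _) (fM 0).
have [r r0 hr] := unif_continuous_itv (- (K ^+ 2 / dl)) 0 cf eta0.
have r20 : 0 < r / 2 by rewrite divr_gt0.
have [z1 z10 hz1] := ratio_estimate K0 dl0 mu0 r20.
have C0 : 0 < 3 * K + 4 by rewrite ltr_wpDl// mulr_ge0.
(* The bound [mu / 12] leaves room for [mu n / 4 <= L - 3]; the factor [3 K + 4] is the constant of
   the three comparisons of sums. *)
pose z := Num.min (Num.min 1 (mu / 12)) (Num.min z1 (z1 / (3 * K + 4))).
have z0 : 0 < z by rewrite !lt_min ltr01 z10 !divr_gt0.
have zle1 : z <= 1 by rewrite !ge_min lexx.
have zmu : z <= mu / 12 by rewrite !ge_min lexx orbT.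
have zz1 : z <= z1 by rewrite !ge_min lexx !orbT.
have Cz : (3 * K + 4) * z <= z1 by rewrite mulrC -ler_pdivlMr// !ge_min lexx !orbT.
clearbody z.
exists z => // n d a p n0 a0 p12 A B AK /andP[dB BK] w0z lz anz nz.
have n0' : 0 < n%:R :> R by rewrite ltr0n.
have A0 : 0 <= A by apply: sumr_ge0 => i _; exact: sqr_ge0.
have B0 : 0 < B by exact: lt_le_trans dB.
have z01 : 0 <= z <= 1 by rewrite (ltW z0).
have q0 : - (K ^+ 2 / dl) <= - A ^+ 2 / B <= 0.
  rewrite mulNr lerN2 oppr_le0 divr_ge0 ?sqr_ge0 ?(ltW B0)// andbT.
  rewrite ler_pM ?sqr_ge0 ?invr_ge0 ?(ltW B0)//; first by rewrite lerXn2r// nnegrE.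
  by rewrite lef_pV2 ?posrE.
pose m := mu / 4 * n%:R.
have m0 : 0 < m by rewrite mulr_gt0// divr_gt0.
have mL : m <= (cm_L d - 3)%:R.
  have h1 : (cm_L d)%:R - 3 <= (cm_L d - 3)%:R :> R.
    by rewrite lerBlDr -natrD ler_nat addnC -leq_subLR.
  apply: le_trans h1.
  have h2 : \sum_i (d i)%:R <= (cm_L d)%:R :> R.
    by rewrite -natr_sum ler_nat cm_LE// leq_addr.
  have h3 : (mu - mu / 12) * n%:R <= \sum_i (d i)%:R.
    by rewrite -ler_pdivlMr//; move: lz; rewrite ler_norml; lra.
  have h4 : 3 <= 3 * (mu / 12) * n%:R.
    have : 1 <= z * n%:R by rewrite -ler_pdivrMr// mul1r.
    have : z * n%:R <= mu / 12 * n%:R by rewrite ler_pM2r.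
    lra.
  have mn : 0 <= mu * n%:R by rewrite mulr_ge0 ?ltW.
  by rewrite /m; move: h2 h3 h4 mn; lra.
have pt (s : {perm 'I_(cm_L d)}) :
    `|f (mu * n%:R / a * ecm_pearson s) - f (- A ^+ 2 / B)| <=
    eta + 2 * M * (z^-1 * ((a^-1 * (erased s)%:R) + (n%:R / a ^+ 4) * ecm_cross R s)).
  have e0 : 0 <= a^-1 * (erased s)%:R by rewrite mulr_ge0 ?invr_ge0 ?(ltW a0).
  have c0 : 0 <= (n%:R / a ^+ 4) * ecm_cross R s.
    rewrite mulr_ge0 ?divr_ge0 ?exprn_ge0 ?(ltW a0)//.
    by apply: sumr_ge0 => i _; apply: sumr_ge0 => j _; rewrite !mulr_ge0.
  (* Markov's inequality in pointwise form: where the error exceeds [z], the trivial bound [2 M] is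
     at most [2 M / z] times the error; elsewhere [ratio_estimate] applies. *)
  have [bad|good] := ltP z (a^-1 * (erased s)%:R + (n%:R / a ^+ 4) * ecm_cross R s).
    apply: (@le_trans _ _ (2 * M)).
      apply: (le_trans (ler_normB _ _)).
      have := fM (mu * n%:R / a * ecm_pearson s); have := fM (- A ^+ 2 / B); lra.
    rewrite ler_wpDl ?(ltW eta0)// ler_peMr ?mulr_ge0//.
    by rewrite mulrC ler_pdivlMr// mul1r ltW.
  have ez : (erased s)%:R / a <= z by rewrite mulrC; move: good c0; lra.
  have cz : n%:R * ecm_cross R s / a ^+ 4 <= z by rewrite mulrAC; move: good e0; lra.
  have cz0 : 0 <= n%:R * ecm_cross R s / a ^+ 4 by rewrite mulrAC.
  apply: (@le_trans _ _ eta); last first.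
    rewrite lerDl mulr_ge0 ?mulr_ge0// ?addr_ge0//; by rewrite invr_ge0 ltW.
  rewrite distrC; apply: hr => //; rewrite distrC; apply: (@le_lt_trans _ _ (r / 2)); last by lra.
  rewrite pearson_scaled//; apply: hz1.
  - by rewrite A0.
  - by rewrite dB.
  - apply: le_trans Cz; exact: (erased_sum2 a0 z01 AK w0z ez).
  - apply: le_trans Cz; exact: (erased_sum3 a0 z01 AK w0z ez).
  - by rewrite ger0_norm//; apply: le_trans zz1.
  - apply: le_trans Cz; exact: (erased_sum1 n0 a0 z01 AK ez lz anz nz).
  - by rewrite divr_ge0 ?(ltW a0)//= (le_trans anz).
apply: le_trans (cm_avg_dist n0 _ _) _.
apply: le_trans (cm_avg_le n0 (fun s _ => pt s)) _.
rewrite cm_avgD cm_avg_cst// lerD2l cm_avgZ ler_wpM2l ?mulr_ge0// cm_avgZ ler_pM2l ?invr_gt0//.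
rewrite cm_avgD !cm_avgZ -/m /defect; apply: lerD.
  by rewrite mulrC ler_pM2r ?invr_gt0//; exact: (avg_erased n0 m0 mL p12).
rewrite [leRHS]mulrAC ler_wpM2l ?divr_ge0 ?exprn_ge0 ?(ltW a0)//.
exact: (avg_cross n0 m0 mL p12).
Qed.

End conditional_estimate.

(** * The number of erased edges *)

Lemma natr_powRN_cvg0 {R : realType} (dl : R) : 0 < dl ->
  n%:R `^ (- dl) @[n --> \oo] --> (0 : R).
Proof.
move=> d0; apply/cvgrPdist_le => e e0; near=> n.
have n0 : e^-1 `^ dl^-1 <= n%:R by near: n; exact: nbhs_infty_ger.
have ei : 0 < e^-1 by rewrite invr_gt0.
have np : 0 < n%:R :> R by apply: lt_le_trans n0; exact: powR_gt0.
rewrite sub0r normrN ger0_norm ?powR_ge0// powRN -[leRHS]invrK lef_pV2 ?posrE ?powR_gt0//.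
have -> : e^-1 = (e^-1 `^ dl^-1) `^ dl by rewrite -powRrM mulVf ?gt_eqF// powRr1// ltW.
by apply: ge0_ler_powR; rewrite ?nnegrE ?powR_ge0 ?(ltW d0) ?(ltW np).
Unshelve. all: by end_near. Qed.

(* Since [a_n >= c n^b] eventually, the last two conditions make [n^(4-p) / a_n^4]
   and [n^(2-p) / a_n] vanish; they are compatible with [p < gamma] and
   [b < 1/gamma] because [(gamma - 2)^2] and [(gamma - 1)^2] are positive. *)
Lemma erased_exponents {R : realType} (gamma : R) : 1 < gamma < 2 -> exists p b : R,
  [/\ 1 < p < gamma, 0 < b < gamma^-1, 4 - p < 4 * b & 2 - p < b].
Proof.
move=> /andP[g1 g2]; have g0 : 0 < gamma by lra.
pose u := (gamma - 2) ^+ 2 / gamma; pose v := (gamma - 1) ^+ 2 / gamma.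
have ue : u = gamma + 4 * gamma^-1 - 4 by rewrite /u; field; rewrite gt_eqF.
have ve : v = gamma + gamma^-1 - 2 by rewrite /v; field; rewrite gt_eqF.
have u0 : 0 < u by rewrite divr_gt0// exprn_even_gt0//= subr_eq0 lt_eqF.
have v0 : 0 < v by rewrite divr_gt0// exprn_even_gt0//= subr_eq0 gt_eqF.
pose t := Num.min (Num.min (u / 6) (v / 3)) ((gamma - 1) / 3).
have g10 : 0 < gamma - 1 by rewrite subr_gt0.
have t0 : 0 < t by rewrite !lt_min (divr_gt0 u0) ?(divr_gt0 v0) ?(divr_gt0 g10).
have t1 : t <= u / 6 by rewrite !ge_min lexx.
have t2 : t <= v / 3 by rewrite !ge_min lexx orbT.
have t3 : t <= (gamma - 1) / 3 by rewrite !ge_min lexx orbT.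
by exists (gamma - t), (gamma^-1 - t); split; try (apply/andP; split); lra.
Qed.

(** * Nonnegative variables with bounded mean *)

Section integral_bounds.
Context {d} {T : measurableType d} {R : realType} (P : probability T R).

(** Powers of the degrees are unbounded and outside the scope of [bmf]; an upper bound on the
    extended integral is all that is required of them. *)
Definition mean_le (X : T -> R) (c : R) : Prop :=
  [/\ measurable_fun setT X, (forall w, 0 <= X w) &
      (\int[P]_w (X w)%:E <= c%:E)%E].

Lemma mean_leD X Y a b : mean_le X a -> mean_le Y b ->
  mean_le (fun w => X w + Y w) (a + b).
Proof.
move=> [mX X0 Xa] [mY Y0 Yb]; split.
- exact: measurable_funD.
- by move=> w; rewrite addr_ge0.
- under eq_integral do rewrite EFinD.
  rewrite ge0_integralD//; try by move=> w _; rewrite lee_fin.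
  + by rewrite EFinD; exact: leeD.
  + exact/measurable_EFinP.
  + exact/measurable_EFinP.
Qed.

Lemma mean_leZ X a k : 0 <= k -> mean_le X a -> mean_le (fun w => k * X w) (k * a).
Proof.
move=> k0 [mX X0 Xa]; split.
- by apply: measurable_funM => //; exact: measurable_cst.
- by move=> w; rewrite mulr_ge0.
- under eq_integral do rewrite EFinM.
  rewrite ge0_integralZl//.
  + by rewrite EFinM; apply: lee_wpmul2l => //; rewrite lee_fin.
  + exact/measurable_EFinP.
  + by move=> w _; rewrite lee_fin.
Qed.

Lemma mean_le0 : mean_le (fun=> 0) 0.
Proof.
by split => //; rewrite integral0.
Qed.

Lemma mean_le_sum (I : Type) (r : seq I) (Q : pred I) (F : I -> T -> R) (c : I -> R) :
  (forall i, Q i -> mean_le (F i) (c i)) ->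
  mean_le (fun w => \sum_(i <- r | Q i) F i w) (\sum_(i <- r | Q i) c i).
Proof.
move=> h; elim: r => [|i r IH].
  have -> : (fun w => \sum_(i <- [::] | Q i) F i w) = (fun=> 0).
    by apply/funext => w; rewrite big_nil.
  rewrite big_nil; exact: mean_le0.
have -> : (fun w => \sum_(i <- i :: r | Q i) F i w) =
    (fun w => if Q i then F i w + \sum_(i <- r | Q i) F i w else \sum_(i <- r | Q i) F i w).
  by apply/funext => w; rewrite big_cons.
rewrite big_cons; case: ifPn => // Qi; exact: mean_leD (h i Qi) IH.
Qed.

Lemma mean_le_trans X a b : a <= b -> mean_le X a -> mean_le X b.
Proof. by move=> ab [mX X0 Xa]; split => //; apply: le_trans Xa _; rewrite lee_fin. Qed.

Lemma mean_le_dom (X Y : T -> R) a : measurable_fun setT Y -> (forall w, 0 <= Y w <= X w) ->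
  mean_le X a -> mean_le Y a.
Proof.
move=> mY YX [mX X0 Xa]; split => //; first by move=> w; case/andP: (YX w).
apply: le_trans Xa; apply: ge0_le_integral => //; try exact/measurable_EFinP;
  by move=> w _; rewrite lee_fin; case/andP: (YX w).
Qed.

End integral_bounds.

(** * Mean of the defect under the degree law *)

Section sample.
Context {R : realType} {dD : measure_display} {TD : measurableType dD}
  (PD : probability TD R) (D : nat -> TD -> nat) (gamma : R).
Hypothesis mD : forall i, measurable_fun [set: TD] (D i).
Hypothesis iD : mutually_independent PD D.
Hypothesis idD : forall i k, PD (D i @^-1` [set k]) = PD (D 0%N @^-1` [set k]).

Definition sample n w (i : 'I_n) : nat := D i w.

(** The degree vector ranges over a countable set, so every function of it is measurable. This
    covers [cm_avg], where even the set of pairings depends on the degrees. *)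
Lemma measurable_sample n (H : ('I_n -> nat) -> R) :
  measurable_fun setT (fun w => H (sample w)).
Proof.
move=> _ B mB; rewrite setTI.
have -> : (fun w => H (@sample n w)) @^-1` B =
    \bigcup_(v : {ffun 'I_n -> nat})
      ([set w | B (H v)] `&` [set w | forall i : 'I_n, D i w = v i]).
  apply/seteqP; split => w /=.
    move=> h; exists [ffun i : 'I_n => D i w] => //; split => /=; last first.
      by move=> i; rewrite ffunE.
    by rewrite (_ : (fun_of_fin _) = @sample n w)//; apply/funext => i; rewrite ffunE.
  by move=> [v _ [/= h e]]; rewrite (_ : @sample n w = v)//; apply/funext => i; exact: e.
apply: countable_bigcupT_measurable; first exact: countableP.
move=> v; apply: measurableI.
  have [h|h] := pselect (B (H v)).
    by rewrite (_ : [set _ | _] = setT)//; apply/seteqP; split.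
  by rewrite (_ : [set _ | _] = set0)//; apply/seteqP; split.
rewrite (_ : [set _ | _] = \bigcap_(i : 'I_n) (D i @^-1` [set v i])); last first.
  apply/seteqP; split => w /= h i; first by move=> _; exact: h.
  exact: (h i I).
apply: fin_bigcap_measurable; first exact: finite_finset.
by move=> i _; exact: measurable_natset.
Qed.

Section defect_mean.
Variables (p C : R).
Hypothesis p1g : 1 < p < gamma.
Hypothesis C0 : 0 < C.
Hypothesis hC : (\int[PD]_w (((D 0%N w)%:R + 1) `^ p)%:E <= C%:E)%E.

Let W i w : R := ((D i w)%:R + 1) `^ p.

Let mean_W i : mean_le PD (W i) C.
Proof.
split; last 1 first.
- rewrite /W (@integral_idD _ _ _ _ _ mD idD i (fun k => (k%:R + 1) `^ p))//.
- exact: (measurable_sample (fun v : 'I_i.+1 -> nat => ((v ord_max)%:R + 1) `^ p)).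
- by move=> w; exact: powR_ge0.
Qed.

Let mean_W2 i j : i != j -> mean_le PD (fun w => W i w * W j w) (C ^+ 2).
Proof.
move=> ij; split.
- by apply: measurable_funM; [case: (mean_W i)|case: (mean_W j)].
- by move=> w; rewrite mulr_ge0// powR_ge0.
- exact: (moment_pair mD iD idD (ltW C0) ij hC).
Qed.

(** The diagonal is excluded in [pair_sum], so the two weights are independent and only moments of
    order [p] occur. The summand [(D_0 + 1) / a] accounts for the parity correction at vertex 0. *)
Lemma mean_defect n (a m : R) : (0 < n)%N -> 0 < a -> 0 < m ->
  mean_le PD (fun w => defect (@sample n w) a m p + ((D 0%N w)%:R + 1) / a)
   (m `^ (- p) * ((m * n%:R * C + n%:R ^+ 2 * C ^+ 2) / a +
      n%:R * m * n%:R ^+ 2 * C ^+ 2 / a ^+ 4) + C / a).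
Proof.
move=> n0 a0 m0; have mi : 0 <= m by exact: ltW.
have w0 k : 0 <= k%:R + 1 :> R by rewrite addr_ge0.
have wt0 w i : 0 <= wt R (@sample n w) i by exact: w0.
have pm : mean_le PD (fun w => pair_sum (@sample n w) m p)
    (m `^ (- p) * (n%:R ^+ 2 * C ^+ 2)).
  have e w : pair_sum (@sample n w) m p =
      m `^ (- p) * \sum_i \sum_(j : 'I_n | j != i) (W i w * W j w).
    rewrite /pair_sum mulr_sumr; apply: eq_bigr => i _.
    rewrite mulr_sumr; apply: eq_bigr => j _.
    by rewrite (powR_div p (mulr_ge0 (wt0 w i) (wt0 w j)) mi) (powRM p (wt0 w i) (wt0 w j)) powRN mulrC.
  rewrite (_ : (fun w => _) = (fun w => m `^ (- p) * \sum_i \sum_(j : 'I_n | j != i) (W i w * W j w))); last first.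
    by apply/funext.
  apply: mean_leZ; first exact: powR_ge0.
  apply: (@mean_le_trans _ _ _ _ _ (\sum_(i < n) \sum_(j < n | j != i) C ^+ 2)).
    rewrite (_ : n%:R ^+ 2 * C ^+ 2 = \sum_(i < n) \sum_(j < n) C ^+ 2); last first.
      by rewrite !sumr_const card_ord -mulrnA -[RHS]mulr_natl natrM expr2.
    apply: ler_sum => i _; rewrite [leRHS](bigD1 i)//= lerDr; exact: sqr_ge0.
  apply: mean_le_sum => i _; apply: mean_le_sum => j ji; apply: mean_W2.
  by rewrite eq_sym.
have sm : mean_le PD (fun w => \sum_(i < n) (wt R (@sample n w) i / m) `^ p)
    (m `^ (- p) * (n%:R * C)).
  rewrite (_ : (fun w => _) = (fun w => m `^ (- p) * \sum_(i < n) W i w)); last first.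
    apply/funext => w; rewrite mulr_sumr; apply: eq_bigr => i _.
    by rewrite (powR_div p (wt0 w i) mi) powRN mulrC.
  apply: mean_leZ; first exact: powR_ge0.
  rewrite (_ : n%:R * C = \sum_(i < n) C); last by rewrite sumr_const card_ord mulr_natl.
  by apply: mean_le_sum.
have wm : mean_le PD (fun w => (D 0%N w)%:R + 1) C.
  apply: mean_le_dom (mean_W 0%N).
    exact: (measurable_sample (fun v : 'I_1 -> nat => (v ord0)%:R + 1)).
  move=> w; rewrite w0/= /W; apply: le1r_powR; first by rewrite lerDr.
  by case/andP: p1g => /ltW.
have ai : 0 <= a^-1 by rewrite invr_ge0 ltW.
have h1 := mean_leZ ai (mean_leD (mean_leZ mi sm) pm).
have k0 : 0 <= n%:R * m / a ^+ 4 by rewrite divr_ge0 ?mulr_ge0 ?exprn_ge0 ?(ltW a0).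
have h2 := mean_leZ k0 pm.
have h3 := mean_leZ ai wm.
have h := mean_leD (mean_leD h1 h2) h3.
have -> : (fun w => defect (@sample n w) a m p + ((D 0%N w)%:R + 1) / a) =
   (fun w => a^-1 * (m * (\sum_(i < n) (wt R (@sample n w) i / m) `^ p) +
       pair_sum (@sample n w) m p) +
     n%:R * m / a ^+ 4 * pair_sum (@sample n w) m p + a^-1 * ((D 0%N w)%:R + 1)).
  apply/funext => w; rewrite /defect /erased_sum.
  move: (\sum_(i < n) _) (pair_sum _ _ _) ((D 0%N w)%:R + 1) (a^-1) (a ^+ 4) => x1 x2 x3 x4 x5.
  rewrite [x3 * _]mulrC; congr (_ + _ + _); first by rewrite mulrC.
  by rewrite mulrA mulrAC.
apply: mean_le_trans h.
move: (m `^ (- p)) (a^-1) ((a ^+ 4)^-1) => x1 x2 x3.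
by rewrite le_eqVlt; apply/orP; left; apply/eqP; ring.
Qed.

End defect_mean.
End sample.

(** * The erasure error vanishes in mean *)

Section erased_sample.
Context {R : realType} (gamma : R) (L : R -> R)
  {dD : measure_display} {TD : measurableType dD} (PD : probability TD R)
  (D : nat -> TD -> nat).
Hypothesis g12 : 1 < gamma < 2.
Hypothesis Lsv : slowly_varying L.
Hypothesis mD : forall i, measurable_fun [set: TD] (D i).
Hypothesis iD : mutually_independent PD D.
Hypothesis idD : forall i k, PD (D i @^-1` [set k]) = PD (D 0%N @^-1` [set k]).
Hypothesis tD : forall t : R, 0 < t ->
  PD [set w | t < (D 0%N w)%:R] = (L t * t `^ (- gamma))%:E.
Local Notation an := (an PD D).
Local Notation Fb := (Fb PD D).
Local Notation mu := (meanD PD D).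
Local Notation sample := (@sample _ _ D _).

Let Fbni := Fb_ni PD mD.
Let Fbgt0 := Fb_gt0 Lsv mD tD.
Let Fble1 := Fb_le1 PD mD.
Let Fbrv := Fb_rv Lsv mD tD.
Let mu0 : 0 < mu := meanD_gt0 g12 Lsv mD tD.

Definition edge_defect p n w : R :=
  defect (sample w : 'I_n -> nat) (an n) (mu / 4 * n%:R) p + ((D 0%N w)%:R + 1) / an n.

Lemma an_div_cvg0 : an n / n%:R @[n --> \oo] --> (0 : R).
Proof.
have g1 : 1 < gamma by case/andP: g12.
have c := aR_sublinear (gamma_gt0 g12) Fbni Fbgt0 Fble1 Fbrv g1.
exact: (@cvg_comp _ _ _ (fun n : nat => n%:R : R) (fun t => aR Fb t / t) _ _ _ (@cvgr_idn R) c).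
Qed.

Lemma an_inv_cvg0 : (an n)^-1 @[n --> \oo] --> (0 : R).
Proof.
apply/gtr0_cvgV0; last exact: (an_cvgy g12 Lsv mD tD).
by have := an_cvgy g12 Lsv mD tD; move/cvgryPgt; exact.
Qed.

Lemma mean_edge_defect : exists2 p : R, 1 <= p <= 2 &
  forall e : R, 0 < e -> \forall n \near \oo, mean_le PD (edge_defect p n) e.
Proof.
have [p [b [p1g hb h4 h2]]] := erased_exponents g12.
have p12 : 1 <= p <= 2 by move: p1g g12 => /andP[? ?] /andP[? ?]; apply/andP; split; lra.
exists p => // e e0.
have [|C C0 hC] := @moment_fin R gamma L dD TD PD D Lsv mD tD p.
  by move: p1g => /andP[? ?]; apply/andP; split; lra.
have [c c0 hc] := aR_growth (gamma_gt0 g12) Fbni Fbgt0 Fble1 Fbrv hb.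
pose k := mu / 4; have k0 : 0 < k by rewrite divr_gt0.
(* The constants that remain in [mean_defect] after setting [m = k n] and inserting [an n >= c n^b];
   the powers of [n] left over have negative exponents by the choice of [p] and [b]. *)
pose G1 := k `^ (- p) * (k * C + C ^+ 2) / c.
pose G2 := k `^ (- p) * k * C ^+ 2 / c ^+ 4.
have G10 : 0 <= G1.
  by rewrite /G1 divr_ge0 ?(ltW c0)// mulr_ge0 ?powR_ge0// addr_ge0 ?sqr_ge0// mulr_ge0 ?ltW.
have G20 : 0 <= G2.
  by rewrite /G2 divr_ge0 ?exprn_ge0 ?(ltW c0)// mulr_ge0 ?sqr_ge0// mulr_ge0 ?powR_ge0 ?ltW.
have lim : G1 * n%:R `^ (- (b - (2 - p))) + G2 * n%:R `^ (- (4 * b - (4 - p))) + C / an n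
    @[n --> \oo] --> G1 * 0 + G2 * 0 + C * 0.
  apply: cvgD; first apply: cvgD.
  - by apply: cvgM; [exact: cvg_cst|apply: natr_powRN_cvg0; lra].
  - by apply: cvgM; [exact: cvg_cst|apply: natr_powRN_cvg0; lra].
  - by apply: cvgM; [exact: cvg_cst|exact: an_inv_cvg0].
rewrite !mulr0 !addr0 in lim.
have hcn : \forall n \near \oo, c * n%:R `^ b <= an n.
  exact: (@cvgr_idn R _ hc).
near=> n.
have n0 : (0 < n)%N by near: n; exact: nbhs_infty_gt.
have n0' : 0 < n%:R :> R by rewrite ltr0n.
have can : c * n%:R `^ b <= an n by near: n; exact: hcn.
have nb0 : 0 < n%:R `^ b :> R by rewrite powR_gt0.
have cn0 : 0 < c * n%:R `^ b by rewrite mulr_gt0.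
have a0 : 0 < an n by apply: lt_le_trans can.
have m0 : 0 < mu / 4 * n%:R by rewrite mulr_gt0.
apply: (mean_le_trans _ (mean_defect mD iD idD p1g C0 hC n0 a0 m0)).
apply: (@le_trans _ _ (G1 * n%:R `^ (- (b - (2 - p))) + G2 * n%:R `^ (- (4 * b - (4 - p))) + C / an n)); last first.
  by near: n; exact: (cvgr_le _ lim).
rewrite lerD2r powRM ?(ltW k0) ?(ltW n0')// -/k.
have nn : n%:R != 0 :> R by rewrite gt_eqF.
have e2 : n%:R `^ (- p) * n%:R ^+ 2 = n%:R `^ (2 - p).
  by rewrite -powR_mulrn ?(ltW n0')// -powRD ?nn ?implybT// addrC.
have e4 : n%:R `^ (- p) * n%:R ^+ 4 = n%:R `^ (4 - p).
  by rewrite -powR_mulrn ?(ltW n0')// -powRD ?nn ?implybT// addrC.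
have i1 : (an n)^-1 <= (c * n%:R `^ b)^-1 by rewrite lef_pV2 ?posrE.
have i4 : (an n ^+ 4)^-1 <= ((c * n%:R `^ b) ^+ 4)^-1.
  by rewrite lef_pV2 ?posrE ?exprn_gt0// lerXn2r ?nnegrE ?(ltW cn0) ?(ltW a0).
rewrite (_ : _ * _ = k `^ (- p) * (k * C + C ^+ 2) * n%:R `^ (2 - p) * (an n)^-1 +
   k `^ (- p) * k * C ^+ 2 * n%:R `^ (4 - p) * (an n ^+ 4)^-1); last first.
  rewrite -e2 -e4; move: ((an n)^-1) ((an n ^+ 4)^-1) => x1 x2; ring.
apply: lerD.
  rewrite (_ : G1 * _ = k `^ (- p) * (k * C + C ^+ 2) * n%:R `^ (2 - p) * (c * n%:R `^ b)^-1).
    rewrite ler_wpM2l// !mulr_ge0 ?powR_ge0// addr_ge0 ?sqr_ge0// mulr_ge0 ?(ltW k0) ?(ltW C0)//.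
  rewrite /G1 invfM -(powRN _ b) (_ : - (b - (2 - p)) = (2 - p) + - b); last by ring.
  rewrite (powRD (r := 2 - p)) ?nn ?implybT//; move: (c^-1) => x1; ring.
rewrite (_ : G2 * _ = k `^ (- p) * k * C ^+ 2 * n%:R `^ (4 - p) * ((c * n%:R `^ b) ^+ 4)^-1).
  by rewrite ler_wpM2l// mulr_ge0 ?powR_ge0// mulr_ge0 ?sqr_ge0// mulr_ge0 ?powR_ge0// ltW.
have e5 : ((n%:R `^ b) ^+ 4)^-1 = n%:R `^ (- (b * 4)).
  by rewrite powRN powRrM powR_mulrn// powR_ge0.
rewrite /G2 [(c * _) ^+ 4]exprMn (invfM (c ^+ 4)) e5.
rewrite (_ : - (4 * b - (4 - p)) = (4 - p) + - (b * 4)); last by ring.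
rewrite (powRD (r := 4 - p)) ?nn ?implybT//; move: ((c ^+ 4)^-1) => x1; ring.
Unshelve. all: by end_near. Qed.

End erased_sample.

(** * Limit of the erased coefficient and the normalisation *)

Lemma defect_ge0 {R : realType} n (d : 'I_n -> nat) (a m p : R) : 0 <= a -> 0 <= m ->
  0 <= defect d a m p.
Proof.
move=> a0 m0.
have q0 : 0 <= pair_sum d m p.
  by apply: sumr_ge0 => i _; apply: sumr_ge0 => j _; exact: powR_ge0.
rewrite /defect /erased_sum addr_ge0//; last first.
  by rewrite divr_ge0 ?exprn_ge0// mulr_ge0// mulr_ge0.
rewrite divr_ge0// addr_ge0// mulr_ge0//.
by apply: sumr_ge0 => i _; exact: powR_ge0.
Qed.

Lemma tail_bound_ge0 {R : realType} (s dl a b : R) : 0 <= s -> 0 <= a -> 0 <= b ->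
  0 <= tail_bound s dl a b.
Proof.
move=> s0 a0 b0; rewrite addr_ge0 ?mulr_ge0 ?expR_ge0// subr_ge0 expR_le1 oppr_le0.
by rewrite addr_ge0// mulr_ge0.
Qed.

Section erased_limit.
Context {R : realType} (gamma : R) (L : R -> R)
  {dD : measure_display} {TD : measurableType dD} (PD : probability TD R)
  (D : nat -> TD -> nat).
Hypothesis g12 : 1 < gamma < 2.
Hypothesis Lsv : slowly_varying L.
Hypothesis mD : forall i, measurable_fun [set: TD] (D i).
Hypothesis iD : mutually_independent PD D.
Hypothesis idD : forall i k, PD (D i @^-1` [set k]) = PD (D 0%N @^-1` [set k]).
Hypothesis tD : forall t : R, 0 < t ->
  PD [set w | t < (D 0%N w)%:R] = (L t * t `^ (- gamma))%:E.
Local Notation an := (an PD D).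
Local Notation Fb := (Fb PD D).
Local Notation mu := (meanD PD D).
Local Notation An := (An PD D).
Local Notation Bn := (Bn PD D).
Local Notation Ln := (@Ln R _ _ D).
Local Notation sample := (@sample _ _ D _).

Let mu0 : 0 < mu := meanD_gt0 g12 Lsv mD tD.

Definition ecm_mean n (c : R) (f : R -> R) w : R :=
  @cm_avg R n (sample w) (fun s => f (c * ecm_pearson s)).

Lemma measurable_An n : measurable_fun setT (An n).
Proof. exact: (measurable_sample mD (fun v : 'I_n -> nat => \sum_i ((v i)%:R / an n) ^+ 2)). Qed.

Lemma measurable_Bn n : measurable_fun setT (Bn n).
Proof. exact: (measurable_sample mD (fun v : 'I_n -> nat => \sum_i ((v i)%:R / an n) ^+ 3)). Qed.

Lemma bmf_ecm_mean n c f M : (0 < n)%N -> (forall x, `|f x| <= M) -> bmf (ecm_mean n c f).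
Proof.
move=> n0 fM; split.
  exact: (measurable_sample mD (fun v : 'I_n -> nat => @cm_avg R n v (fun s => f (c * ecm_pearson s)))).
exists (2 * M) => w; rewrite -[X in `|X|]subr0; apply: cm_avg_dist_bound => //.
by rewrite normr0; exact: le_trans (normr_ge0 _) (fM 0).
Qed.

Lemma bmf_ratio n (f : R -> R) M : (forall x, `|f x| <= M) ->
  bmf (fun w => f (- An n w ^+ 2 / Bn n w)).
Proof.
move=> fM; split; last by exists M.
exact: (measurable_sample mD (fun v : 'I_n -> nat =>
  f (- (\sum_i ((v i)%:R / an n) ^+ 2) ^+ 2 / (\sum_i ((v i)%:R / an n) ^+ 3)))).
Qed.

(** Outside a bad event the pointwise estimate of [avg_close] holds; on it the difference is at most
    [2 M]. Each source of badness is dominated by a bounded variable with small mean, and the means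
    are added. *)
Lemma ecm_mean_close (f : R -> R) (M : R) : continuous f -> (forall x, `|f x| <= M) ->
  (forall e : R, 0 < e -> exists s dl, [/\ 0 < s, 0 < dl &
    \forall n \near \oo, Ex PD (fun w => tail_bound s dl (An n w) (Bn n w)) <= e]) ->
  Ex PD (ecm_mean n (mu * n%:R / an n) f) - Ex PD (fun w => f (- An n w ^+ 2 / Bn n w))
  @[n --> \oo] --> (0 : R).
Proof.
move=> cf fM tight; apply/cvgrPdist_le => e e0.
have M0 : 0 <= M by exact: le_trans (normr_ge0 _) (fM 0).
(* Three error variables of mean at most [e1], each weighted by [2 M], add up to [e] with the
   [e / 4] of [avg_close]. *)
pose e1 := e / (8 * (M + 1)).
have e10 : 0 < e1 by rewrite divr_gt0// mulr_gt0// ltr_wpDl.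
have Me1 : 2 * M * e1 <= e / 4.
  rewrite /e1 mulrA ler_pdivrMr ?mulr_gt0 ?ltr_wpDl//.
  by move: M0 e0; nra.
have e40 : 0 < e / 4 by rewrite divr_gt0.
have [s [dl [s0 d0 tn]]] := tight e1 e10.
pose K := Num.max s^-1 dl.
have sK : s^-1 <= K by rewrite le_max lexx.
have K0 : 0 <= K by rewrite le_max (ltW d0) orbT.
have [z z0 hz] := avg_close cf fM K0 d0 mu0 e40.
have [rho rho0 hrho] := expN_separated mu z0.
have r20 : 0 < rho ^+ 2 by rewrite exprn_gt0.
have [p p12 hp] := mean_edge_defect g12 Lsv mD iD idD tD.
have zi : 0 < z^-1 by rewrite invr_gt0.
near=> n.
have n0 : (0 < n)%N by near: n; exact: nbhs_infty_gt.
have n0' : 0 < n%:R :> R by rewrite ltr0n.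
have a0 : 0 < an n.
  by near: n; have := an_cvgy g12 Lsv mD tD; move/cvgryPgt; exact.
have anz : an n / n%:R <= z.
  by near: n; exact: (cvgr_le _ (an_div_cvg0 g12 Lsv mD tD)).
have nz : n%:R^-1 <= z.
  rewrite invf_ple ?posrE//; near: n; exact: nbhs_infty_ger.
have ht : Ex PD (fun w => tail_bound s dl (An n w) (Bn n w)) <= e1 by near: n.
have hsq0 : Ex PD (fun w => (expR (- (Ln n w / n%:R)) - expR (- mu)) ^+ 2) <= e1 * rho ^+ 2.
  near: n; apply: (cvgr_le _ (wlln g12 Lsv mD iD idD tD)).
  by rewrite mulr_gt0.
pose sq w := (expR (- (Ln n w / n%:R)) - expR (- mu)) ^+ 2.
have hU : mean_le PD (edge_defect PD D p n) (e1 * z).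
  by near: n; apply: hp; rewrite mulr_gt0.
(* Truncation at 1 makes the defect a bounded variable; below 1 nothing is lost, and at 1 the
   trivial bound is used. *)
pose V w := Num.min 1 (z^-1 * edge_defect PD D p n w).
have [mU U0 iU] := hU.
have V0 w : 0 <= V w by rewrite le_min ler01 mulr_ge0// ltW.
have mV : measurable_fun setT V.
  apply: measurable_minr; first exact: measurable_cst.
  by apply: measurable_funM => //; exact: measurable_cst.
have bV : bmf V.
  split => //; exists 1 => w; rewrite ger0_norm//.
  by rewrite ge_min lexx.
have hV : Ex PD V <= e1.
  have [mZ _ iZ] := mean_leZ (ltW zi) hU.
  apply: (Ex_le_integral (Y := fun w => z^-1 * edge_defect PD D p n w)) => //.
  - by move=> w; rewrite V0/= ge_min lexx orbT.
  - by apply: (le_trans iZ); rewrite lee_fin mulrCA mulVf ?mulr1// gt_eqF.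
have bsq : bmf sq.
  split; last first.
    exists 1 => w; rewrite ger0_norm ?sqr_ge0// /sq -[leRHS](expr1n _ 2).
    rewrite -real_normK ?num_real// lerXn2r ?nnegrE//.
    have x1 : expR (- (Ln n w / n%:R)) <= 1 by rewrite expR_le1 oppr_le0 divr_ge0// Ln_ge0.
    have x2 : expR (- mu) <= 1 by rewrite expR_le1 oppr_le0 ltW.
    have x3 := expR_ge0 (- (Ln n w / n%:R)); have x4 := expR_ge0 (- mu).
    by rewrite ler_norml; lra.
  exact: (measurable_sample mD (fun v : 'I_n -> nat =>
    (expR (- ((\sum_i (v i)%:R) / n%:R)) - expR (- mu)) ^+ 2)).
have bt : bmf (fun w => tail_bound s dl (An n w) (Bn n w)).
  apply: bmf_tail_bound => //; [exact: measurable_An|exact: measurable_Bn| |].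
  - by move=> w; exact: An_ge0.
  - by move=> w; exact: Bn_ge0.
have ba := bmf_ecm_mean (mu * n%:R / an n) n0 fM.
have br := bmf_ratio n fM.
have bs1 := bmfM (bmf_cst (rho ^+ 2)^-1) bsq.
have bb := bmfD (bmfD bt bs1) bV.
(* One summand is at least 1 in each bad case: the pair outside the compact set, [Ln / n] far from
   [mu], or a defect of at least [z]. In the good case the last one bounds the error term of
   [avg_close]. *)
pose G w := tail_bound s dl (An n w) (Bn n w) + (rho ^+ 2)^-1 * sq w + V w.
have pt w : `|ecm_mean n (mu * n%:R / an n) f w - f (- An n w ^+ 2 / Bn n w)| <=
    e / 4 + 2 * M * G w.
  have t0 : 0 <= tail_bound s dl (An n w) (Bn n w).
    by apply: tail_bound_ge0; rewrite ?(ltW s0) ?An_ge0 ?Bn_ge0.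
  have s0' : 0 <= (rho ^+ 2)^-1 * sq w by rewrite mulr_ge0 ?sqr_ge0 ?invr_ge0 ?(ltW r20).
  have big : 1 <= G w -> `|ecm_mean n (mu * n%:R / an n) f w - f (- An n w ^+ 2 / Bn n w)| <=
      e / 4 + 2 * M * G w.
    move=> h; apply: (@le_trans _ _ (2 * M)); first exact: cm_avg_dist_bound.
    rewrite -[leLHS]add0r; apply: lerD; first exact: ltW.
    by rewrite ler_peMr// mulr_ge0.
  have [good|bad] := boolP [&& An n w <= K, dl <= Bn n w & Bn n w <= K]; last first.
    apply: big; rewrite /G -addrA ler_wpDr ?addr_ge0//.
    by apply: (one_le_tail_bound s0 d0 sK _ _ bad); [exact: An_ge0|exact: Bn_ge0].
  have [far|near] := ltP z `|Ln n w / n%:R - mu|.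
    apply: big; rewrite /G ler_wpDr// ler_wpDl//.
    rewrite mulrC ler_pdivlMr// mul1r /sq -[leRHS]real_normK ?num_real//.
    by rewrite lerXn2r ?nnegrE ?(ltW rho0)//; exact: hrho.
  have [Ubig|Usmall] := leP 1 (z^-1 * edge_defect PD D p n w).
    have V1 : V w = 1 by rewrite /V min_l.
    by apply: big; rewrite /G V1 lerDr addr_ge0.
  case/and3P: good => AK dB BK.
  have def0 : 0 <= defect (sample w : 'I_n -> nat) (an n) (mu / 4 * n%:R) p.
    by apply: defect_ge0; rewrite ?(ltW a0)// mulr_ge0// divr_ge0// ltW.
  have w00 : 0 <= ((D 0%N w)%:R + 1) / an n by rewrite divr_ge0 ?(ltW a0)// addr_ge0.
  have w0z : wt R (sample w : 'I_n -> nat) (Ordinal n0) / an n <= z.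
    have : edge_defect PD D p n w <= z.
      by move: Usmall; rewrite mulrC ltr_pdivrMr// mul1r => /ltW.
    by apply: le_trans; rewrite /edge_defect /wt /= lerDr.
  have dBK : dl <= Bn n w <= K by rewrite dB.
  apply: (le_trans (hz n (sample w) (an n) p n0 a0 p12 AK dBK w0z near anz nz)).
  have VU : V w = z^-1 * edge_defect PD D p n w by rewrite /V min_r// ltW.
  rewrite lerD2l ler_wpM2l ?mulr_ge0// /G VU.
  apply: (@le_trans _ _ (z^-1 * edge_defect PD D p n w)).
    by rewrite ler_pM2l// /edge_defect lerDl.
  by rewrite lerDr addr_ge0.
rewrite sub0r normrN; apply: (le_trans (Ex_dist PD ba br)).
apply: (@le_trans _ _ (Ex PD (fun w => e / 4 + 2 * M * G w))).
  apply: Ex_le => //; [exact: bmf_norm (bmfB ba br)|].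
  exact: bmfD (bmf_cst _) (bmfM (bmf_cst _) bb).
rewrite (ExD PD (bmf_cst _) (bmfM (bmf_cst _) bb)) Ex_cst (ExZ PD _ bb).
rewrite /G (ExD PD (bmfD bt bs1) bV) (ExD PD bt bs1) (ExZ PD _ bsq).
have hs : (rho ^+ 2)^-1 * Ex PD sq <= e1 by rewrite mulrC ler_pdivrMr.
have : 2 * M * (Ex PD (fun w => tail_bound s dl (An n w) (Bn n w)) +
    (rho ^+ 2)^-1 * Ex PD sq + Ex PD V) <= 2 * M * (e1 + e1 + e1).
  rewrite ler_wpM2l ?mulr_ge0//; apply: lerD => //; exact: lerD.
move: Me1; set x := 2 * M; move: (Ex PD (fun w => tail_bound _ _ _ _)) (_ * Ex PD sq) (Ex PD V) => y1 y2 y3.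
by rewrite !mulrDr; lra.
Unshelve. all: by end_near. Qed.

Definition edge_scale (t : R) : R := t `^ gamma^-1 / aR Fb t.

(** By [aR_ratio] the quantile varies regularly with index [1 / gamma], which the numerator cancels;
    measurability comes from monotonicity of the quantile. *)
Lemma slowly_varying_edge_scale : slowly_varying edge_scale.
Proof.
have g0' := gamma_gt0 g12.
have Fbni := Fb_ni PD mD; have Fbgt0 := Fb_gt0 Lsv mD tD.
have Fble1 := Fb_le1 PD mD; have Fbrv := Fb_rv Lsv mD tD.
have ay := aR_cvgy g0' Fbni Fbgt0 Fble1 Fbrv.
have apos : \forall t \near +oo, 0 < aR Fb t by move/cvgryPgt : ay; exact.
split; [|split].
- apply: measurable_funM; first exact: measurable_powR.
  apply: measurable_inv_ge0; last by move=> t; exact: aR_ge0.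
  apply: nondecreasing_measurable => //.
  by move=> x y xy; exact: (aR_nd g0' Fbni Fbgt0 Fble1 Fbrv).
- near=> t; rewrite divr_gt0//; last by near: t.
  by rewrite powR_gt0//; near: t; exact: nbhs_pinfty_gt.
- move=> lam lam0.
  have c := aR_ratio g0' Fbni Fbgt0 Fble1 Fbrv lam0.
  have l0 : lam `^ gamma^-1 != 0 by rewrite gt_eqF// powR_gt0.
  have c2 : lam `^ gamma^-1 * (aR Fb (lam * t) / aR Fb t)^-1 @[t --> +oo] --> lam `^ gamma^-1 * (lam `^ gamma^-1)^-1.
    by apply: cvgM; [exact: cvg_cst|exact: cvgV].
  rewrite mulfV// in c2.
  apply: cvg_trans c2; apply: near_eq_cvg; near=> t.
  have t0 : 0 < t by near: t; exact: nbhs_pinfty_gt.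
  rewrite /edge_scale powRM ?(ltW lam0) ?(ltW t0)// !invfM !invrK.
  have tn : t `^ gamma^-1 != 0 by rewrite gt_eqF// powR_gt0.
  move: tn; move: (t `^ gamma^-1) ((aR Fb (lam * t))^-1) => x y x0.
  by field.
Unshelve. all: by end_near. Qed.

Lemma edge_scaleE n : (0 < n)%N ->
  mu * edge_scale n%:R * n%:R `^ (1 - gamma^-1) = mu * n%:R / an n.
Proof.
move=> n0; have n0' : 0 < n%:R :> R by rewrite ltr0n.
rewrite /edge_scale -!mulrA; congr (_ * _).
rewrite mulrA mulrAC -powRD ?(gt_eqF n0') ?implybT//.
by rewrite addrC subrK powRr1// ltW.
Qed.

End erased_limit.

Unset Implicit Arguments.

Theorem theorem1p2 (R : realType) (gamma : R) (L : R -> R)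
  (dD : measure_display) (TD : measurableType dD) (PD : probability TD R)
  (D : nat -> TD -> nat) :
  1 < gamma < 2 ->
  slowly_varying L ->
  (forall i, measurable_fun [set: TD] (D i)) ->
  mutually_independent PD D ->
  (forall i k, PD (D i @^-1` [set k]) = PD (D 0%N @^-1` [set k])) ->
  (forall t : R, 0 < t ->
     PD [set w | t < (D 0%N w)%:R] = (L t * t `^ (- gamma))%:E) ->
  let mu : R := fine ('E_PD[fun w => (D 0%N w)%:R])%E in
  exists L1 : R -> R, slowly_varying L1 /\
  forall (dX : measure_display) (TX : measurableType dX)
         (PX : probability TX R) (xi : nat -> TX -> R),
    (forall i, measurable_fun [set: TX] (xi i)) ->
    mutually_independent PX xi ->
    (forall i (A : set R), measurable A ->
       PX (xi i @^-1` A) = exponential_prob 1 A) ->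
    forall f : R -> R, continuous f -> (exists M : R, forall x, `|f x| <= M) ->
      ecm_expect PD D n (mu * L1 n%:R * n%:R `^ (1 - gamma^-1)) f
        @[n --> \oo] --> ('E_PX[f \o stable_limit xi gamma])%E.
Proof.
move=> g12 Lsv mD iD idD tD mu.
exists (edge_scale gamma PD D); split; first exact: (slowly_varying_edge_scale g12 Lsv mD tD).
move=> dX TX PX xi mxi ixi exi f cf [M fM].
pose A' := fS xi gamma 2; pose B' := fS xi gamma 3.
have mA' : measurable_fun setT A' by exact: measurable_fS.
have mB' : measurable_fun setT B' by exact: measurable_fS.
have A'0 w : 0 <= A' w by exact: fS_ge0.
have B'0 w : 0 <= B' w by exact: fS_ge0.
have lapn s t : 0 <= s -> 0 <= t -> 0 < s + t ->
    Ex PD (fun w => expR (- (s * An PD D n w + t * Bn PD D n w))) @[n --> \oo] -->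
    expR (- lapI gamma s t).
  by move=> s0 t0 _; exact: (laplace_sample g12 Lsv mD iD idD tD s0 t0).
have lap' s t : 0 <= s -> 0 <= t -> 0 < s + t ->
    Ex PX (fun w => expR (- (s * A' w + t * B' w))) = expR (- lapI gamma s t).
  by move=> s0 t0 st; exact: laplace_stable.
have tight e : 0 < e -> exists s dl, [/\ 0 < s, 0 < dl &
    \forall n \near \oo, Ex PD (fun w => tail_bound s dl (An PD D n w) (Bn PD D n w)) <= e].
  move=> e0; have [s [dl [s0 d0 h _]]] := tightness (measurable_An PD mD)
    (measurable_Bn PD mD) mA' mB' (An_ge0 PD D) (Bn_ge0 PD D) A'0 B'0 lapn lap'
    (lapI_small g12) (lapI_large g12) e0.
  by exists s, dl.
have c1 := ecm_mean_close g12 Lsv mD iD idD tD cf fM tight.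
have c2 := ratio_weak_cvg (measurable_An PD mD) (measurable_Bn PD mD) mA' mB'
  (An_ge0 PD D) (Bn_ge0 PD D) A'0 B'0 lapn lap' (lapI_small g12) (lapI_large g12) cf fM.
have br' : bmf (fun w => f (- A' w ^+ 2 / B' w)).
  split; last by exists M.
  apply: (measurableT_comp (continuous_measurable_fun cf)); apply: measurable_funM.
    by apply: measurable_funN; exact: measurable_funX.
  exact: measurable_inv_ge0.
have -> : ('E_PX[f \o stable_limit xi gamma] = (Ex PX (fun w => f (- A' w ^+ 2 / B' w)))%:E)%E.
  by rewrite unlock -(ExE PX br').
(* The ratio of the sampled power sums is the intermediary: close in mean to the erased coefficient,
   and convergent by its transforms. *)
have c3 : Ex PD (ecm_mean D n (mu * n%:R / an PD D n) f) @[n --> \oo] -->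
    Ex PX (fun w => f (- A' w ^+ 2 / B' w)).
  have c : (Ex PD (ecm_mean D n (mu * n%:R / an PD D n) f) -
      Ex PD (fun w => f (- An PD D n w ^+ 2 / Bn PD D n w))) +
      Ex PD (fun w => f (- An PD D n w ^+ 2 / Bn PD D n w)) @[n --> \oo] -->
      0 + Ex PX (fun w => f (- A' w ^+ 2 / B' w)) by exact: cvgD c1 c2.
  rewrite add0r in c; apply: cvg_trans c; apply: near_eq_cvg.
  by apply: nearW => n; rewrite subrK.
have eE n : (0 < n)%N ->
    ecm_expect PD D n (mu * edge_scale gamma PD D n%:R * n%:R `^ (1 - gamma^-1)) f =
    (Ex PD (ecm_mean D n (mu * n%:R / an PD D n) f))%:E.
  move=> n0; rewrite (edge_scaleE gamma PD D n0) /ecm_expect unlock.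
  by rewrite -(ExE PD (bmf_ecm_mean mD _ n0 fM)).
apply: cvg_EFin.
  near=> n; have n0 : (0 < n)%N by near: n; exact: nbhs_infty_gt.
  by rewrite eE.
apply: cvg_trans c3; apply: near_eq_cvg; near=> n.
have n0 : (0 < n)%N by near: n; exact: nbhs_infty_gt.
by rewrite /= eE.
Unshelve. all: by end_near. Qed.
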